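(* There is a unique function $\mathrm{lk}_2$ from the set of 2-component links to $\mathbb{Z}/2$ such that (i) $\mathrm{lk}_2$ is an isotopy invariant, i.e. it takes equal values on isotopic links; (ii) $\mathrm{lk}_2$ assumes value $0$ on the trivial link; (iii) for any 2-component links $K_+$ and $K_-$ having plane diagrams that differ by a crossing change of a crossing $A$, $$\mathrm{lk}_2 K_+-\mathrm{lk}_2 K_- =\begin{cases}1 & \text{if } A \text{ is a crossing of different components,}\\ 0 & \text{if } A \text{ is a self-crossing of one component.}\end{cases}$$
   Context: A knot is a closed non-self-intersecting polygonal line in $\mathbb{R}^3$ (non-oriented). A link is an ordered collection of pairwise disjoint knots, called its components. The trivial link is a link formed by triangles in parallel planes. Elementary move: suppose that two sides $AC$ and $CB$ of a triangle $ABC$ are edges of a component of a link and that the link and the (filled) triangle $ABC$ do not intersect at any other points. The elementary move $ACB\to AB$ replaces the edges $AC$, $CB$ by $AB$; the inverse operation is also an elementary move; if $ABC$ is degenerate, an elementary move is subdivision of an edge or its inverse. Two links are isotopic if one is obtained from the other by a finite sequence of elementary moves through links (preserving the order of components). A plane diagram of a link is its generic projection onto a plane, together with the information which part of the link goes under and which part goes over at every crossing. (A union of polygonal lines in the plane is generic if there are polygonal lines $L$ with the same union of edges such that no 3 vertices of $L$ belong to a line and no 3 segments joining some vertices of $L$ have a common interior point.) A crossing change is the change of overcrossing to undercrossing, or vice versa, at one crossing of a plane diagram. *)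

(* Defs.v *)
From HB Require Import structures.
From Stdlib Require Import Relation_Operators.
From mathcomp Require Import all_boot all_order all_algebra finmap.
From mathcomp Require Import boolp classical_sets reals.

Set Implicit Arguments.
Unset Strict Implicit.
Unset Printing Implicit Defensive.

Import Order.TTheory GRing.Theory Num.Theory.

Local Open Scope fset_scope.
Local Open Scope classical_set_scope.
Local Open Scope ring_scope.

Notation point3 R := 'rV[R]_3.

(* An edge is its unordered pair of endpoints, so that the polygonal lines
   built from edges are not oriented. *)
Notation edge R := {fset 'rV[R]_3}.

Section Geometry.
Variable R : realType.
Implicit Types (a b c p x : point3 R) (e f : edge R).

Definition dot p x : R := (p *m x^T) 0 0.

Definition segment a b : set (point3 R) :=
  [set x | exists2 t : R, 0 <= t <= 1 & x = (1 - t) *: a + t *: b].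

Definition triangle a b c : set (point3 R) :=
  [set x | exists r s t : R, [/\ 0 <= r, 0 <= s, 0 <= t, r + s + t = 1
                               & x = r *: a + s *: b + t *: c]].

Definition collinear a b c : Prop :=
  exists p d : point3 R,
    forall x, x \in [:: a; b; c] -> exists t : R, x = p + t *: d.

Definition edge_points e : set (point3 R) :=
  [set x | exists a b, e = [fset a; b] /\ segment a b x].

Definition edge_interior e : set (point3 R) :=
  edge_points e `\` [set x | x \in e].

(* Edges of the closed polygonal line with cyclically ordered vertices w. *)
Definition closed_edges (w : seq (point3 R)) : {fset edge R} :=
  [fset [fset ab.1; ab.2] | ab in zip w (rot 1 w)].

Definition polyline_points (E : {fset edge R}) : set (point3 R) :=
  [set x | exists2 e, e \in E & edge_points e x].

Definition is_knot (E : {fset edge R}) : Prop :=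
  exists w : seq (point3 R),
    [/\ (2 < size w)%N, uniq w, E = closed_edges w
      & forall e f x, e \in E -> f \in E -> e != f ->
          edge_points e x -> edge_points f x -> x \in (e `&` f)%fset].

End Geometry.

Record link (R : realType) (n : nat) := Link {
  component :> 'I_n -> {fset edge R};
  component_knot : forall i, is_knot (component i);
  component_disjoint : forall i j, i != j ->
    polyline_points (component i) `&` polyline_points (component j) = set0
}.

Section Isotopy.
Variables (R : realType) (n : nat).
Implicit Types K : link R n.

Definition link_points K : set (point3 R) :=
  [set x | exists i, polyline_points (K i) x].

(* The move ACB -> AB.  If A, B, C are collinear then C lies between A and B,
   because AC and CB are edges of a knot; the disjointness condition is then
   automatic and the move is the inverse of the subdivision of AB by C. *)
Definition elementary_move K K' : Prop :=
  exists (i : 'I_n) (A B C : point3 R),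
    [/\ [fset A; C] \in K i, [fset C; B] \in K i,
        link_points K `&` triangle A B C `<=` segment A C `|` segment C B,
        K' i = ([fset A; B] |` (K i `\` [fset [fset A; C]; [fset C; B]]))%fset
      & forall j, j != i -> K' j = K j].

Definition isotopic : link R n -> link R n -> Prop :=
  clos_refl_sym_trans _ elementary_move.

Definition trivial_link K : Prop :=
  exists (u : point3 R) (h : 'I_n -> R),
    [/\ u != 0, injective h
      & forall i, exists a b c : point3 R,
          [/\ K i = closed_edges [:: a; b; c],
              dot a u = h i, dot b u = h i & dot c u = h i]].

End Isotopy.

(* The plane {x | dot x u = c}, where u is the normal and c the offset; it is
   viewed from the side to which u points. *)
Record plane (R : realType) := Plane {
  normal : point3 R;
  offset : R;
  normal_neq0 : normal != 0
}.

Definition project (R : realType) (P : plane R) (x : point3 R) : point3 R :=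
  x - ((dot x (normal P) - offset P) / dot (normal P) (normal P)) *: normal P.

(* subdivision s t: the closed polygonal line t is obtained from s by
   successive subdivisions of edges. Vertex sequences are taken cyclically. *)
Inductive subdivision (R : realType) (s : seq (point3 R)) :
    seq (point3 R) -> Prop :=
| subdivision_refl : subdivision s s
| subdivision_rot k t : subdivision s t -> subdivision s (rot k t)
| subdivision_edge a b c t :
    subdivision s [:: a, b & t] -> edge_interior [fset a; b] c ->
    subdivision s [:: a, c, b & t].

(* dlines gives the cyclically ordered vertices of the projected components,
   after removal of the vertices at which the projection goes straight.
   goes_over e f is relevant only if e and f cross, and says that e goes over f. *)
Record diagram (R : realType) (n : nat) := Diagram {
  dplane : plane R;
  dlines : 'I_n -> seq (point3 R);
  goes_over : rel (edge R)
}.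

Section Diagrams.
Variables (R : realType) (n : nat).
Implicit Types (D : diagram R n) (K : link R n) (e f : edge R).

(* Vertices are counted with multiplicity, so that coinciding ones are
   excluded as well: they lie on a line with any third vertex. *)
Definition generic (L : 'I_n -> seq (point3 R)) : Prop :=
  let V := flatten [seq L i | i <- enum 'I_n] in
  [/\ forall i, (2 < size (L i))%N, uniq V,
      forall a b c, a \in V -> b \in V -> c \in V -> uniq [:: a; b; c] ->
        ~ collinear a b c
    & forall e1 e2 e3 : edge R,
        {subset e1 <= V} -> {subset e2 <= V} -> {subset e3 <= V} ->
        uniq [:: e1; e2; e3] ->
        edge_interior e1 `&` edge_interior e2 `&` edge_interior e3 = set0].

Definition crossing D (i j : 'I_n) e f (A : point3 R) : Prop :=
  [/\ e \in closed_edges (dlines D i), f \in closed_edges (dlines D j),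
      e != f & (edge_interior e `&` edge_interior f) A].

(* The part of the i-th component that projects to the edge e. *)
Definition strand (P : plane R) K (i : 'I_n) e : set (point3 R) :=
  [set x | exists g : edge R,
     [/\ g \in K i, project P @` edge_points g `<=` edge_points e
       & edge_points g x]].

(* D is a plane diagram of K. *)
Definition diagram_of D K : Prop :=
  [/\ generic (dlines D),
      forall i, exists w : seq (point3 R),
        [/\ uniq w, K i = closed_edges w
          & subdivision (dlines D i) (map (project (dplane D)) w)]
    & forall i j e f A, crossing D i j e f A ->
        goes_over D e f <->
        exists x y, [/\ strand (dplane D) K i e x, strand (dplane D) K j f y,
          project (dplane D) x = A, project (dplane D) y = A
          & dot y (normal (dplane D)) < dot x (normal (dplane D))]].

(* D and D' differ by the crossing change at the crossing of e and f. *)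
Definition crossing_change D D' e f : Prop :=
  [/\ dplane D = dplane D', dlines D =1 dlines D',
      goes_over D' e f = goes_over D f e, goes_over D' f e = goes_over D e f
    & forall i j e' f' A, crossing D i j e' f' A ->
        [fset e'; f'] != [fset e; f] -> goes_over D' e' f' = goes_over D e' f'].

End Diagrams.

(* Main.v *)
(** Existence.  For a generic direction n let lk_2 be the parity of the number
    of pairs of edges, e of the first component and f of the second, such that
    some ray {y + t n : t >= 0} from a point y of f meets e.  A filled triangle
    and a segment span a one-dimensional polytope of pairs (x, y) with x - y on
    the ray of n, and a one-dimensional polytope has two ends.  Counting these
    ends shows that an elementary move preserves the parity; the same count with
    the sector spanned by n and n' in place of the ray shows that the parity
    does not depend on n.  For a diagram, n is the direction of projection: after
    a small translation of one component, lk_2 counts the crossings at which the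
    first component goes over the second, so that only a crossing change between
    different components alters it.

    Uniqueness.  A property of links that is invariant under isotopy and crossing
    changes and holds for trivial links holds for all links.  Indeed, perturb the
    vertices so that their projections are in general position, and fix the
    projection.  The heights of the vertices form a vector off finitely many
    hyperplanes, one for each crossing, and crossing one hyperplane is a crossing
    change; hence the heights can be chosen freely.  Placing three consecutive
    vertices of a component at height 0 and all others below, the middle one is
    removed by an elementary move.  By induction both components become
    triangles, which are put into parallel planes. *)

Require Import Defs.
From HB Require Import structures.
From Stdlib Require Import Relation_Operators.
From mathcomp Require Import all_boot all_order all_algebra finmap.
From mathcomp Require Import boolp classical_sets reals.
From mathcomp Require Import ring lra zify.

Set Implicit Arguments.
Unset Strict Implicit.
Unset Printing Implicit Defensive.

Import Order.TTheory GRing.Theory Num.Theory.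
Local Open Scope ring_scope.

(** * Fibers of linear maps on an orthant, and Farkas' lemma *)

(** A diagram constrains only the straightened projections: a link may have further vertices
    anywhere over its edges, even over a crossing, and then a projected vertex of one component lies
    on the other. So the direction of projection may be unusable for counting, and one strand may
    consist of several edges of the link. Hence hits are counted for any [transverse] direction, one
    component is translated before its diagram is read, and subdivisions are traced down to their
    pieces.

    Uniqueness is applied to the property [lk2 K = g K], where [g] is a second function with the
    three properties. Two height functions in the same chamber are never joined by an isotopy: if
    there are walls, crossing changes join both to the negated heights; if there are none, vertices
    are moved vertically, one at a time.

    The number 6 comes from a count of unknowns: two normalizations and one vector equation in space
    are five equations, so six nonnegative unknowns leave a family of dimension one. *)

Section KernelParity.
Variables (R : realFieldType) (m : nat) (A : 'M[R]_(m.+1, m)) (c : 'rV[R]_m).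

Definition fiber (x : 'rV[R]_m.+1) := x *m A = c /\ forall j, 0 <= x 0 j.

(** The ratio test of the simplex method: walking from [x] along [y], the first coordinate to vanish
    is the decreasing one for which [x 0 i / - y 0 i] is least. *)
Lemma fiber_walk (x y : 'rV[R]_m.+1) : fiber x -> y *m A = 0 -> (exists i, y 0 i < 0) ->
  exists k i, [/\ 0 <= k, y 0 i < 0, fiber (x + k *: y) & (x + k *: y) 0 i = 0].
Proof.
move=> [xA x0] yA [i0 yi0].
pose q i := x 0 i / - y 0 i.
case: (@arg_minP _ R _ i0 (fun i => y 0 i < 0) q yi0) => i yi qmin.
have k0 : 0 <= q i by rewrite divr_ge0 // oppr_ge0 ltW.
exists (q i), i; split=> //; last first.
  by rewrite !mxE /q; field; rewrite lt_eqF.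
split=> [|j]; first by rewrite mulmxDl -scalemxAl yA scaler0 addr0.
rewrite !mxE; case: (leP 0 (y 0 j)) => yj.
  by rewrite addr_ge0 // mulr_ge0.
have := qmin j yj; rewrite [q j]/q ler_pdivlMr ?oppr_gt0 // mulrN; lra.
Qed.

(* The fiber is bounded and the kernel has positive dimension, so the fiber is a
   segment; by nondegeneracy each of its two ends lies on exactly one face. *)
Lemma kernel_parity :
  (forall y : 'rV[R]_m.+1, y *m A = 0 -> (forall j, 0 <= y 0 j) -> y = 0) ->
  (forall (x : 'rV[R]_m.+1) i j, fiber x -> x 0 i = 0 -> x 0 j = 0 -> i = j) ->
  \big[addb/false]_j `[< exists2 x : 'rV[R]_m.+1, fiber x & x 0 j = 0 >] = false.
Proof.
move=> bnd nondeg.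
have neg (y : 'rV[R]_m.+1) : y *m A = 0 -> y != 0 -> exists i, y 0 i < 0.
  move=> yA yn0; apply: contrapT => nex; case/eqP: yn0; apply: bnd => // j.
  by rewrite leNgt; apply/negP => yj; apply: nex; exists j.
have [[j [x xS xj]]|none] := pselect (exists j, exists2 x : 'rV[R]_m.+1, fiber x & x 0 j = 0);
    last first.
  rewrite big1 // => j _; apply/asboolP => h; apply: none; by exists j.
(* A nonzero kernel vector that keeps coordinate [j] at zero would lead from [x] to a point on a
   second face while staying on the face [j]. *)
have kerj (z : 'rV[R]_m.+1) : z *m A = 0 -> z 0 j = 0 -> z = 0.
  move=> zA zj; apply: contrapT => /eqP zn0.
  have [k [i [_ zi xS' xi]]] := fiber_walk xS zA (neg _ zA zn0).
  have ij : i = j by apply: (nondeg _ _ _ xS' xi); rewrite !mxE xj zj mulr0 addr0.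
  by rewrite ij zj ltxx in zi.
have [y yA yn0] : exists2 y : 'rV[R]_m.+1, y *m A = 0 & y != 0.
  have : kermx A != 0.
    by rewrite -mxrank_eq0 mxrank_ker subn_eq0 -ltnNge ltnS rank_leq_col.
  by case/rowV0Pn => y /sub_kermxP yA yn0; exists y.
wlog yj : y yA yn0 / 0 < y 0 j.
  move=> W; case: (ltgtP 0 (y 0 j)) => h; first exact: (W y).
    by apply: (W (- y)); rewrite ?mulNmx ?yA ?oppr0 ?oppr_eq0 // mxE oppr_gt0.
  by rewrite (kerj _ yA (esym h)) eqxx in yn0.
have [k [i [k0 yi x'S x'i]]] := fiber_walk xS yA (neg _ yA yn0).
have nij : i != j by apply: contraTneq yi => ->; rewrite -leNgt ltW.
(* By [kerj] the kernel is the line of [y], so every point of the fiber is [x + k' *: y]. It remains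
   to see that [k'] lies between 0 and [k] and that no face is met strictly between. *)
have act l : (exists2 x, fiber x & x 0 l = 0) -> l \in [:: i; j].
  move=> [z zS zl]; rewrite !inE.
  have /eqP : z - x - ((z 0 j - x 0 j) / y 0 j) *: y = 0.
    apply: kerj; last by rewrite !mxE; field; rewrite gt_eqF.
    by rewrite !mulmxBl -scalemxAl yA scaler0 subr0 zS.1 xS.1 subrr.
  set k' := _ / _; rewrite subr_eq0 subr_eq => /eqP zE.
  have k'0 : 0 <= k'.
    by rewrite divr_ge0 ?(ltW yj) // xj subr0; apply: zS.2.
  have k'k : k' <= k.
    have := zS.2 i; rewrite zE !mxE; move: x'i; rewrite !mxE => h h'.
    have : 0 <= (k - k') * - y 0 i by lra.
    by rewrite pmulr_lge0 ?oppr_gt0 // subr_ge0.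
  have xl := xS.2 l; have x'l := x'S.2 l.
  move: zl x'l; rewrite zE !mxE => zl x'l.
  case: (ltgtP 0 k') k'0 => // [k'p|k'e] _; last first.
    rewrite -k'e mul0r add0r in zl.
    by rewrite (nondeg _ _ _ xS zl xj) eqxx orbT.
  case: (ltgtP k' k) k'k => // [k'lt|k'e] _; last first.
    have h : (x + k *: y) 0 l = 0 by rewrite !mxE -k'e addrC.
    by rewrite (nondeg _ _ _ x'S h x'i) eqxx.
  have xl0 : x 0 l = 0.
    apply/eqP; rewrite eq_le xl andbT.
    (* Coordinate [l] is affine along the segment, nonnegative at both ends and zero at the interior
       parameter [k']; the identity forces it to vanish at [x] already. *)
    have h1 : k' * (x 0 l + k * y 0 l) = (k' - k) * x 0 l + k * (k' * y 0 l + x 0 l) by ring.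
    have h2 : 0 <= k' * (x 0 l + k * y 0 l) by rewrite mulr_ge0 // ltW.
    rewrite h1 zl mulr0 addr0 in h2.
    by rewrite -(@nmulr_rge0 _ (k' - k)) // subr_lt0.
  by rewrite (nondeg _ _ _ xS xl0 xj) eqxx orbT.
rewrite (bigD1 i) //= (bigD1 j) /=; last by rewrite eq_sym.
rewrite big1 => [|l /andP[li lj]]; last first.
  apply/asboolP => /act; rewrite !inE; by rewrite (negbTE li) (negbTE lj).
rewrite (_ : asbool _ = true); last by apply/asboolP; exists (x + k *: y).
by rewrite (_ : asbool _ = true) //; apply/asboolP; exists x.
Qed.
End KernelParity.

Section Farkas.
Variables (R : realFieldType) (d : nat).
Implicit Types (c y : 'rV[R]_d) (s : seq 'rV[R]_d).
Definition ip y c : R := (y *m c^T) 0 0.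
Lemma ipE y c : ip y c = \sum_i y 0 i * c 0 i.
Proof. by rewrite /ip mxE; apply: eq_bigr => i _; rewrite !mxE. Qed.
Lemma ipDl x y c : ip (x + y) c = ip x c + ip y c.
Proof. by rewrite /ip mulmxDl mxE. Qed.
Lemma ipZl k y c : ip (k *: y) c = k * ip y c.
Proof. by rewrite /ip -scalemxAl mxE. Qed.
Lemma ipC x y : ip x y = ip y x.
Proof. by rewrite !ipE; apply: eq_bigr => i _; rewrite mulrC. Qed.

Fixpoint in_cone s c : Prop :=
  if s is a :: s' then exists2 k, 0 <= k & in_cone s' (c - k *: a) else c = 0.

Lemma in_cone_ip s c y : (forall a, a \in s -> 0 <= ip a y) -> in_cone s c ->
  0 <= ip c y.
Proof.
elim: s c => [|a s IH] c ys /=; first by move=> ->; rewrite /ip mul0mx mxE.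
move=> [k k0 /IH h]; rewrite -(subrK (k *: a) c) ipDl ipZl addr_ge0 //.
  by apply: h => b bs; apply: ys; rewrite inE bs orbT.
by rewrite mulr_ge0 // ys // mem_head.
Qed.

Lemma in_cone_map s c (p : 'rV[R]_d -> 'rV[R]_d) :
  (forall k u v, p (k *: u + v) = k *: p u + p v) ->
  in_cone (map p s) c -> exists2 u, in_cone s u & c = p u.
Proof.
move=> plin; elim: s c => [|a s IH] c /=.
  move=> ->; exists 0 => //.
  by have := plin (-1) 0 0; rewrite scaler0 addr0 scaleN1r addNr.
move=> [k k0 /IH [u us cE]]; exists (k *: a + u).
  by exists k => //; rewrite addrC addKr.
by rewrite plin -cE addrC subrK.
Qed.

(** Induction on the number of generators. A functional [y] that separates [c] from the other
    generators fails only if it is negative on [a]. Then everything is projected along [a] into the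
    hyperplane where [y] vanishes, which leaves one generator less. *)
Lemma farkas s c : in_cone s c \/
  exists y, (forall a, a \in s -> 0 <= ip a y) /\ ip c y < 0.
Proof.
have [n] := ubnP (size s); elim: n s c => [//|n IH] [|a s] c /=.
  move=> _; have [->|cn0] := eqVneq c 0; [by left|right; exists (- c); split=> //].
  rewrite -scaleN1r ipC ipZl mulN1r oppr_lt0 lt_neqAle ipE.
  rewrite sumr_ge0 ?andbT => [|i _]; last by rewrite -expr2 sqr_ge0.
  apply: contraNneq cn0 => /esym/eqP.
  rewrite psumr_eq0 => [/allP h|i _]; last by rewrite -expr2 sqr_ge0.
  apply/eqP/rowP => i; rewrite mxE; have := h i (mem_index_enum _).
  by rewrite /= mulf_eq0 orbb => /eqP.
rewrite ltnS => sn; have [h|[y [ys yc]]] := IH s c sn.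
  by left; exists 0; rewrite ?scale0r ?subr0.
have [ay|ay] := leP 0 (ip a y).
  right; exists y; split=> // b; rewrite inE => /orP[/eqP->//|]; exact: ys.
have ay0 : ip a y != 0 by rewrite lt_eqF.
pose p b := b - (ip b y / ip a y) *: a.
have plin k u v : p (k *: u + v) = k *: p u + p v.
  by apply/rowP => i; rewrite /p ipDl ipZl !mxE; field.
have sn' : (size (map p s) < n)%N by rewrite size_map.
have [|] := IH (map p s) (p c) sn'.
  move=> /(in_cone_map plin) [u us pcu]; left.
  (* The coefficient of [a] lost in the projection. It is nonnegative because [ip c y] and [ip a y]
     are negative while [ip u y] is not. *)
  exists ((ip c y - ip u y) / ip a y).
    have uy := in_cone_ip ys us.
    by rewrite -mulrNN -invrN mulr_ge0 ?invr_ge0 ?oppr_ge0 ?(ltW ay) //; lra.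
  suff -> : c - ((ip c y - ip u y) / ip a y) *: a = u by [].
  apply/rowP => i; move/rowP: pcu => /(_ i); rewrite !mxE => h.
  have -> : c 0 i = u 0 i - ip u y / ip a y * a 0 i + ip c y / ip a y * a 0 i.
    by rewrite -h subrK.
  by field.
(* The functional found for the projected vectors is pulled back along [p]; the pullback vanishes on
   [a]. *)
move=> [y1 [y1s y1c]]; right.
have pE b : ip b (y1 - (ip a y1 / ip a y) *: y) = ip (p b) y1.
  rewrite /p -scaleN1r ipDl -scaleNr ipZl ipC ipDl !ipZl ![ip _ b]ipC; field.
  exact: ay0.
exists (y1 - (ip a y1 / ip a y) *: y); split=> [b|]; last by rewrite pE.
rewrite pE inE => /orP[/eqP ->|bs]; last by apply: y1s; rewrite map_f.
by rewrite /p divff // scale1r subrr /ip mul0mx mxE.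
Qed.
End Farkas.

(** * Parity of ray hits *)

Section Parity6.
Variable R : realFieldType.
Variables (u v : 'I_6 -> R) (p : 'I_6 -> 'rV[R]_3).

Definition fiber6 (x : 'I_6 -> R) :=
  [/\ forall j, 0 <= x j, \sum_j x j * u j = 1, \sum_j x j * v j = 1
    & \sum_j x j *: p j = 0].

(** [kernel_parity] for the 1 + 1 + 3 equations of [fiber6]. The vectors [u] and [v] select the
    coordinates that are barycentric in the first and in the second simplex; coordinates selected by
    neither are parameters of rays. *)
Lemma parity6 :
  (forall y : 'I_6 -> R, (forall j, 0 <= y j) -> \sum_j y j * u j = 0 ->
     \sum_j y j * v j = 0 -> \sum_j y j *: p j = 0 -> forall j, y j = 0) ->
  (forall x i j, fiber6 x -> x i = 0 -> x j = 0 -> i = j) ->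
  \big[addb/false]_j `[< exists2 x, fiber6 x & x j = 0 >] = false.
Proof.
move=> bnd nondeg.
pose A : 'M[R]_(6, 1 + 1 + 3) :=
  row_mx (row_mx (\col_j u j) (\col_j v j)) (\matrix_j p j).
have AE (x : 'rV[R]_6) (k l : R) (q : 'rV[R]_3) :
  x *m A = row_mx (row_mx k%:M l%:M) q <->
  [/\ \sum_j x 0 j * u j = k, \sum_j x 0 j * v j = l & \sum_j x 0 j *: p j = q].
  have E1 (g : 'I_6 -> R) : x *m (\col_j g j) = (\sum_j x 0 j * g j)%:M.
    by apply/matrixP => i i'; rewrite !mxE !ord1 eqxx; apply: eq_bigr => j _; rewrite mxE.
  have inj (a b : R) : (a%:M : 'M[R]_1) = b%:M -> a = b.
    by move=> /matrixP /(_ 0 0); rewrite !mxE eqxx.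
  have E2 : x *m (\matrix_j p j) = \sum_j x 0 j *: p j.
    rewrite mulmx_sum_row; apply: eq_bigr => j _; by rewrite rowK.
  rewrite /A !mul_mx_row !E1 E2; split.
    by move=> /eq_row_mx[/eq_row_mx[/inj <- /inj <-] <-].
  by move=> [<- <- <-].
pose c : 'rV[R]_(1 + 1 + 3) := row_mx (row_mx 1%:M 1%:M) 0.
have fE (x : 'rV[R]_6) : fiber A c x <-> fiber6 (fun j => x 0 j).
  split; first by move=> [/AE[]].
  by move=> [x0 h1 h2 h3]; split=> //; apply/AE; split.
have eqf j : `[< exists2 x, fiber6 x & x j = 0 >] =
             `[< exists2 x : 'rV[R]_6, fiber A c x & x 0 j = 0 >].
  apply: asbool_equiv_eq; split=> [[x xS xj]|[x xS xj]].
    exists (\row_j x j); last by rewrite mxE.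
    by apply/fE; rewrite (_ : (fun _ => _) = x) //; apply/funext => i; rewrite mxE.
  by exists (fun j => x 0 j) => //; apply/fE.
under eq_bigr do rewrite eqf.
apply: (@kernel_parity R 5 A c) => [y yA y0|x i j /fE]; last exact: nondeg.
have /AE[h1 h2 h3] : y *m A = row_mx (row_mx 0%:M 0%:M) 0.
  by rewrite yA !raddf0 !row_mx0.
by apply/rowP => j; rewrite mxE; exact: (bnd (fun j => y 0 j)).
Qed.
End Parity6.

Local Open Scope classical_set_scope.
Section Hits.
Variable R : realType.
Implicit Types (a b c d n x y : point3 R) (X Y : set (point3 R)).

Lemma segmentP a b x : segment a b x <->
  exists s t : R, [/\ 0 <= s, 0 <= t, s + t = 1 & x = s *: a + t *: b].
Proof.
split=> [[t /andP[t0 t1] ->]|[s [t [s0 t0 st ->]]]].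
  by exists (1 - t), t; rewrite subr_ge0 t0 t1; split=> //; ring.
have -> : s = 1 - t by rewrite -st addrK.
exists t => //; rewrite t0 /= -st; lra.
Qed.

(** With [n] pointing upwards, [X] is above [Y]. For [n = 0] this says that [X] and [Y] meet, so
    results about hits, such as stability, also cover disjointness. *)
Definition hit n X Y := exists x y t, [/\ X x, Y y, 0 <= t & x - y = t *: n].
Definition hit2 n n' X Y :=
  exists x y t t', [/\ X x, Y y, 0 <= t, 0 <= t' & x - y = t *: n + t' *: n'].

Let o0 : 'I_6 := @Ordinal 6 0 isT.
Let o1 : 'I_6 := @Ordinal 6 1 isT.
Let o2 : 'I_6 := @Ordinal 6 2 isT.
Let o3 : 'I_6 := @Ordinal 6 3 isT.
Let o4 : 'I_6 := @Ordinal 6 4 isT.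
Let o5 : 'I_6 := @Ordinal 6 5 isT.

Let big6 (T : Type) (idx : T) (op : T -> T -> T) (F : 'I_6 -> T) :
  \big[op/idx]_j F j =
  op (F o0) (op (F o1) (op (F o2) (op (F o3) (op (F o4) (op (F o5) idx))))).
Proof.
rewrite !big_ord_recl big_ord0.
by repeat (congr (op (F _) _); first exact: val_inj).
Qed.

Let ord6_ind (P : 'I_6 -> Prop) :
  P o0 -> P o1 -> P o2 -> P o3 -> P o4 -> P o5 -> forall i, P i.
Proof.
move=> h0 h1 h2 h3 h4 h5 [[|[|[|[|[|[|//]]]]]] Hi].
- by rewrite (_ : Ordinal _ = o0) //; apply: val_inj.
- by rewrite (_ : Ordinal _ = o1) //; apply: val_inj.
- by rewrite (_ : Ordinal _ = o2) //; apply: val_inj.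
- by rewrite (_ : Ordinal _ = o3) //; apply: val_inj.
- by rewrite (_ : Ordinal _ = o4) //; apply: val_inj.
- by rewrite (_ : Ordinal _ = o5) //; apply: val_inj.
Qed.

Let six (T : Type) (l0 l1 l2 l3 l4 l5 : T) (j : 'I_6) : T :=
  nth l0 [:: l0; l1; l2; l3; l4; l5] j.

(** Spells out the six faces with [F] in place of the fiber, so that each of them can be identified
    with a geometric event. *)
Lemma parity6_faces (u v : 'I_6 -> R) (w : 'I_6 -> point3 R)
    (F : R -> R -> R -> R -> R -> R -> Prop) :
  (forall x : 'I_6 -> R,
     fiber6 u v w x <-> F (x o0) (x o1) (x o2) (x o3) (x o4) (x o5)) ->
  (forall y : 'I_6 -> R, (forall j, 0 <= y j) -> \sum_j y j * u j = 0 ->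
     \sum_j y j * v j = 0 -> \sum_j y j *: w j = 0 -> forall j, y j = 0) ->
  (forall l0 l1 l2 l3 l4 l5, F l0 l1 l2 l3 l4 l5 ->
     pairwise (fun x y : R => ~~ ((x == 0) && (y == 0))) [:: l0; l1; l2; l3; l4; l5]) ->
  `[< exists l1 l2 l3 l4 l5, F 0 l1 l2 l3 l4 l5 >] (+)
  (`[< exists l0 l2 l3 l4 l5, F l0 0 l2 l3 l4 l5 >] (+)
  (`[< exists l0 l1 l3 l4 l5, F l0 l1 0 l3 l4 l5 >] (+)
  (`[< exists l0 l1 l2 l4 l5, F l0 l1 l2 0 l4 l5 >] (+)
  (`[< exists l0 l1 l2 l3 l5, F l0 l1 l2 l3 0 l5 >] (+)
   `[< exists l0 l1 l2 l3 l4, F l0 l1 l2 l3 l4 0 >])))) = false.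
Proof.
move=> FE bnd nondeg.
rewrite -(@parity6 R u v w) // => [|x i j /FE /nondeg /pairwiseP h xi xj].
  rewrite big6 addbF; congr (_ (+) (_ (+) (_ (+) (_ (+) (_ (+) _)))));
    apply: asbool_equiv_eq; split=> [[l0 [l1 [l2 [l3 [l4 h]]]]]|[x /FE h x0]];
    do ?[by rewrite x0 in h; do 5 eexists; exact: h].
  - by exists (six 0 l0 l1 l2 l3 l4) => //; apply/FE.
  - by exists (six l0 0 l1 l2 l3 l4) => //; apply/FE.
  - by exists (six l0 l1 0 l2 l3 l4) => //; apply/FE.
  - by exists (six l0 l1 l2 0 l3 l4) => //; apply/FE.
  - by exists (six l0 l1 l2 l3 0 l4) => //; apply/FE.
  - by exists (six l0 l1 l2 l3 l4 0) => //; apply/FE.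
have sx k : nth 0 [:: x o0; x o1; x o2; x o3; x o4; x o5] (nat_of_ord k) = x k.
  by move: k; apply: ord6_ind.
apply/val_inj => /=; case: (ltngtP i j) => // ij.
- by have := h 0 _ _ (ltn_ord i) (ltn_ord j) ij; rewrite !sx xi xj eqxx.
- by have := h 0 _ _ (ltn_ord j) (ltn_ord i) ij; rewrite !sx xi xj eqxx.
Qed.

(* The coordinates are three barycentric ones of the point of the triangle, two
   of the point of the segment, and the parameter of the ray; the last never
   vanishes, because the triangle and the segment are disjoint. *)
Lemma prism_parity n a b c p q :
  n != 0 ->
  (forall x, triangle a b c x -> ~ segment p q x) ->
  (forall x, x \in [:: a; b; c] -> ~ hit n [set x] (segment p q)) ->
  (forall y, y \in [:: p; q] ->
     [/\ ~ hit n (segment a b) [set y], ~ hit n (segment b c) [set y]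
       & ~ hit n (segment a c) [set y]]) ->
  `[< hit n (segment a b) (segment p q) >] (+)
  `[< hit n (segment b c) (segment p q) >] (+)
  `[< hit n (segment a c) (segment p q) >] =
  `[< hit n (triangle a b c) [set p] >] (+) `[< hit n (triangle a b c) [set q] >].
Proof.
move=> n0 disj vert edg.
pose u : 'I_6 -> R := six 1 1 1 0 0 0; pose v : 'I_6 -> R := six 0 0 0 1 1 0.
pose w : 'I_6 -> point3 R := six a b c (- p) (- q) (- n).
pose F (l0 l1 l2 l3 l4 l5 : R) :=
  [/\ [/\ 0 <= l0, 0 <= l1 & 0 <= l2], [/\ 0 <= l3, 0 <= l4 & 0 <= l5],
    l0 + l1 + l2 = 1, l3 + l4 = 1 &
    (l0 *: a + l1 *: b + l2 *: c) - (l3 *: p + l4 *: q) = l5 *: n].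
have wE (x : 'I_6 -> R) : \sum_j x j *: w j =
    (x o0 *: a + x o1 *: b + x o2 *: c) - (x o3 *: p + x o4 *: q) - x o5 *: n.
  by rewrite big6 /w /six /=; apply/rowP => k; rewrite !mxE; ring.
have FE (x : 'I_6 -> R) :
    fiber6 u v w x <-> F (x o0) (x o1) (x o2) (x o3) (x o4) (x o5).
  rewrite /fiber6 /F wE !big6 /u /v /six /= !mulr1 !mulr0 !addr0 !add0r addrA.
  split; move=> [x0 h1 h2].
    by move=> /eqP; rewrite subr_eq0 => /eqP h3; split.
  move=> h3 h4; split=> //; last by apply/eqP; rewrite subr_eq0 h4.
  by apply: ord6_ind; case: x0; case: h1.
have bnd (y : 'I_6 -> R) : (forall j, 0 <= y j) -> \sum_j y j * u j = 0 ->
     \sum_j y j * v j = 0 -> \sum_j y j *: w j = 0 -> forall j, y j = 0.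
  rewrite wE !big6 /u /v /six /= !mulr1 !mulr0 !addr0 !add0r => y0 h1 h2.
  have z0 : y o0 = 0 by move: (y0 o0) (y0 o1) (y0 o2); lra.
  have z1 : y o1 = 0 by move: (y0 o0) (y0 o1) (y0 o2); lra.
  have z2 : y o2 = 0 by move: (y0 o0) (y0 o1) (y0 o2); lra.
  have z3 : y o3 = 0 by move: (y0 o3) (y0 o4); lra.
  have z4 : y o4 = 0 by move: (y0 o3) (y0 o4); lra.
  rewrite z0 z1 z2 z3 z4 !scale0r !addr0 subr0 sub0r => /eqP.
  rewrite oppr_eq0 scaler_eq0 (negbTE n0) orbF => /eqP z5.
  by apply: ord6_ind.
have tri l0 l1 l2 : 0 <= l0 -> 0 <= l1 -> 0 <= l2 -> l0 + l1 + l2 = 1 ->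
    triangle a b c (l0 *: a + l1 *: b + l2 *: c) by exists l0, l1, l2.
have seg x y s t : 0 <= s -> 0 <= t -> s + t = 1 -> segment x y (s *: x + t *: y).
  by move=> *; apply/segmentP; exists s, t.
(* Two vanishing coordinates would put a vertex of the triangle over the segment, or an edge of the
   triangle over an end of the segment; a vanishing ray parameter would be a common point. *)
have nondeg l0 l1 l2 l3 l4 l5 : F l0 l1 l2 l3 l4 l5 ->
     pairwise (fun x y : R => ~~ ((x == 0) && (y == 0))) [:: l0; l1; l2; l3; l4; l5].
  move=> [[p0 p1 p2] [p3 p4 p5] e1 e2 e3].
  have z5 : (l5 == 0) = false.
    apply/eqP => z; move: e3; rewrite z scale0r => /eqP; rewrite subr_eq0 => /eqP e3.
    by apply: (disj _ (tri _ _ _ p0 p1 p2 e1)); rewrite e3; apply: seg.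
  have z01 : (l0 == 0) && (l1 == 0) = false.
    apply/negP => /andP[/eqP z /eqP z']; subst; apply: (vert c); first by rewrite !inE eqxx !orbT.
    exists c, (l3 *: p + l4 *: q), l5; split=> //; first exact: seg.
    by rewrite -e3 (_ : l2 = 1) ?scale0r ?add0r ?scale1r //; lra.
  have z02 : (l0 == 0) && (l2 == 0) = false.
    apply/negP => /andP[/eqP z /eqP z']; subst; apply: (vert b); first by rewrite !inE eqxx !orbT.
    exists b, (l3 *: p + l4 *: q), l5; split=> //; first exact: seg.
    by rewrite -e3 (_ : l1 = 1) ?scale0r ?add0r ?addr0 ?scale1r //; lra.
  have z12 : (l1 == 0) && (l2 == 0) = false.
    apply/negP => /andP[/eqP z /eqP z']; subst; apply: (vert a); first by rewrite !inE eqxx.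
    exists a, (l3 *: p + l4 *: q), l5; split=> //; first exact: seg.
    by rewrite -e3 (_ : l0 = 1) ?scale0r ?add0r ?addr0 ?scale1r //; lra.
  have zy k l y y' : y \in [:: p; q] -> k + l = 1 -> k *: y' + l *: y = l3 *: p + l4 *: q ->
     k = 0 -> [/\ l0 <> 0, l1 <> 0 & l2 <> 0].
    move=> yin kl ky k0; subst k; move: ky; rewrite scale0r add0r (_ : l = 1) ?scale1r; last by lra.
    move=> ky; rewrite -ky in e3; have [h1 h2 h3] := edg y yin; split=> z.
    - apply: h2; exists (l1 *: b + l2 *: c), y, l5; split=> //.
        by apply: seg => //; lra.
      by rewrite -e3 z scale0r add0r.
    - apply: h3; exists (l0 *: a + l2 *: c), y, l5; split=> //.
        by apply: seg => //; lra.
      by rewrite -e3 z scale0r addr0.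
    - apply: h1; exists (l0 *: a + l1 *: b), y, l5; split=> //.
        by apply: seg => //; lra.
      by rewrite -e3 z scale0r addr0.
  have pin : p \in [:: p; q] by rewrite inE eqxx.
  have qin : q \in [:: p; q] by rewrite !inE eqxx orbT.
  have zp : l3 == 0 -> [/\ (l0 == 0) = false, (l1 == 0) = false & (l2 == 0) = false].
    by move/eqP => h; have [/eqP/negbTE-> /eqP/negbTE-> /eqP/negbTE->] := zy l3 l4 q p qin e2 erefl h.
  have zq : l4 == 0 -> [/\ (l0 == 0) = false, (l1 == 0) = false & (l2 == 0) = false].
    have e2' : l4 + l3 = 1 by rewrite addrC.
    by move/eqP => h; have [/eqP/negbTE-> /eqP/negbTE-> /eqP/negbTE->] := zy l4 l3 p q pin e2' (addrC _ _) h.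
  have z34 : (l3 == 0) && (l4 == 0) = false.
    by apply/negP => /andP[/eqP z /eqP z']; move: e2; rewrite z z' addr0 => /eqP; rewrite eq_sym oner_eq0.
  rewrite /= z5 !andbF z01 z02 z12 z34 /= !andbT.
  by case: eqP zp => [_ [] // -> -> ->|_ _]; rewrite ?andbF /=;
     case: eqP zq => [_ [] // -> -> ->|_ _]; rewrite ?andbF.
have H := parity6_faces FE bnd nondeg.
rewrite !addbA [in LHS]addbC !addbA in H *.
suff [E0 E1 E2 [E3 E4 E5]] :
  [/\ hit n (segment b c) (segment p q) <-> exists l1 l2 l3 l4 l5, F 0 l1 l2 l3 l4 l5,
   hit n (segment a c) (segment p q) <-> exists l0 l2 l3 l4 l5, F l0 0 l2 l3 l4 l5,
   hit n (segment a b) (segment p q) <-> exists l0 l1 l3 l4 l5, F l0 l1 0 l3 l4 l5 &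
   [/\ hit n (triangle a b c) [set q] <-> exists l0 l1 l2 l4 l5, F l0 l1 l2 0 l4 l5,
   hit n (triangle a b c) [set p] <-> exists l0 l1 l2 l3 l5, F l0 l1 l2 l3 0 l5 &
   ~ exists l0 l1 l2 l3 l4, F l0 l1 l2 l3 l4 0]].
  move: H; rewrite -(asbool_equiv_eq E0) -(asbool_equiv_eq E1) -(asbool_equiv_eq E2).
  rewrite -(asbool_equiv_eq E3) -(asbool_equiv_eq E4) (asboolF E5).
  by do 5 case: `[< _ >].
split; [| | |split].
- split=> [[x [y [t [/segmentP[r [r' [r0 r'0 rr ->]]] /segmentP[s [s' [s0 s'0 ss ->]]] t0 e]]]]|].
    by exists r, r', s, s', t; rewrite /F scale0r !add0r.
  move=> [l1 [l2 [l3 [l4 [l5 [[_ ? ?] [? ? ?] e1 e2]]]]]].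
  rewrite scale0r add0r in e1 *; rewrite add0r in e1 *.
  by exists (l1 *: b + l2 *: c), (l3 *: p + l4 *: q), l5; split=> //; exact: seg.
- split=> [[x [y [t [/segmentP[r [r' [r0 r'0 rr ->]]] /segmentP[s [s' [s0 s'0 ss ->]]] t0 e]]]]|].
    by exists r, r', s, s', t; rewrite /F scale0r !addr0.
  move=> [l1 [l2 [l3 [l4 [l5 [[? _ ?] [? ? ?] e1 e2]]]]]].
  rewrite scale0r addr0 in e1 *; rewrite addr0 in e1 *.
  by exists (l1 *: a + l2 *: c), (l3 *: p + l4 *: q), l5; split=> //; exact: seg.
- split=> [[x [y [t [/segmentP[r [r' [r0 r'0 rr ->]]] /segmentP[s [s' [s0 s'0 ss ->]]] t0 e]]]]|].
    by exists r, r', s, s', t; rewrite /F scale0r !addr0.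
  move=> [l1 [l2 [l3 [l4 [l5 [[? ? _] [? ? ?] e1 e2]]]]]].
  rewrite scale0r addr0 in e1 *; rewrite addr0 in e1 *.
  by exists (l1 *: a + l2 *: b), (l3 *: p + l4 *: q), l5; split=> //; exact: seg.
- split=> [[x [y [t [[r0 [r1 [r2 [? ? ? ? ->]]]] -> t0 e]]]]|].
    by exists r0, r1, r2, 1, t; rewrite /F scale0r scale1r !add0r.
  move=> [l1 [l2 [l3 [l4 [l5 [[? ? ?] [_ ? ?] e1]]]]]]; rewrite add0r => ->.
  rewrite scale0r scale1r add0r => e.
  by exists (l1 *: a + l2 *: b + l3 *: c), q, l5; split=> //; exact: tri.
- split=> [[x [y [t [[r0 [r1 [r2 [? ? ? ? ->]]]] -> t0 e]]]]|].
    by exists r0, r1, r2, 1, t; rewrite /F scale0r scale1r !addr0.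
  move=> [l1 [l2 [l3 [l4 [l5 [[? ? ?] [? _ ?] e1]]]]]]; rewrite addr0 => ->.
  rewrite scale0r scale1r addr0 => e.
  by exists (l1 *: a + l2 *: b + l3 *: c), p, l5; split=> //; exact: tri.
- move=> [l0 [l1 [l2 [l3 [l4 [[? ? ?] [? ? _] e1 e2]]]]]].
  rewrite scale0r => /eqP; rewrite subr_eq0 => /eqP e3.
  by apply: (disj _ (tri l0 l1 l2 _ _ _ e1)) => //; rewrite e3; apply: seg.
Qed.

(** The pairs of points whose difference lies in the sector form a one-dimensional polytope. It ends
    where the difference reaches a side of the sector, which is counted on the left, or where one of
    the points reaches an end of its segment, which is counted on the right. *)
Lemma sector_parity n n' a b p q :
  (forall t t' : R, 0 <= t -> 0 <= t' -> t *: n + t' *: n' = 0 -> t = 0 /\ t' = 0) ->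
  (forall x, segment a b x -> ~ segment p q x) ->
  (forall x, x \in [:: a; b] ->
     ~ hit n [set x] (segment p q) /\ ~ hit n' [set x] (segment p q)) ->
  (forall y, y \in [:: p; q] ->
     ~ hit n (segment a b) [set y] /\ ~ hit n' (segment a b) [set y]) ->
  (forall x y, x \in [:: a; b] -> y \in [:: p; q] -> ~ hit2 n n' [set x] [set y]) ->
  `[< hit n (segment a b) (segment p q) >] (+)
  `[< hit n' (segment a b) (segment p q) >] =
  (`[< hit2 n n' [set a] (segment p q) >] (+)
   `[< hit2 n n' [set b] (segment p q) >]) (+)
  (`[< hit2 n n' (segment a b) [set p] >] (+)
   `[< hit2 n n' (segment a b) [set q] >]).
Proof.
move=> indep disj vx vy corner.
pose u : 'I_6 -> R := six 1 1 0 0 0 0; pose v : 'I_6 -> R := six 0 0 1 1 0 0.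
pose w : 'I_6 -> point3 R := six a b (- p) (- q) (- n) (- n').
pose F (l0 l1 l2 l3 l4 l5 : R) :=
  [/\ [/\ 0 <= l0, 0 <= l1 & 0 <= l2], [/\ 0 <= l3, 0 <= l4 & 0 <= l5],
    l0 + l1 = 1, l2 + l3 = 1 &
    (l0 *: a + l1 *: b) - (l2 *: p + l3 *: q) = l4 *: n + l5 *: n'].
have wE (x : 'I_6 -> R) : \sum_j x j *: w j =
    (x o0 *: a + x o1 *: b) - (x o2 *: p + x o3 *: q) - (x o4 *: n + x o5 *: n').
  by rewrite big6 /w /six /=; apply/rowP => k; rewrite !mxE; ring.
have FE (x : 'I_6 -> R) :
    fiber6 u v w x <-> F (x o0) (x o1) (x o2) (x o3) (x o4) (x o5).
  rewrite /fiber6 /F wE !big6 /u /v /six /= !mulr1 !mulr0 !addr0 !add0r.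
  split; move=> [x0 h1 h2].
    by move=> /eqP; rewrite subr_eq0 => /eqP h3; split.
  move=> h3 h4; split=> //; last by apply/eqP; rewrite subr_eq0 h4.
  by apply: ord6_ind; case: x0; case: h1.
have bnd (y : 'I_6 -> R) : (forall j, 0 <= y j) -> \sum_j y j * u j = 0 ->
     \sum_j y j * v j = 0 -> \sum_j y j *: w j = 0 -> forall j, y j = 0.
  rewrite wE !big6 /u /v /six /= !mulr1 !mulr0 !addr0 !add0r => y0 h1 h2.
  have z0 : y o0 = 0 by move: (y0 o0) (y0 o1); lra.
  have z1 : y o1 = 0 by move: (y0 o0) (y0 o1); lra.
  have z2 : y o2 = 0 by move: (y0 o2) (y0 o3); lra.
  have z3 : y o3 = 0 by move: (y0 o2) (y0 o3); lra.
  rewrite z0 z1 z2 z3 !scale0r !addr0 subr0 sub0r => /eqP.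
  rewrite oppr_eq0 => /eqP /(indep _ _ (y0 o4) (y0 o5)) [z4 z5].
  by apply: ord6_ind.
have seg x y s t : 0 <= s -> 0 <= t -> s + t = 1 -> segment x y (s *: x + t *: y).
  by move=> *; apply/segmentP; exists s, t.
have nondeg l0 l1 l2 l3 l4 l5 : F l0 l1 l2 l3 l4 l5 ->
     pairwise (fun x y : R => ~~ ((x == 0) && (y == 0))) [:: l0; l1; l2; l3; l4; l5].
  move=> [[p0 p1 p2] [p3 p4 p5] e1 e2 e3].
  have X : segment a b (l0 *: a + l1 *: b) by exact: seg.
  have Y : segment p q (l2 *: p + l3 *: q) by exact: seg.
  have z45 : (l4 == 0) && (l5 == 0) = false.
    apply/negP => /andP[/eqP z /eqP z']; move: e3; rewrite z z' !scale0r addr0 => /eqP.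
    by rewrite subr_eq0 => /eqP e3; apply: (disj _ X); rewrite e3.
  have z01 : (l0 == 0) && (l1 == 0) = false.
    by apply/negP => /andP[/eqP z /eqP z']; move: e1; rewrite z z' addr0 => /eqP; rewrite eq_sym oner_eq0.
  have z23 : (l2 == 0) && (l3 == 0) = false.
    by apply/negP => /andP[/eqP z /eqP z']; move: e2; rewrite z z' addr0 => /eqP; rewrite eq_sym oner_eq0.
  pose x := l0 *: a + l1 *: b; pose y := l2 *: p + l3 *: q.
  have xE : (l0 == 0) || (l1 == 0) -> x \in [:: a; b].
    rewrite !inE /x => /orP[] /eqP z; rewrite z ?add0r ?addr0 in e1;
      by rewrite z e1 scale0r scale1r ?add0r ?addr0 eqxx ?orbT.
  have yE : (l2 == 0) || (l3 == 0) -> y \in [:: p; q].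
    rewrite !inE /y => /orP[] /eqP z; rewrite z ?add0r ?addr0 in e2;
      by rewrite z e2 scale0r scale1r ?add0r ?addr0 eqxx ?orbT.
  have zxy : ((l0 == 0) || (l1 == 0)) && ((l2 == 0) || (l3 == 0)) = false.
    apply/negP => /andP[/xE xi /yE yi]; apply: (corner x y xi yi).
    by exists x, y, l4, l5.
  have zx : ((l0 == 0) || (l1 == 0)) && ((l4 == 0) || (l5 == 0)) = false.
    apply/negP => /andP[/xE xi z]; have [h h'] := vx x xi; case/orP: z => /eqP z.
      by apply: h'; exists x, y, l5; rewrite /x /y e3 z scale0r add0r.
    by apply: h; exists x, y, l4; rewrite /x /y e3 z scale0r addr0.
  have zy : ((l2 == 0) || (l3 == 0)) && ((l4 == 0) || (l5 == 0)) = false.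
    apply/negP => /andP[/yE yi z]; have [h h'] := vy y yi; case/orP: z => /eqP z.
      by apply: h'; exists x, y, l5; rewrite /x /y e3 z scale0r add0r.
    by apply: h; exists x, y, l4; rewrite /x /y e3 z scale0r addr0.
  rewrite /=; move: z01 z23 z45 zxy zx zy.
  by case: (l0 == 0); case: (l1 == 0); case: (l2 == 0); case: (l3 == 0);
     case: (l4 == 0); case: (l5 == 0).
have H := parity6_faces FE bnd nondeg.
suff [E0 E1 E2 [E3 E4 E5]] :
  [/\ hit2 n n' [set b] (segment p q) <-> exists l1 l2 l3 l4 l5, F 0 l1 l2 l3 l4 l5,
   hit2 n n' [set a] (segment p q) <-> exists l0 l2 l3 l4 l5, F l0 0 l2 l3 l4 l5,
   hit2 n n' (segment a b) [set q] <-> exists l0 l1 l3 l4 l5, F l0 l1 0 l3 l4 l5 &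
   [/\ hit2 n n' (segment a b) [set p] <-> exists l0 l1 l2 l4 l5, F l0 l1 l2 0 l4 l5,
   hit n' (segment a b) (segment p q) <-> exists l0 l1 l2 l3 l5, F l0 l1 l2 l3 0 l5 &
   hit n (segment a b) (segment p q) <-> exists l0 l1 l2 l3 l4, F l0 l1 l2 l3 l4 0]].
  move: H; rewrite -(asbool_equiv_eq E0) -(asbool_equiv_eq E1) -(asbool_equiv_eq E2).
  rewrite -(asbool_equiv_eq E3) -(asbool_equiv_eq E4) -(asbool_equiv_eq E5).
  by do 6 case: `[< _ >].
split; [| | |split].
- split=> [[x [y [t [t' [-> /segmentP[s [s' [s0 s'0 ss ->]]] t0 t'0 e]]]]]|].
    by exists 1, s, s', t, t'; rewrite /F scale0r scale1r !add0r.
  move=> [l1 [l2 [l3 [l4 [l5 [[_ ? ?] [? ? ?] e1 e2]]]]]].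
  rewrite add0r in e1; rewrite e1 scale0r scale1r add0r => e.
  by exists b, (l2 *: p + l3 *: q), l4, l5; split=> //; exact: seg.
- split=> [[x [y [t [t' [-> /segmentP[s [s' [s0 s'0 ss ->]]] t0 t'0 e]]]]]|].
    by exists 1, s, s', t, t'; rewrite /F scale0r scale1r !addr0.
  move=> [l1 [l2 [l3 [l4 [l5 [[? _ ?] [? ? ?] e1 e2]]]]]].
  rewrite addr0 in e1; rewrite e1 scale0r scale1r addr0 => e.
  by exists a, (l2 *: p + l3 *: q), l4, l5; split=> //; exact: seg.
- split=> [[x [y [t [t' [/segmentP[s [s' [s0 s'0 ss ->]]] -> t0 t'0 e]]]]]|].
    by exists s, s', 1, t, t'; rewrite /F scale0r scale1r !add0r.
  move=> [l0 [l1 [l3 [l4 [l5 [[? ? _] [? ? ?] e1 e2]]]]]].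
  rewrite add0r in e2; rewrite e2 scale0r scale1r add0r => e.
  by exists (l0 *: a + l1 *: b), q, l4, l5; split=> //; exact: seg.
- split=> [[x [y [t [t' [/segmentP[s [s' [s0 s'0 ss ->]]] -> t0 t'0 e]]]]]|].
    by exists s, s', 1, t, t'; rewrite /F scale0r scale1r !addr0.
  move=> [l0 [l1 [l2 [l4 [l5 [[? ? ?] [_ ? ?] e1 e2]]]]]].
  rewrite addr0 in e2; rewrite e2 scale0r scale1r addr0 => e.
  by exists (l0 *: a + l1 *: b), p, l4, l5; split=> //; exact: seg.
- split=> [[x [y [t [/segmentP[r [r' [r0 r'0 rr ->]]] /segmentP[s [s' [s0 s'0 ss ->]]] t0 e]]]]|].
    by exists r, r', s, s', t; rewrite /F scale0r !add0r.
  move=> [l0 [l1 [l2 [l3 [l5 [[? ? ?] [? ? ?] e1 e2]]]]]].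
  rewrite scale0r add0r => e.
  by exists (l0 *: a + l1 *: b), (l2 *: p + l3 *: q), l5; split=> //; exact: seg.
- split=> [[x [y [t [/segmentP[r [r' [r0 r'0 rr ->]]] /segmentP[s [s' [s0 s'0 ss ->]]] t0 e]]]]|].
    by exists r, r', s, s', t; rewrite /F scale0r !addr0.
  move=> [l0 [l1 [l2 [l3 [l4 [[? ? ?] [? ? ?] e1 e2]]]]]].
  rewrite scale0r addr0 => e.
  by exists (l0 *: a + l1 *: b), (l2 *: p + l3 *: q), l4; split=> //; exact: seg.
Qed.
End Hits.

(** * Vectors and planes *)

Section Avoid.
Variable R : realFieldType.

Lemma avoid_roots (ps : seq {poly R}) (e : R) : 0 < e -> all (fun p => p != 0) ps ->
  exists2 t, 0 < t < e & all (fun p => p.[t] != 0) ps.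
Proof.
move=> e0 psn0; pose P := \prod_(p <- ps) p.
have Pn0 : P != 0 by rewrite prodf_seq_neq0.
(* These are [size P] distinct candidates, more than [P] has roots; starting the denominators at 2
   keeps all of them strictly below [e]. *)
pose rs := [seq e / k.+2%:R | k <- iota 0 (size P)].
have [/hasP[t /mapP[k _ tE] Pt]|/hasPn no] := boolP (has (fun t => ~~ root P t) rs).
  exists t; first by rewrite tE divr_gt0 ?ltr0n //= ltr_pdivrMr ?ltr0n // ltr_pMr // ltr1n.
  apply/allP => p pin; apply: contra Pt => /eqP pt.
  by rewrite rootE /P horner_prod prodf_seq_eq0; apply/hasP; exists p => //=; rewrite pt.
have : (size rs < size P)%N.
  apply: max_poly_roots => //; first by apply/allP => t /no; rewrite negbK.
  rewrite map_inj_uniq ?iota_uniq // => k l /(mulfI (lt0r_neq0 e0)) /invr_inj /eqP.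
  by rewrite eqr_nat => /eqP [].
by rewrite size_map size_iota ltnn.
Qed.
End Avoid.

Section Vectors.
Variable R : realType.
Implicit Types (a b c d n m p q x y w : point3 R) (t s e : R).

Lemma dotE a b : dot a b = a 0 0 * b 0 0 + a 0 1 * b 0 1 + a 0 2 * b 0 2.
Proof.
rewrite /dot mxE !big_ord_recr big_ord0 /= add0r !mxE.
by congr (_ * _ + _ * _ + _ * _); congr (_ 0 _); apply: val_inj.
Qed.
Lemma dotDl a b c : dot (a + b) c = dot a c + dot b c.
Proof. by rewrite !dotE !mxE; ring. Qed.
Lemma dotZl t a c : dot (t *: a) c = t * dot a c.
Proof. by rewrite !dotE !mxE; ring. Qed.
Lemma dotNl a c : dot (- a) c = - dot a c.
Proof. by rewrite !dotE !mxE; ring. Qed.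
Lemma dotBl a b c : dot (a - b) c = dot a c - dot b c.
Proof. by rewrite dotDl dotNl. Qed.
Lemma point3P a b : a 0 0 = b 0 0 -> a 0 1 = b 0 1 -> a 0 2 = b 0 2 -> a = b.
Proof.
move=> h0 h1 h2; apply/rowP => -[[|[|[|//]]] i].
- by rewrite (_ : Ordinal i = 0) //; apply: val_inj.
- by rewrite (_ : Ordinal i = 1) //; apply: val_inj.
- by rewrite (_ : Ordinal i = 2) //; apply: val_inj.
Qed.

Lemma dot_eq0 a : dot a a = 0 -> a = 0.
Proof.
rewrite dotE => h.
by apply: point3P; rewrite mxE; apply/eqP; rewrite -sqrf_eq0; apply/eqP; nra.
Qed.

Definition vec (x0 x1 x2 : R) : point3 R := \row_i nth 0 [:: x0; x1; x2] i.

Definition cross a b : point3 R :=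
  vec (a 0 1 * b 0 2 - a 0 2 * b 0 1) (a 0 2 * b 0 0 - a 0 0 * b 0 2)
      (a 0 0 * b 0 1 - a 0 1 * b 0 0).

Lemma exists_normal a b : exists2 m, m != 0 & dot a m = 0 /\ dot b m = 0.
Proof.
have [c0|cn0] := eqVneq (cross a b) 0; last first.
  by exists (cross a b) => //; rewrite !dotE !mxE /=; split; ring.
have perp u : exists2 m : point3 R, m != 0 & dot u m = 0.
  have [u0|un0] := eqVneq u 0.
    exists (vec 1 0 0); last by rewrite u0 !dotE !mxE; ring.
    by apply/eqP => /rowP/(_ 0)/eqP; rewrite !mxE oner_eq0.
  have [z0|zn0] := eqVneq (vec (u 0 1) (- u 0 0) 0) 0; last first.
    by exists (vec (u 0 1) (- u 0 0) 0) => //; rewrite !dotE !mxE /=; ring.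
  exists (vec 1 0 0).
    by apply/eqP => /rowP/(_ 0)/eqP; rewrite !mxE oner_eq0.
  by move/rowP: z0 => /(_ 1); rewrite !dotE !mxE /=; lra.
have [a0|an0] := eqVneq a 0.
  have [m mn0 bm] := perp b; exists m => //; split=> //.
  by rewrite a0 !dotE !mxE; ring.
(* Since [a] and [b] are parallel and [a] is nonzero, a vector orthogonal to [a] is orthogonal to
   [b] too. The identity below is the expansion of a double cross product, whose right side vanishes
   with [cross a b]. *)
have [m mn0 am] := perp a; exists m => //; split=> //.
apply: (@mulfI _ (dot a a)); first by apply: contra_neq an0 => /dot_eq0.
pose c := cross a b.
have c_eq0 i : c 0 i = 0 by rewrite /c c0 mxE.
have : dot a a * dot b m - dot a b * dot a m =
  - (a 0 1 * c 0 2 - a 0 2 * c 0 1) * m 0 0 - (a 0 2 * c 0 0 - a 0 0 * c 0 2) * m 0 1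
  - (a 0 0 * c 0 1 - a 0 1 * c 0 0) * m 0 2.
  by rewrite !dotE !mxE /=; ring.
by rewrite am !c_eq0; lra.
Qed.

Definition near e x y := forall i, `|(y - x) 0 i| < e.

(** The point is sought on the moment curve [c + (t, t^2, t^3)]. Its coordinates are linearly
    independent polynomials without constant term, so each plane, a pair of normal and offset, cuts
    the curve in the roots of a nonzero polynomial. *)
Lemma avoid_planes (Ps : seq (point3 R * R)) c e : 0 < e ->
  (forall P, P \in Ps -> P.1 != 0) ->
  exists2 c', near e c c' & forall P, P \in Ps -> dot c' P.1 != P.2.
Proof.
move=> e0 Ps0.
pose f (P : point3 R * R) : {poly R} :=
  Poly [:: dot c P.1 - P.2; P.1 0 0; P.1 0 1; P.1 0 2].
have e1 : 0 < Num.min e 1 by rewrite lt_min e0 ltr01.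
have fn0 : all (fun P : {poly R} => P != 0) (map f Ps).
  apply/allP => _ /mapP[P /Ps0 P0 ->]; apply: contra_neq P0 => fP0.
  have cf i : (f P)`_i = 0 by rewrite fP0 coef0.
  apply: point3P; rewrite mxE.
  - by have := cf 1%N; rewrite coef_Poly.
  - by have := cf 2%N; rewrite coef_Poly.
  - by have := cf 3%N; rewrite coef_Poly.
have [t /andP[t0 te] /allP h] := avoid_roots e1 fn0.
move: te; rewrite lt_min => /andP[te t1].
exists (c + vec t (t ^+ 2) (t ^+ 3)) => [i|P Pin].
  rewrite addrC addKr mxE.
  have le k : `|t ^+ k.+1| < e.
    rewrite ger0_norm ?exprn_ge0 ?(ltW t0) //; apply: le_lt_trans te.
    by rewrite exprS ger_pMr // exprn_ile1 // ltW.
  by case: i => -[|[|[|//]]] i /=; [apply: (le 0%N)|apply: le|apply: le].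
have := h (f P) (map_f _ Pin); apply: contraNN => /eqP h0.
apply/eqP; rewrite horner_Poly /= -h0 dotDl (dotE (vec _ _ _)) !mxE /=; ring.
Qed.

(* A separating functional from Farkas' lemma yields the radius e. *)
Lemma stab n a b p q : ~ hit n (segment a b) (segment p q) ->
  exists2 e, 0 < e & forall w x y t, near e 0 w ->
    segment a b x -> segment p q y -> 0 <= t -> x + w - y <> t *: n.
Proof.
move=> nh.
pose r (k l : R) (z : point3 R) : 'rV[R]_(1 + 1 + 3) := row_mx (row_mx k%:M l%:M) z.
have rE k l z k' l' z' t : r k l z - t *: r k' l' z' = r (k - t * k') (l - t * l') (z - t *: z').
  rewrite /r !scale_row_mx !opp_row_mx !add_row_mx !scale_scalar_mx.
  by rewrite -!raddfN /= -!raddfD.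
have r0 k l z : r k l z = 0 -> [/\ k = 0, l = 0 & z = 0].
  rewrite -[X in _ = X]row_mx0 -[X in row_mx X]row_mx0 => /eq_row_mx[/eq_row_mx[h1 h2] ->].
  by move/matrixP: h1 => /(_ 0 0); move/matrixP: h2 => /(_ 0 0); rewrite !mxE eqxx !mulr1n.
(* The vector [(1, 1, - w)] lies in the cone of these generators whenever the first segment,
   translated by [w], hits the second one. At [w = 0] there is no hit, so Farkas' lemma
   separates. *)
pose gs := [:: r 1 0 a; r 1 0 b; r 0 1 (- p); r 0 1 (- q); r 0 0 (- n)].
have coneP w x y t : segment a b x -> segment p q y -> 0 <= t -> x + w - y = t *: n ->
    in_cone gs (r 1 1 (- w)).
  move=> /segmentP[l0 [l1 [l00 l10 e1 ->]]] /segmentP[l2 [l3 [l20 l30 e2 ->]]] t0 e.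
  exists l0 => //; exists l1 => //; exists l2 => //; exists l3 => //; exists t => //=.
  rewrite !rE !mulr1 !mulr0 !subr0 -addrA -opprD e1 -addrA -opprD e2 !subrr.
  rewrite (_ : - w - _ - _ - _ - _ - _ = 0); last first.
    move/rowP: e => e; apply/rowP => i; move: (e i); rewrite !mxE; lra.
  by rewrite /r !raddf0 !row_mx0.
have [|[z [zs zc]]] := farkas gs (r 1 1 0).
  move=> [l0 l00 [l1 l10 [l2 l20 [l3 l30 [t t0]]]]].
  rewrite /= !rE => /r0[h1 h2 h3]; case: nh.
  exists (l0 *: a + l1 *: b), (l2 *: p + l3 *: q), t; split=> //.
  - by apply/segmentP; exists l0, l1; split=> //; lra.
  - by apply/segmentP; exists l2, l3; split=> //; lra.
  - by move/rowP: h3 => h3; apply/rowP => i; move: (h3 i); rewrite !mxE; lra.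
pose M := 1 + \sum_i `|z 0 i|.
have M0 : 0 < M by rewrite ltr_pwDl // sumr_ge0.
exists (- ip (r 1 1 0) z / M) => [|w x y t wn xs ys t0 e]; first by rewrite divr_gt0 // oppr_gt0.
have := in_cone_ip zs (coneP w x y t xs ys t0 e); rewrite leNgt => /negP; apply.
have -> : r 1 1 (- w) = r 1 1 0 + r 0 0 (- w).
  by rewrite /r !add_row_mx add0r -!raddfD /= !addr0.
rewrite ipDl.
have e0 : 0 < - ip (r 1 1 0) z / M by rewrite divr_gt0 // oppr_gt0.
suff : `|ip (r 0 0 (- w)) z| < - ip (r 1 1 0) z by rewrite ltr_norml; lra.
have lt : - ip (r 1 1 0) z / M * \sum_i `|z 0 i| < - ip (r 1 1 0) z.
  rewrite -[X in _ < X](divfK (lt0r_neq0 M0)) ltr_pM2l //.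
  by rewrite /M ltrDr.
apply: le_lt_trans lt; rewrite ipE (le_trans (ler_norm_sum _ _ _)) // mulr_sumr.
apply: ler_sum => i _; rewrite normrM ler_wpM2r // /r.
rewrite !raddf0 row_mx0 mxE; case: split => j; first by rewrite mxE normr0 ltW.
by rewrite mxE normrN; have := wn j; rewrite subr0 => /ltW.
Qed.
End Vectors.

(** * Edges of a knot and their ray hits *)

Section Cyc.
Variable T : eqType.
Implicit Types (w : seq T) (a b : T).

Definition cyc w := zip w (rot 1 w).

Lemma cyc_cons a w : cyc (a :: w) = zip (a :: w) (rcons w a).
Proof. by rewrite /cyc rot1_cons. Qed.

Lemma cyc_cons2 a b w : cyc [:: a, b & w] = (a, b) :: zip (b :: w) (rcons w a).
Proof. by rewrite cyc_cons. Qed.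

Lemma cycP w a b : reflect
  (exists2 i, (i < size w)%N & a = nth a w i /\
     b = nth a w (if i.+1 == size w then 0%N else i.+1))
  ((a, b) \in cyc w).
Proof.
have sz : size w = size (rot 1 w) by rewrite size_rot.
have nr i : (i < size w)%N ->
    nth a (rot 1 w) i = nth a w (if i.+1 == size w then 0%N else i.+1).
  case: w {sz} => [//|x s] /= isz; rewrite rot1_cons nth_rcons eqSS.
  by case: (ltngtP i (size s)) isz => //=; lia.
apply: (iffP idP) => [|[i isz [ai bi]]].
  move=> /(nthP (a, a)) [i]; rewrite size_zip -sz minnn => isz.
  by rewrite nth_zip // => -[ai bi]; exists i => //; rewrite -nr.
apply/(nthP (a, a)); exists i; first by rewrite size_zip -sz minnn.
by rewrite nth_zip // nr // -ai -bi.
Qed.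

Lemma mem_cyc w a b : (a, b) \in cyc w -> a \in w /\ b \in w.
Proof.
case/cycP => i isz [ai bi]; split; [rewrite ai|rewrite bi]; rewrite mem_nth //.
by case: eqP => // ni; lia.
Qed.

Lemma cyc_map (U : eqType) (f : T -> U) w :
  zip (map f w) (rot 1 (map f w)) = [seq (f ab.1, f ab.2) | ab <- cyc w].
Proof.
rewrite -map_rot /cyc; move: (rot 1 w) => v.
by elim: w v => [|x s IH] [|y t] //=; rewrite IH.
Qed.

Lemma cyc_rot k w : perm_eq (cyc (rot k w)) (cyc w).
Proof.
have e : cyc (rot k w) = rot k (cyc w).
  have sz : size w = size (rot 1 w) by rewrite size_rot.
  rewrite /cyc rot_rot /rot zip_cat ?size_drop ?sz //.
  have take_zip (s t : seq T) j : zip (take j s) (take j t) = take j (zip s t).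
    by elim: s t j => [|x s IH] [|y t] [|j] //=; rewrite ?IH // ?zip0s; case: take.
  have drop_zip (s t : seq T) j : size s = size t -> zip (drop j s) (drop j t) = drop j (zip s t).
    by elim: s t j => [|x s IH] [|y t] [|j] //= [] /IH.
  by rewrite take_zip drop_zip.
by rewrite e perm_rot.
Qed.

Lemma cyc_neq w a b : uniq w -> (1 < size w)%N -> (a, b) \in cyc w -> a != b.
Proof.
move=> uw sw /cycP[i isz [ai bi]].
have jsz : ((if i.+1 == size w then 0%N else i.+1) < size w)%N by case: eqP; lia.
by rewrite {1}ai bi nth_uniq //; case: (i.+1 =P size w) => ?; lia.
Qed.

Lemma cyc_next w a b b' : uniq w -> (a, b) \in cyc w -> (a, b') \in cyc w -> b = b'.
Proof.
move=> uw /cycP[i isz [ai bi]] /cycP[j jsz [aj bj]].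
have ij : i = j by apply/eqP; rewrite -(nth_uniq a isz jsz uw) -ai -aj.
by rewrite bi bj ij.
Qed.

Lemma cyc_asym w a b : uniq w -> (2 < size w)%N -> (a, b) \in cyc w -> (b, a) \notin cyc w.
Proof.
move=> uw sw /cycP[i isz [ai bi]]; apply/negP => /cycP[j jsz [bj aj]].
have i'sz : ((if i.+1 == size w then 0%N else i.+1) < size w)%N by case: eqP; lia.
have j'sz : ((if j.+1 == size w then 0%N else j.+1) < size w)%N by case: eqP; lia.
have bj' : b = nth a w j by rewrite (set_nth_default b).
have aj' : a = nth a w (if j.+1 == size w then 0%N else j.+1).
  by rewrite (set_nth_default b).
have /eqP : nth a w j == nth a w (if i.+1 == size w then 0%N else i.+1) by rewrite -bj' -bi.
have /eqP : nth a w i == nth a w (if j.+1 == size w then 0%N else j.+1) by rewrite -aj' -ai.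
move=> /eqP; rewrite nth_uniq // => /eqP h /eqP; rewrite nth_uniq // => /eqP.
by move: h; case: (i.+1 =P size w) => ?; case: (j.+1 =P size w) => ?; lia.
Qed.

(** Every vertex starts one edge and ends one edge, so it is counted twice. All cancellations around
    closed polygons go through this lemma. *)
Lemma cyc_sum (g : T -> bool) w :
  \big[addb/false]_(ab <- cyc w) (g ab.1 (+) g ab.2) = false.
Proof.
rewrite big_split /=.
have sz : size w = size (rot 1 w) by rewrite size_rot.
have -> : \big[addb/false]_(ab <- cyc w) g ab.1 = \big[addb/false]_(a <- w) g a.
  by rewrite -[w in RHS](@unzip1_zip _ _ w (rot 1 w)) ?sz // big_map.
have -> : \big[addb/false]_(ab <- cyc w) g ab.2 = \big[addb/false]_(a <- rot 1 w) g a.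
  by rewrite -[rot 1 w in RHS](@unzip2_zip _ _ w (rot 1 w)) ?sz // big_map.
have pr : perm_eq (rot 1 w) w by rewrite perm_rot.
by rewrite (perm_big _ pr) addbb.
Qed.

Lemma uniq_cyc w : uniq w -> uniq (cyc w).
Proof.
move=> uw; apply: (@map_uniq _ _ fst); rewrite -/(unzip1 _) unzip1_zip //.
by rewrite size_rot.
Qed.

Lemma mem_cyc_out w a : a \in w -> exists b, (a, b) \in cyc w.
Proof.
move=> /(nthP a)[i isz ai]; exists (nth a w (if i.+1 == size w then 0%N else i.+1)).
by apply/cycP; exists i.
Qed.
End Cyc.

Section Edges.
Variable R : realType.
Implicit Types (a b c d n x y : point3 R) (e f : edge R) (w : seq (point3 R)).

Lemma fset2C a b : [fset a; b]%fset = [fset b; a]%fset :> edge R.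
Proof. by rewrite fsetUC. Qed.

Lemma fset2_inj a b c d : [fset a; b]%fset = [fset c; d]%fset :> edge R ->
  (a = c /\ b = d) \/ (a = d /\ b = c).
Proof.
move=> h.
have : a \in [fset c; d]%fset by rewrite -h !inE eqxx.
have : b \in [fset c; d]%fset by rewrite -h !inE eqxx orbT.
have : c \in [fset a; b]%fset by rewrite h !inE eqxx.
have : d \in [fset a; b]%fset by rewrite h !inE eqxx orbT.
rewrite !inE => /orP[]/eqP-> /orP[]/eqP-> /orP[]/eqP ? /orP[]/eqP ?; subst; auto.
Qed.

Lemma segmentC a b : segment a b = segment b a.
Proof.
by apply/seteqP; split=> x /segmentP[s [t [s0 t0 st ->]]]; apply/segmentP;
  exists t, s; rewrite addrC (addrC (_ *: _)).
Qed.

Lemma segment_l a b : segment a b a.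
Proof. by apply/segmentP; exists 1, 0; rewrite scale1r scale0r !addr0. Qed.
Lemma segment_r a b : segment a b b.
Proof. by rewrite segmentC; exact: segment_l. Qed.

Lemma edge_pointsE a b : edge_points [fset a; b]%fset = segment a b.
Proof.
apply/seteqP; split=> x; last by exists a, b.
by move=> [c [d [/fset2_inj[[-> ->]|[-> ->]]]]] //; rewrite segmentC.
Qed.

Lemma closed_edgesP w e :
  reflect (exists2 ab, ab \in cyc w & e = [fset ab.1; ab.2]%fset)
          (e \in closed_edges w).
Proof. by apply: (iffP (imfsetP _ _ _ _)). Qed.

Lemma mem_closed_edges w a b : (a, b) \in cyc w -> [fset a; b]%fset \in closed_edges w.
Proof. by move=> h; apply/closed_edgesP; exists (a, b). Qed.

Lemma edge_mem_vertex w e x : e \in closed_edges w -> x \in e -> x \in w.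
Proof.
case/closed_edgesP => -[a b] /mem_cyc[aw bw] ->.
by rewrite !inE => /orP[] /eqP->.
Qed.

Lemma closed_edges_inj w : uniq w -> (2 < size w)%N ->
  {in cyc w &, injective (fun ab => [fset ab.1; ab.2]%fset : edge R)}.
Proof.
move=> uw sw [a b] [c d] ab cd /fset2_inj[[]|[]] /= ? ?; subst => //.
by have := cyc_asym uw sw ab; rewrite cd.
Qed.

Lemma closed_edges_rot k w : closed_edges (rot k w) = closed_edges w.
Proof.
apply/fsetP => e; apply/closed_edgesP/closed_edgesP => -[ab h ->]; exists ab => //.
  by rewrite -(perm_mem (cyc_rot k w)).
by rewrite (perm_mem (cyc_rot k w)).
Qed.

(** Passes from unordered edges to cyclically consecutive pairs, where [cyc_sum] applies. With fewer
    than three vertices two steps would yield the same edge. *)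
Lemma big_closed_edges (F : edge R -> bool) w : uniq w -> (2 < size w)%N ->
  \big[addb/false]_(e <- closed_edges w) F e =
  \big[addb/false]_(ab <- cyc w) F [fset ab.1; ab.2]%fset.
Proof.
move=> uw sw; rewrite -(big_map (fun ab => [fset ab.1; ab.2]%fset) xpredT).
apply: perm_big; apply: uniq_perm; first exact: fset_uniq.
  rewrite map_inj_in_uniq ?uniq_cyc //; exact: closed_edges_inj.
move=> e; apply/closed_edgesP/mapP => -[ab h ->]; by exists ab.
Qed.
End Edges.

Section Crossings.
Variable R : realType.
Implicit Types (a b c d n m x y : point3 R) (e f : edge R) (s t V : seq (point3 R)).
Implicit Types P Q : {fset edge R}.

Definition hits n e f := `[< hit n (edge_points e) (edge_points f) >].
Definition crossings n P Q :=
  \big[addb/false]_(e <- P) \big[addb/false]_(f <- Q) hits n e f.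

(** Weaker than [gen_dir] on purpose: the direction of projection of a diagram is only known to have
    this property, and only after a translation. *)
Definition transverse n P Q := forall e f x, e \in P -> f \in Q ->
  (x \in e -> ~ hit n [set x] (edge_points f)) /\
  (x \in f -> ~ hit n (edge_points e) [set x]).

Definition disjoint_lines P Q := forall x, polyline_points P x -> ~ polyline_points Q x.

Definition in_span n u v := exists l m : R, n = l *: u + m *: v.

(** The three points may coincide. In particular [x = y = z] makes [n] nonzero as soon as [V] is
    nonempty. *)
Definition gen_dir n V := forall x y z, x \in V -> y \in V -> z \in V ->
  ~ in_span n (y - x) (z - x).

Lemma hitN n X Y : hit (- n) Y X <-> hit n X Y.
Proof.
split=> -[x [y [t [? ? ? e]]]]; exists y, x, t; split=> //.
  by rewrite -opprB e scalerN opprK.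
by rewrite -opprB e scalerN.
Qed.

(** Reversing the direction exchanges the components, which reduces a move of the second component
    to one of the first. *)
Lemma crossingsN n P Q : crossings (- n) Q P = crossings n P Q.
Proof.
rewrite /crossings exchange_big; apply: eq_bigr => e _; apply: eq_bigr => f _.
apply: asbool_equiv_eq; exact: hitN.
Qed.

Lemma avoid_spans (S : seq (point3 R * point3 R)) c (e : R) : 0 < e ->
  exists2 n, near e c n & forall uv, uv \in S -> ~ in_span n uv.1 uv.2.
Proof.
move=> e0.
have [nor norP] := @boolp.choice _ _
  (fun (uv : point3 R * point3 R) m => m != 0 /\ (dot uv.1 m = 0 /\ dot uv.2 m = 0))
  (fun uv => let: ex_intro2 m h h' := exists_normal uv.1 uv.2 in ex_intro _ m (conj h h')).
have Ps0 (pl : point3 R * R) : pl \in [seq (nor uv, 0 : R) | uv <- S] -> pl.1 != 0.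
  by move=> /mapP[uv _ ->]; have [] := norP uv.
have [n nc h] := avoid_planes c e0 Ps0.
exists n => // uv uvS [l [m nE]]; have [_ [h1 h2]] := norP uv.
have := h _ (map_f _ uvS); rewrite /= nE dotDl !dotZl h1 h2 !mulr0 addr0.
by rewrite eqxx.
Qed.

Lemma gen_dir_exists V : exists n, gen_dir n V.
Proof.
pose S := [seq (yz.1 - x, yz.2 - x) | x <- V, yz <- [seq (y, z) | y <- V, z <- V]].
have [n _ h] := @avoid_spans S 0 1 ltr01.
exists n => x y z xV yV zV; apply: (h (y - x, z - x)).
by apply/allpairsP; exists (x, (y, z)); split=> //=; apply/allpairsP; exists (y, z).
Qed.

Lemma hit_span_l n a c d : ~ segment c d a -> hit n [set a] (segment c d) ->
  in_span n (c - a) (d - a).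
Proof.
move=> na [x [y [t [-> /segmentP[s [s' [s0 s'0 ss ->]]] t0 e]]]].
have [tz|tn0] := eqVneq t 0.
  case: na; move/eqP: e; rewrite tz scale0r subr_eq0 => /eqP ->.
  by apply/segmentP; exists s, s'.
exists (- s / t), (- s' / t); apply/rowP => i; move/rowP: e => /(_ i).
have -> : s' = 1 - s by rewrite -ss addrC addKr.
by rewrite !mxE => e; apply: (mulfI tn0); rewrite -e; field.
Qed.

Lemma gen_dirN n V : gen_dir n V -> gen_dir (- n) V.
Proof.
move=> g x y z xV yV zV [l [m e]]; apply: (g x y z xV yV zV).
by exists (- l), (- m); rewrite !scaleNr -opprD -e opprK.
Qed.

Lemma gen_dir_neq0 n V x : x \in V -> gen_dir n V -> n != 0.
Proof.
move=> xV g; apply/eqP => n0; apply: (g x x x xV xV xV).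
by exists 0, 0; rewrite !scale0r addr0.
Qed.

Lemma gen_dirS n V V' : {subset V' <= V} -> gen_dir n V -> gen_dir n V'.
Proof. by move=> sub g x y z /sub xV /sub yV /sub zV; apply: g. Qed.

Lemma gen_dir_hit n V a c d : gen_dir n V -> a \in V -> c \in V -> d \in V ->
  ~ segment c d a -> ~ hit n [set a] (segment c d) /\ ~ hit n (segment c d) [set a].
Proof.
move=> g aV cV dV na; split=> h.
  exact: (g a c d aV cV dV (hit_span_l na h)).
by move/hitN: h => h; apply: (gen_dirN g aV cV dV (hit_span_l na h)).
Qed.
End Crossings.

Section CrossingParity.
Variable R : realType.
Implicit Types (a b c d n m x y : point3 R) (e f : edge R) (s t V : seq (point3 R)).
Implicit Types P Q : {fset edge R}.

Definition polygon P s := [/\ uniq s, (2 < size s)%N & P = closed_edges s].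

Lemma hitsE n a b c d :
  hits n [fset a; b]%fset [fset c; d]%fset = `[< hit n (segment a b) (segment c d) >].
Proof. by rewrite /hits !edge_pointsE. Qed.

Lemma polyline_edge P e x : e \in P -> edge_points e x -> polyline_points P x.
Proof. by move=> eP ex; exists e. Qed.

Lemma triangle_seg a b c x : segment a b x \/ segment b c x \/ segment a c x ->
  triangle a b c x.
Proof.
move=> [|[]] /segmentP[s [t [s0 t0 st ->]]].
- by exists s, t, 0; rewrite scale0r !addr0.
- by exists 0, s, t; rewrite scale0r !add0r.
- by exists s, 0, t; rewrite scale0r !addr0.
Qed.

(** The sum of [prism_parity] over the edges of [Q]. The right sides are differences of one function
    of the vertices of [Q], namely whether the triangle is hit from there, and cancel by
    [cyc_sum]. *)
Lemma prism_sum n a b c Q t : polygon Q t -> gen_dir n ([:: a; b; c] ++ t) ->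
  (forall x, triangle a b c x -> ~ polyline_points Q x) ->
  (\big[addb/false]_(f <- Q) hits n [fset a; b]%fset f) (+)
  (\big[addb/false]_(f <- Q) hits n [fset b; c]%fset f) (+)
  (\big[addb/false]_(f <- Q) hits n [fset a; c]%fset f) = false.
Proof.
move=> [ut st ->] g disj; rewrite !big_closed_edges // -!big_split /=.
rewrite -[RHS](cyc_sum (fun y => `[< hit n (triangle a b c) [set y] >]) t).
apply: eq_big_seq => -[p q] /= pq; have [pt qt] := mem_cyc pq.
have disj' x : triangle a b c x -> ~ segment p q x.
  move=> /disj h sx; apply: h; apply: polyline_edge (mem_closed_edges pq) _.
  by rewrite edge_pointsE.
have inV z : z \in [:: a; b; c] -> z \in [:: a; b; c] ++ t by rewrite mem_cat => ->.
have intV z : z \in t -> z \in [:: a; b; c] ++ t by rewrite mem_cat orbC => ->.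
have aV : a \in [:: a; b; c] by rewrite inE eqxx.
have bV : b \in [:: a; b; c] by rewrite !inE eqxx orbT.
have cV : c \in [:: a; b; c] by rewrite !inE eqxx !orbT.
rewrite !hitsE; apply: prism_parity => //.
- exact: (gen_dir_neq0 (inV _ aV) g).
- move=> x xV; apply: (gen_dir_hit g (inV _ xV) (intV _ pt) (intV _ qt) _).1.
  apply: disj'; apply: triangle_seg; move: xV; rewrite !inE => /or3P[] /eqP->.
  + by left; exact: segment_l.
  + by left; exact: segment_r.
  + by right; left; exact: segment_r.
- move=> y ypq; have yt : y \in t by move: ypq; rewrite !inE => /orP[] /eqP ->.
  have ys : segment p q y.
    by move: ypq; rewrite !inE => /orP[] /eqP ->; [exact: segment_l|exact: segment_r].
  have ny : ~ triangle a b c y by move=> /disj'.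
  by split; apply: (gen_dir_hit g (intV _ yt) (inV _ _) (inV _ _) _).2 => // h;
    apply: ny; apply: triangle_seg; auto.
Qed.

Lemma gen_dir_transverse n P Q s t : polygon P s -> polygon Q t -> disjoint_lines P Q ->
  gen_dir n (s ++ t) -> transverse n P Q.
Proof.
move=> [us ss ->] [ut st ->] disj g e f x /closed_edgesP[[a b] ab ->] /closed_edgesP[[c d] cd ->].
rewrite !edge_pointsE /=.
have [[as_ bs] [ct dt]] := (mem_cyc ab, mem_cyc cd).
have sV z : z \in s -> z \in s ++ t by rewrite mem_cat => ->.
have tV z : z \in t -> z \in s ++ t by rewrite mem_cat orbC => ->.
have disj' z : segment a b z -> ~ segment c d z.
  move=> za zc; apply: (disj z).
    by apply: polyline_edge (mem_closed_edges ab) _; rewrite edge_pointsE.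
  by apply: polyline_edge (mem_closed_edges cd) _; rewrite edge_pointsE.
split=> xe.
  have xab : segment a b x.
    by move: xe; rewrite !inE => /orP[] /eqP ->; [exact: segment_l|exact: segment_r].
  apply: (gen_dir_hit g _ (tV _ ct) (tV _ dt) (disj' _ xab)).1.
  by apply: sV; move: xe; rewrite !inE => /orP[] /eqP ->.
have xcd : segment c d x.
  by move: xe; rewrite !inE => /orP[] /eqP ->; [exact: segment_l|exact: segment_r].
apply: (gen_dir_hit g _ (sV _ as_) (sV _ bs) _).2; last by move=> /disj'.
by apply: tV; move: xe; rewrite !inE => /orP[] /eqP ->.
Qed.

(* In the sum of sector_parity over all pairs of edges the contributions of the
   vertices cancel around each of the two polygons. *)
Lemma crossings_dir_indep n n' P Q s t : polygon P s -> polygon Q t -> disjoint_lines P Q ->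
  n != 0 -> transverse n P Q -> transverse n' P Q ->
  (forall x y, x \in s -> y \in t -> ~ in_span n' n (x - y)) ->
  crossings n P Q = crossings n' P Q.
Proof.
move=> [us ss PE] [ut st QE] disj n0 tr tr' indep; subst P Q.
suff : crossings n (closed_edges s) (closed_edges t) (+)
  crossings n' (closed_edges s) (closed_edges t) = false.
  by do 2 case: crossings.
rewrite /crossings !big_closed_edges // -big_split /=.
under eq_bigr do rewrite !big_closed_edges // -big_split /=.
have E ab cd : ab \in cyc s -> cd \in cyc t ->
   hits n [fset ab.1; ab.2]%fset [fset cd.1; cd.2]%fset (+)
   hits n' [fset ab.1; ab.2]%fset [fset cd.1; cd.2]%fset =
   (`[< hit2 n n' [set ab.1] (segment cd.1 cd.2) >] (+)
   `[< hit2 n n' [set ab.2] (segment cd.1 cd.2) >]) (+)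
  (`[< hit2 n n' (segment ab.1 ab.2) [set cd.1] >] (+)
   `[< hit2 n n' (segment ab.1 ab.2) [set cd.2] >]).
  case: ab cd => a b [c d] /= ab cd; rewrite !hitsE.
  have [[as_ bs] [ct dt]] := (mem_cyc ab, mem_cyc cd).
  have xs x : x \in [:: a; b] -> x \in s by rewrite !inE => /orP[] /eqP ->.
  have yt y : y \in [:: c; d] -> y \in t by rewrite !inE => /orP[] /eqP ->.
  have eab := mem_closed_edges ab; have ecd := mem_closed_edges cd.
  apply: sector_parity.
  - move=> r r' r0 r'0 e.
    have [r'z|r'n] := eqVneq r' 0.
      move: e; rewrite r'z scale0r addr0 => /eqP; rewrite scaler_eq0 (negbTE n0) orbF.
      by move/eqP.
    case: (indep a c as_ ct); exists (- r / r'), 0; rewrite scale0r addr0.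
    apply/rowP => i; move/rowP: e => /(_ i); rewrite !mxE => e.
    have -> : n' 0 i = (r' * n' 0 i) / r' by field.
    by rewrite (_ : r' * n' 0 i = - r * n 0 i); [field|lra].
  - move=> z zab zcd; apply: (disj z).
      by apply: polyline_edge eab _; rewrite edge_pointsE.
    by apply: polyline_edge ecd _; rewrite edge_pointsE.
  - move=> x xab; rewrite -edge_pointsE.
    have xe : x \in [fset a; b]%fset by move: xab; rewrite !inE.
    by split; [apply: (tr _ _ _ eab ecd).1|apply: (tr' _ _ _ eab ecd).1].
  - move=> x xab; rewrite -edge_pointsE.
    have xe : x \in [fset c; d]%fset by move: xab; rewrite !inE.
    by split; [apply: (tr _ _ _ eab ecd).2|apply: (tr' _ _ _ eab ecd).2].
  - move=> x y xab ycd [_ [_ [r [r' [-> -> r0 r'0 e]]]]].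
    have [r'z|r'n] := eqVneq r' 0.
      have xe : x \in [fset a; b]%fset by move: xab; rewrite !inE.
      apply: ((tr _ _ x eab ecd).1 xe); exists x, y, r; split=> //.
        rewrite edge_pointsE; move: ycd; rewrite !inE => /orP[] /eqP ->.
          exact: segment_l.
        exact: segment_r.
      by rewrite e r'z scale0r addr0.
    apply: (indep x y (xs _ xab) (yt _ ycd)); exists (- r / r'), (1 / r').
    apply/rowP => i; move/rowP: e => /(_ i); rewrite !mxE => e.
    by rewrite e; field.
rewrite (eq_big_seq (fun ab => \big[addb/false]_(cd <- cyc t)
  ((`[< hit2 n n' [set ab.1] (segment cd.1 cd.2) >] (+)
   `[< hit2 n n' [set ab.2] (segment cd.1 cd.2) >]) (+)
  (`[< hit2 n n' (segment ab.1 ab.2) [set cd.1] >] (+)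
   `[< hit2 n n' (segment ab.1 ab.2) [set cd.2] >])))); last first.
  by move=> ab h; apply: eq_big_seq => cd h'; exact: E.
under eq_bigr => ab _ do rewrite big_split /= (cyc_sum (fun y => `[< hit2 n n' (segment ab.1 ab.2) [set y] >])) addbF big_split /=.
exact: (cyc_sum (fun x => \big[addb/false]_(cd <- cyc t) `[< hit2 n n' [set x] (segment cd.1 cd.2) >])).
Qed.

(** [crossings_dir_indep] needs the second direction to be independent of the first and of all
    vertex differences, which may fail for [n] and [n']. Both are therefore compared with a third
    direction chosen for this purpose. *)
Lemma crossings_indep n n' P Q s t : polygon P s -> polygon Q t -> disjoint_lines P Q ->
  n != 0 -> n' != 0 -> transverse n P Q -> transverse n' P Q ->
  crossings n P Q = crossings n' P Q.
Proof.
move=> Ps Qt disj n0 n'0 tr tr'.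
pose S0 := [seq (yz.1 - x, yz.2 - x) | x <- s ++ t, yz <- [seq (y, z) | y <- s ++ t, z <- s ++ t]].
pose S1 := [seq (k, xy.1 - xy.2) | k <- [:: n; n'], xy <- [seq (x, y) | x <- s, y <- t]].
have [n'' _ h] := @avoid_spans R (S0 ++ S1) 0 1 ltr01.
have g : gen_dir n'' (s ++ t).
  move=> x y z xV yV zV; apply: (h (y - x, z - x)); rewrite mem_cat; apply/orP; left.
  by apply/allpairsP; exists (x, (y, z)); split=> //=; apply/allpairsP; exists (y, z).
have tr'' := gen_dir_transverse Ps Qt disj g.
have sp k x y : k \in [:: n; n'] -> x \in s -> y \in t -> ~ in_span n'' k (x - y).
  move=> kn xs yt; apply: (h (k, x - y)); rewrite mem_cat; apply/orP; right.
  by apply/allpairsP; exists (k, (x, y)); split=> //=; apply/allpairsP; exists (x, y).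
rewrite (@crossings_dir_indep n n'' P Q s t) //; last by move=> x y; apply: sp; rewrite inE eqxx.
rewrite (@crossings_dir_indep n' n'' P Q s t) //.
by move=> x y; apply: sp; rewrite !inE eqxx orbT.
Qed.
End CrossingParity.

(** * The linking number modulo two *)

Section LinkingNumber.
Variable R : realType.
Implicit Types (A B C a b c d n m x y : point3 R) (e f : edge R) (s t V : seq (point3 R)).
Implicit Types (P Q : {fset edge R}) (K : link R 2).

Lemma ord2_max (i : 'I_2) : i != ord0 -> i = ord_max.
Proof. by case: i => -[|[|//]] //= h _; apply: val_inj. Qed.

Lemma link_polygon k (K : link R k) i : exists s, polygon (K i) s.
Proof. by have [s [? ? ? _]] := component_knot K i; exists s. Qed.

Lemma link_disjoint k (K : link R k) i j : i != j -> disjoint_lines (K i) (K j).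
Proof.
by move=> /(component_disjoint K) ij x xi xj; rewrite -[False]/(set0 x) -ij.
Qed.

(** Quantifying over directions avoids the choice of one; by [lk_parityE] every transverse direction
    gives the same value. *)
Definition lk_parity K : bool :=
  `[< exists n, [/\ n != 0, transverse n (K ord0) (K ord_max)
                  & crossings n (K ord0) (K ord_max)] >].
Definition lk2 K : 'Z_2 := (lk_parity K : nat)%:R.

Lemma lk_parityE n K : n != 0 -> transverse n (K ord0) (K ord_max) ->
  lk_parity K = crossings n (K ord0) (K ord_max).
Proof.
move=> n0 tr; apply/asboolP/idP => [[n' [n'0 tr' c]]|c]; last by exists n.
have [[s Ps] [t Qt]] := (link_polygon K ord0, link_polygon K ord_max).
by rewrite (crossings_indep Ps Qt _ n0 n'0 tr tr') //; exact: link_disjoint.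
Qed.

Lemma edge_neq P s a b : polygon P s -> [fset a; b]%fset \in P -> a != b.
Proof.
move=> [us ss ->] /closed_edgesP[[c d] cd /fset2_inj[[-> ->]|[-> ->]]] /=.
  by rewrite (cyc_neq us _ cd) // ltnW.
by rewrite eq_sym (cyc_neq us _ cd) // ltnW.
Qed.

(** The old and the new edges are the three sides of a triangle, whose counts add up to zero by
    [prism_sum]. The two conditions on edges make sure that the sums over finite sets lose and gain
    exactly these sides. *)
Lemma crossings_move n P P' Q t A B C : polygon Q t -> gen_dir n ([:: A; B; C] ++ t) ->
  (forall x, triangle A B C x -> ~ polyline_points Q x) ->
  [fset A; C]%fset \in P -> [fset C; B]%fset \in P ->
  [fset A; C]%fset != [fset C; B]%fset ->
  [fset A; B]%fset \notin (P `\` [fset [fset A; C]; [fset C; B]])%fset ->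
  P' = ([fset A; B] |` (P `\` [fset [fset A; C]; [fset C; B]]))%fset ->
  crossings n P' Q = crossings n P Q.
Proof.
move=> Qt g disj AC CB neq AB ->.
have CB' : [fset C; B]%fset \in (P `\ [fset A; C])%fset by rewrite in_fsetD1 eq_sym neq.
rewrite /crossings big_fsetU1 // [RHS](big_fsetD1 _ AC) /= [in RHS](big_fsetD1 _ CB') /=.
rewrite fsetDDl addbA; congr (_ (+) _).
have := prism_sum Qt g disj.
rewrite [[fset B; C]%fset]fset2C; by do 3 case: (\big[addb/false]_(f <- Q) _).
Qed.

Lemma elementary_move_lk K K' : elementary_move K K' -> lk_parity K' = lk_parity K.
Proof.
move=> [i [A [B [C [AC CB disj K'i K'j]]]]].
have [s0 P0] := link_polygon K ord0; have [s1 P1] := link_polygon K ord_max.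
have [s0' P0'] := link_polygon K' ord0; have [s1' P1'] := link_polygon K' ord_max.
have [n g] := gen_dir_exists ([:: A; B; C] ++ (s0 ++ s1) ++ (s0' ++ s1')).
have n0 : n != 0 by apply: (gen_dir_neq0 (x := A)) g; rewrite inE eqxx.
have trK : transverse n (K ord0) (K ord_max).
  apply: (gen_dir_transverse P0 P1); first exact: link_disjoint.
  by apply: gen_dirS g => z; rewrite !(mem_cat, inE); do 3 case: (z == _) => //=; do 2 case: (z \in _) => //=.
have trK' : transverse n (K' ord0) (K' ord_max).
  apply: (gen_dir_transverse P0' P1'); first exact: link_disjoint.
  by apply: gen_dirS g => z; rewrite !(mem_cat, inE) => /orP[] ->; rewrite !orbT.
rewrite !(@lk_parityE n) //.
have Pi : polygon (K i) (if i == ord0 then s0 else s1).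
  by case: (i =P ord0) => [->//|/eqP/ord2_max->].
have [us ss _] := Pi.
have knot := component_knot K i; have [w [sw uw KE KI]] := knot.
have nAC := edge_neq Pi AC; have nCB := edge_neq Pi CB.
have nAB : A != B.
  have [w' Pi'] := link_polygon K' i.
  by apply: (edge_neq Pi'); rewrite K'i !inE eqxx.
have neq : [fset A; C]%fset != [fset C; B]%fset :> edge R.
  by apply/eqP => /fset2_inj[[h _]|[h _]]; [rewrite h eqxx in nAC|rewrite h eqxx in nAB].
have AB : [fset A; B]%fset \notin (K i `\` [fset [fset A; C]; [fset C; B]])%fset.
  apply/negP; rewrite in_fsetD in_fset2 negb_or => /andP[/andP[h1 h2] h3].
  (* If [AB] were an edge already, its midpoint would be a point of the link in the triangle, hence
     on [AC] or [CB]; but two edges of a knot meet only in common endpoints. *)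
  pose M := (1/2) *: A + (1/2) *: B.
  have MAB : edge_points [fset A; B]%fset M.
    by rewrite edge_pointsE; apply/segmentP; exists (1/2), (1/2); split=> //; lra.
  have nM : M \notin [fset A; B]%fset.
    apply/negP; rewrite !inE /M => /orP[] /eqP /rowP h; case/eqP: nAB;
      apply/rowP => k; move: (h k); rewrite !mxE; lra.
  have [||] := disj M.
  - split; first by exists i; apply: polyline_edge h3 MAB.
    by exists (1/2), (1/2), 0; rewrite scale0r !addr0; split=> //; lra.
  - rewrite -edge_pointsE => MAC.
    by have := KI _ _ _ h3 AC h1 MAB MAC; rewrite in_fsetI (negbTE nM).
  - rewrite -edge_pointsE => MCB.
    by have := KI _ _ _ h3 CB h2 MAB MCB; rewrite in_fsetI (negbTE nM).
have dj j : j != i -> forall x, triangle A B C x -> ~ polyline_points (K j) x.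
  move=> ji x xt xj; have xi : polyline_points (K i) x.
    have [] := disj x; first by split=> //; exists j.
      by rewrite -edge_pointsE => h; exists [fset A; C]%fset.
    by rewrite -edge_pointsE => h; exists [fset C; B]%fset.
  exact: (link_disjoint ji xj xi).
case: (i =P ord0) => [i0|/eqP i1].
  have KE1 : K' ord_max = K ord_max by apply: K'j; rewrite i0.
  rewrite KE1; subst i; apply: (crossings_move (t := s1) P1 _ (dj ord_max _) AC CB neq AB K'i) => //.
  by apply: gen_dirS g => z; rewrite !(mem_cat, inE); do 3 case: (z == _) => //=; case: (z \in s0) => //=; case: (z \in s1).
have {}i1 := ord2_max i1.
have KE0 : K' ord0 = K ord0 by apply: K'j; rewrite i1.
(* The moved component is the second one; the negated direction lets it play the role of the
   first. *)
rewrite KE0 -[LHS]crossingsN -[RHS]crossingsN; subst i.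
apply: (crossings_move (t := s0) P0 _ (dj ord0 _) AC CB neq AB K'i) => //.
by apply: gen_dirN; apply: gen_dirS g => z; rewrite !(mem_cat, inE); do 3 case: (z == _) => //=; case: (z \in s0) => //=; case: (z \in s1).
Qed.

Lemma isotopic_lk K K' : isotopic K K' -> lk_parity K = lk_parity K'.
Proof. by elim=> [x y /elementary_move_lk|x|x y _|x y z _ h _ h'] //; rewrite h. Qed.

Lemma trivial_lk K : trivial_link K -> lk_parity K = false.
Proof.
move=> [u [h [u0 hinj hK]]].
have [s0 P0] := link_polygon K ord0; have [s1 P1] := link_polygon K ord_max.
have [n g] := gen_dir_exists (s0 ++ s1).
have [x0 x0s] : exists x, x \in s0 by case: s0 P0 g => [[]//|x s _ _]; exists x; rewrite inE eqxx.
have n0 : n != 0 by apply: (gen_dir_neq0 (x := x0)) g; rewrite mem_cat x0s.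
have dotP i x : polyline_points (K i) x -> dot x u = h i.
  move=> [e eK]; have [a [b [c [KE ha hb hc]]]] := hK i.
  move: eK; rewrite KE => /closed_edgesP[[p q] pq ->]; rewrite edge_pointsE.
  have dv z : z \in [:: a; b; c] -> dot z u = h i by rewrite !inE => /or3P[] /eqP ->.
  move=> /segmentP[r [r' [_ _ rr ->]]]; rewrite dotDl !dotZl.
  by have [/dv -> /dv ->] := mem_cyc pq; rewrite -mulrDl rr mul1r.
have hneq : h ord0 - h ord_max != 0 by rewrite subr_eq0; apply/eqP => /hinj.
(* With this sign of [n], rays from the second component do not lead towards the plane of the first.
   A hit would make the square of the height difference nonpositive. *)
wlog sg : n g n0 / (h ord0 - h ord_max) * dot n u <= 0.
  move=> W; have [le|/ltW le] := leP ((h ord0 - h ord_max) * dot n u) 0; first exact: (W n).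
  by apply: (W (- n) (gen_dirN g)); rewrite ?oppr_eq0 // dotNl mulrN oppr_le0.
rewrite (@lk_parityE n) //; last first.
  by apply: (gen_dir_transverse P0 P1) => //; exact: link_disjoint.
rewrite /crossings big1_seq // => e /= eK; rewrite big1_seq // => f /= fK.
apply/asboolP => -[x [y [t [xe yf t0 xy]]]].
have := congr1 (fun z => dot z u) xy; rewrite dotBl dotZl.
rewrite (dotP ord0 x) ?(dotP ord_max y); [|by exists f|by exists e].
move=> E; case/eqP: hneq; apply/eqP; rewrite -sqrf_eq0 eq_le sqr_ge0 andbT.
by rewrite expr2 {2}E mulrCA mulr_ge0_le0.
Qed.
End LinkingNumber.

(** * Subdivisions and diagrams *)

Lemma map_uniq_inj (T U : eqType) (f : T -> U) (w : seq T) :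
  uniq (map f w) -> {in w &, injective f}.
Proof.
elim: w => [//|x w IH] /= /andP[fx /IH inj] y z; rewrite !inE.
move=> /orP[/eqP->|yw] /orP[/eqP->|zw] // e; last exact: inj.
- by rewrite e map_f in fx.
- by rewrite -e map_f in fx.
Qed.

Section Subdivision.
Variable R : realType.
Implicit Types (a b c d x y : point3 R) (e f : edge R) (s t w : seq (point3 R)).

Lemma segment_param a b (r r' : R) : a != b ->
  (1 - r) *: a + r *: b = (1 - r') *: a + r' *: b -> r = r'.
Proof.
move=> ab e; apply/eqP; rewrite -subr_eq0.
have : (r - r') *: (b - a) == 0.
  by apply/eqP/rowP => i; move/rowP: e => /(_ i); rewrite !mxE; lra.
by rewrite scaler_eq0 (subr_eq0 b) (eq_sym b) (negbTE ab) orbF.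
Qed.

Definition noncollinear (V : seq (point3 R)) := forall a b c,
  a \in V -> b \in V -> c \in V -> uniq [:: a; b; c] -> ~ collinear a b c.

Lemma segment_collinear a b x : segment a b x -> collinear a b x.
Proof.
move=> [r _ ->]; exists a, (b - a) => z; rewrite !inE => /or3P[] /eqP ->.
- by exists 0; rewrite scale0r addr0.
- by exists 1; rewrite scale1r addrC subrK.
- by exists r; rewrite scalerBl scale1r scalerBr; apply/rowP => i; rewrite !mxE; ring.
Qed.

Lemma line_ends a b x y : x != y -> segment a b x -> segment a b y ->
  forall z, z \in [:: a; b] -> exists k : R, z = x + k *: (y - x).
Proof.
move=> xy [r _ xE] [r' _ yE].
have rr : r' - r != 0.
  by rewrite subr_eq0; apply: contraNneq xy => rr; rewrite xE yE rr.
move=> z; rewrite !inE => /orP[] /eqP ->; [exists (- r / (r' - r))|exists ((1 - r) / (r' - r))];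
  by apply/rowP => i; rewrite xE yE !mxE; field.
Qed.

(** All four endpoints lie on the line through [x] and [y], and no three distinct points of [V]
    do. *)
Lemma two_points V a b c d x y : noncollinear V ->
  a \in V -> b \in V -> c \in V -> d \in V -> a != b -> c != d ->
  x != y -> segment a b x -> segment a b y -> segment c d x -> segment c d y ->
  [fset a; b]%fset = [fset c; d]%fset :> edge R.
Proof.
move=> nc aV bV cV dV ab cd xy ax ay cx cy.
have l1 := line_ends xy ax ay; have l2 := line_ends xy cx cy.
have col p q r : p \in [:: a; b] ++ [:: c; d] -> q \in [:: a; b] ++ [:: c; d] ->
    r \in [:: a; b] ++ [:: c; d] -> ~~ uniq [:: p; q; r].
  have inl z : z \in [:: a; b] ++ [:: c; d] -> exists k : R, z = x + k *: (y - x).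
    by rewrite mem_cat => /orP[/l1|/l2].
  have inV z : z \in [:: a; b] ++ [:: c; d] -> z \in V.
    by rewrite mem_cat !inE => /orP[] /orP[] /eqP ->.
  move=> ph qh rh; apply/negP => /(nc _ _ _ (inV _ ph) (inV _ qh) (inV _ rh)); apply.
  by exists x, (y - x) => z; rewrite !inE => /or3P[] /eqP ->; apply: inl.
have ain : a \in [:: a; b] ++ [:: c; d] by rewrite !inE eqxx.
have bin : b \in [:: a; b] ++ [:: c; d] by rewrite !inE eqxx orbT.
have cin : c \in [:: a; b] ++ [:: c; d] by rewrite !inE eqxx !orbT.
have din : d \in [:: a; b] ++ [:: c; d] by rewrite !inE eqxx !orbT.
have third p : ~~ uniq [:: a; b; p] -> (p == a) || (p == b).
  apply: contraR; rewrite negb_or => /andP[h1 h2].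
  by rewrite /= !inE negb_or ab [a == p]eq_sym h1 [b == p]eq_sym h2.
have := third _ (col a b c ain bin cin); have := third _ (col a b d ain bin din).
move=> /orP[] /eqP ? /orP[] /eqP ?; subst.
- by rewrite eqxx in cd.
- by rewrite fset2C.
- by [].
- by rewrite eqxx in cd.
Qed.

Lemma in_edge_segment a b c d : segment a b `<=` segment c d -> segment c d a /\ segment c d b.
Proof. by move=> h; split; apply: h; [exact: segment_l|exact: segment_r]. Qed.

Lemma segment_convex a b x y : segment a b x -> segment a b y -> segment x y `<=` segment a b.
Proof.
move=> /segmentP[r [r' [r0 r'0 rr ->]]] /segmentP[q [q' [q0 q'0 qq ->]]].
move=> _ /segmentP[k [k' [k0 k'0 kk ->]]]; apply/segmentP.
exists (k * r + k' * q), (k * r' + k' * q'); split.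
- by rewrite addr_ge0 ?mulr_ge0.
- by rewrite addr_ge0 ?mulr_ge0.
- by rewrite addrACA -!mulrDr rr qq !mulr1.
- by apply/rowP => i; rewrite !mxE; ring.
Qed.

Lemma edge_interiorP a b c : edge_interior [fset a; b]%fset c ->
  [/\ segment a b c, c != a & c != b].
Proof.
move=> [h]; rewrite edge_pointsE in h => /negP; rewrite !inE negb_or => /andP[ca cb].
by split.
Qed.

Lemma split_segment a b c : a != b -> segment a b c -> c != a -> c != b ->
  [/\ forall x, segment a b x -> segment a c x \/ segment c b x,
      forall x, segment a c x -> segment c b x -> x = c,
      ~ segment c b a & ~ segment a c b].
Proof.
move=> ab [k /andP[k0 k1] cE] ca cb.
have k0' : 0 < k by rewrite lt_neqAle k0 andbT; apply: contraNneq ca => kz; rewrite cE -kz subr0 scale1r scale0r addr0.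
have k1' : k < 1 by rewrite lt_neqAle k1 andbT; apply: contraNneq cb => kz; rewrite cE kz subrr scale1r scale0r add0r.
have par x : segment a c x -> exists2 r : R, 0 <= r <= k & x = (1 - r) *: a + r *: b.
  move=> [r /andP[r0 r1] ->]; exists (r * k); first by rewrite mulr_ge0 //= ger_pMl.
  by rewrite cE; apply/rowP => i; rewrite !mxE; ring.
have par' x : segment c b x -> exists2 r : R, k <= r <= 1 & x = (1 - r) *: a + r *: b.
  move=> [r /andP[r0 r1] ->]; exists (k + r * (1 - k)); first by nra.
  by rewrite cE; apply/rowP => i; rewrite !mxE; ring.
split.
- move=> x [r /andP[r0 r1] ->]; have [rk|kr] := leP r k.
    left; exists (r / k); first by rewrite divr_ge0 //= ler_pdivrMr // mul1r.
    by rewrite cE; apply/rowP => i; rewrite !mxE; field; rewrite gt_eqF.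
  right; exists ((r - k) / (1 - k)).
    by rewrite divr_ge0 ?subr_ge0 ?(ltW kr) //= ler_pdivrMr ?subr_gt0 // mul1r lerD2r.
  by rewrite cE; apply/rowP => i; rewrite !mxE; field; rewrite subr_eq0 gt_eqF.
- move=> x /par[r /andP[_ rk] xE] /par'[r' /andP[kr' _] xE'].
  have rr : r = r' by apply: (segment_param ab); rewrite -xE -xE'.
  by rewrite xE cE (_ : r = k) //; apply/eqP; rewrite eq_le rk rr kr'.
- move=> /par'[r /andP[kr _] aE]; have : 0 = r.
    by apply: (segment_param ab); rewrite -aE subr0 scale1r scale0r addr0.
  lra.
- move=> /par[r /andP[_ rk] bE]; have : 1 = r.
    by apply: (segment_param ab); rewrite -bE subrr scale1r scale0r add0r.
  lra.
Qed.

Section Chain.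
Variables (s : seq (point3 R)).
Hypotheses (us : uniq s) (ss : (2 < size s)%N) (ncs : noncollinear s).

Definition within e a b := segment a b `<=` edge_points e.

Lemma closed_edge_two e f x y : e \in closed_edges s -> f \in closed_edges s ->
  x != y -> edge_points e x -> edge_points e y -> edge_points f x -> edge_points f y -> e = f.
Proof.
move=> /closed_edgesP[[a b] ab ->] /closed_edgesP[[c d] cd ->] xy.
have [[? ?] [? ?]] := (mem_cyc ab, mem_cyc cd).
rewrite !edge_pointsE; apply: (two_points ncs) => //.
  exact: (cyc_neq us (ltnW ss) ab).
exact: (cyc_neq us (ltnW ss) cd).
Qed.

Lemma subdivision_within t a b : subdivision s t -> (a, b) \in cyc t ->
  a != b /\ exists2 e, e \in closed_edges s & within e a b.
Proof.
move=> st; elim: st a b => {t} [|k t _ IH|a0 b0 c t _ IH cint] a b.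
- move=> ab; split; first exact: (cyc_neq us (ltnW ss) ab).
  by exists [fset a; b]%fset; [exact: mem_closed_edges|rewrite /within edge_pointsE].
- by rewrite (perm_mem (cyc_rot k t)); exact: IH.
have [cin ca cb] := edge_interiorP cint.
have IHab : (a0, b0) \in cyc [:: a0, b0 & t] by rewrite cyc_cons2 inE eqxx.
have [ab0 [e es we]] := IH _ _ IHab.
rewrite cyc_cons2 /= !inE => /or3P[/eqP[-> ->]|/eqP[-> ->]|old].
- rewrite eq_sym; split=> //; exists e => // x /(segment_convex (segment_l _ _) cin); exact: we.
- split=> //; exists e => // x /(segment_convex cin (segment_r _ _)); exact: we.
- by apply: IH; rewrite cyc_cons2 inE old orbT.
Qed.

Lemma subdivision_cover t e x : subdivision s t -> e \in closed_edges s ->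
  edge_points e x -> exists a b, [/\ (a, b) \in cyc t, within e a b & segment a b x].
Proof.
move=> st es xe; elim: st => {t} [|k t _ IH|a0 b0 c t st IH cint].
- case/closed_edgesP: es xe => -[a b] ab ->; rewrite edge_pointsE => xe.
  by exists a, b; split=> //; rewrite /within edge_pointsE.
- by move: IH => [a [b [ab h]]]; exists a, b; rewrite (perm_mem (cyc_rot k t)).
have [cin ca cb] := edge_interiorP cint.
have IHab : (a0, b0) \in cyc [:: a0, b0 & t] by rewrite cyc_cons2 inE eqxx.
have [ab0 _] := subdivision_within st IHab.
have [cov _ _ _] := split_segment ab0 cin ca cb.
have mem u : (u \in cyc [:: a0, c, b0 & t]) = [|| u == (a0, c), u == (c, b0) | u \in zip (b0 :: t) (rcons t a0)].
  by rewrite cyc_cons2 /= !inE.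
case: IH => a [b [ab wab xab]]; move: ab; rewrite cyc_cons2 inE => /orP[/eqP[aE bE]|old].
  subst a b; case: (cov x xab) => h.
    exists a0, c; rewrite mem eqxx; split=> // y /(segment_convex (segment_l _ _) cin); exact: wab.
  exists c, b0; rewrite mem eqxx orbT; split=> // y /(segment_convex cin (segment_r _ _)); exact: wab.
by exists a, b; rewrite mem old !orbT.
Qed.

(* [w] labels the vertices of the subdivision so that coinciding vertices of
   different strands stay distinct. *)
Lemma subdivision_meet (pt : point3 R -> point3 R) t w e u v x :
  subdivision s t -> uniq w -> map pt w = t -> e \in closed_edges s ->
  u \in cyc w -> v \in cyc w ->
  within e (pt u.1) (pt u.2) -> within e (pt v.1) (pt v.2) ->
  segment (pt u.1) (pt u.2) x -> segment (pt v.1) (pt v.2) x ->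
  [\/ u = v, u.2 = v.1 /\ x = pt u.2 | v.2 = u.1 /\ x = pt u.1].
Proof.
move=> st uw wt es; elim: st w u v uw wt => {t} [|k t _ IH|a0 b0 c t st IH cint] w u v uw wt.
- move=> uc vc wu wv xu xv; constructor 1.
  have inj : {in w &, injective pt} by apply: map_uniq_inj; rewrite wt.
  have cs z : z \in cyc w -> (pt z.1, pt z.2) \in cyc s.
    by move=> zc; rewrite -wt /cyc cyc_map; apply/mapP; exists z.
  have E z : z \in cyc w -> within e (pt z.1) (pt z.2) -> e = [fset pt z.1; pt z.2]%fset.
    move=> /cs zc wz; have ne := cyc_neq us (ltnW ss) zc.
    apply: (closed_edge_two es (mem_closed_edges zc) ne); rewrite ?edge_pointsE.
    - by apply: wz; exact: segment_l.
    - by apply: wz; exact: segment_r.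
    - exact: segment_l.
    - exact: segment_r.
  have := closed_edges_inj us ss (cs _ uc) (cs _ vc).
  rewrite /= -(E u) // -(E v) // => /(_ erefl) [h1 h2].
  case: u v uc vc h1 h2 {wu wv xu xv} => u1 u2 [v1 v2] /mem_cyc[? ?] /mem_cyc[? ?] /=.
  by move=> /inj -> // /inj ->.
- have uw' : uniq (rotr k w) by rewrite rotr_uniq.
  have wt' : map pt (rotr k w) = t by rewrite map_rotr wt rotK.
  have := IH _ u v uw' wt'.
  by rewrite -!(perm_mem (cyc_rot k (rotr k w))) rotrK.
case: w uw wt => [|a' [|c' [|b' w]]] //= uw [pa pc pb wt].
have [cin ca cb] := edge_interiorP cint.
have IHab : (a0, b0) \in cyc [:: a0, b0 & t] by rewrite cyc_cons2 inE eqxx.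
have [ab0 [e0 e0s we0]] := subdivision_within st IHab.
have [_ acb na nb] := split_segment ab0 cin ca cb.
have sub1 : segment a0 c `<=` segment a0 b0 by exact: (segment_convex (segment_l _ _) cin).
have sub2 : segment c b0 `<=` segment a0 b0 by exact: (segment_convex cin (segment_r _ _)).
(* A piece of the subdivided edge is a proper segment lying in [e] and in [e0], so these are the
   same edge of [s]. *)
have up y z : y != z -> segment y z `<=` segment a0 b0 -> within e y z -> within e a0 b0.
  move=> yz sub wyz; rewrite (_ : e = e0) //.
  apply: (closed_edge_two es e0s yz); [apply: wyz|apply: wyz|apply/we0/sub|apply/we0/sub];
    by [exact: segment_l|exact: segment_r].
set w0 := [:: a', b' & w].
have uw0 : uniq w0.
  by move: uw; rewrite /= !inE !negb_or => /and3P[/and3P[_ -> ->] _ ->].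
have w0t : map pt w0 = [:: a0, b0 & t] by rewrite /= pa pb wt.
have cw0 : cyc w0 = (a', b') :: zip (b' :: w) (rcons w a') by rewrite cyc_cons2.
have cw z : z \in cyc [:: a', c', b' & w] ->
    [\/ z = (a', c'), z = (c', b') | z \in zip (b' :: w) (rcons w a')].
  rewrite cyc_cons2 /= !inE => /or3P[/eqP->|/eqP->|h]; by [constructor 1|constructor 2|constructor 3].
have oldP z : z \in zip (b' :: w) (rcons w a') -> z \in cyc w0 /\ z <> (a', b').
  move=> h; split; first by rewrite cw0 inE h orbT.
  by move=> zE; have := uniq_cyc uw0; rewrite cw0 /= -zE h.
have a'b' : (a', b') \in cyc w0 by rewrite cw0 inE eqxx.
(* To compare a new piece with an old edge, the piece is replaced by its parent from [a0] to [b0],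
   for which the induction hypothesis is available. *)
have mix z : z \in zip (b' :: w) (rcons w a') -> within e (pt z.1) (pt z.2) ->
    within e a0 b0 -> segment (pt z.1) (pt z.2) x -> segment a0 b0 x ->
    (b' = z.1 /\ x = b0) \/ (z.2 = a' /\ x = a0).
  move=> /oldP[zc zn] wz wab xz xab.
  have := IH w0 (a', b') z uw0 w0t a'b' zc; rewrite /= pa pb => H.
  by case: (H wab wz xab xz) => [zE|[]|[]]; [case: zn|left|right].
move=> /cw[->|->|uo] /cw[->|->|vo] /=; rewrite ?pa ?pb ?pc => wu wv xu xv.
- by constructor 1.
- by constructor 2; split=> //; exact: acb.
- case: (mix _ vo wv (up _ _ _ sub1 wu) xv (sub1 _ xu)) => [|[e1 xE]|[e1 xE]].
  + by rewrite eq_sym.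
  + by case: nb; rewrite -xE.
  + by constructor 3.
- by constructor 3; split=> //; exact: acb.
- by constructor 1.
- case: (mix _ vo wv (up _ _ cb sub2 wu) xv (sub2 _ xu)) => [[e1 xE]|[e1 xE]].
  + by constructor 2.
  + by case: na; rewrite -xE.
- case: (mix _ uo wu (up _ _ _ sub1 wv) xu (sub1 _ xv)) => [|[e1 xE]|[e1 xE]].
  + by rewrite eq_sym.
  + by case: nb; rewrite -xE.
  + by constructor 2; rewrite e1 xE.
- case: (mix _ uo wu (up _ _ cb sub2 wv) xu (sub2 _ xv)) => [[e1 xE]|[e1 xE]].
  + by constructor 3; rewrite -e1 xE.
  + by case: na; rewrite -xE.
- have [[uc _] [vc _]] := (oldP _ uo, oldP _ vo).
  exact: (IH w0 u v uw0 w0t uc vc).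
Qed.
End Chain.
End Subdivision.

Lemma small_enough (R : realType) (Z : eqType) (zs : seq Z) (Q : Z -> R -> Prop) :
  (forall z, z \in zs -> exists2 e, 0 < e & Q z e) ->
  (forall z e e', e' <= e -> Q z e -> Q z e') ->
  exists2 e, 0 < e & forall z, z \in zs -> Q z e.
Proof.
move=> h mon; elim: zs h => [|z zs IH] h; first by exists 1.
have [|e e0 he] := IH; first by move=> y yz; apply: h; rewrite inE yz orbT.
have [e' e'0 he'] := h z (mem_head _ _).
exists (Num.min e e') => [|y]; first by rewrite lt_min e0.
rewrite inE => /orP[/eqP->|yz]; first by apply: mon he'; rewrite ge_min lexx orbT.
by apply: mon (he _ yz); rewrite ge_min lexx.
Qed.

(** * Translating one component *)

Section Translation.
Variable R : realType.
Implicit Types (a b c d n m x y w U V : point3 R) (s t : seq (point3 R)).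
Implicit Types (P Q : {fset edge R}).

Lemma polygon_map P s w : polygon P s ->
  polygon (closed_edges (map (+%R^~ w) s)) (map (+%R^~ w) s).
Proof. by move=> [us ss _]; split; rewrite ?size_map // map_inj_uniq //; exact: addIr. Qed.

Lemma segment_add a b w x : segment (a + w) (b + w) x <-> segment a b (x - w).
Proof.
split=> [[k k01 ->]|[k k01 e]]; exists k => //.
  by apply/rowP => i; rewrite !mxE; ring.
by apply/rowP => i; move/rowP: e => /(_ i); rewrite !mxE; lra.
Qed.

(** During the translation an edge sweeps out a parallelogram that avoids [Q]. The diagonal from [a]
    to [b + w] cuts it into two triangles, to which [prism_sum] applies; the sides swept by the
    vertices cancel around the polygon. *)
Lemma crossings_translate n P Q s t w : polygon P s -> polygon Q t ->
  gen_dir n (s ++ map (+%R^~ w) s ++ t) ->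
  (forall x (r : R), 0 <= r <= 1 -> polyline_points P x -> ~ polyline_points Q (x + r *: w)) ->
  crossings n (closed_edges (map (+%R^~ w) s)) Q = crossings n P Q.
Proof.
move=> [us ss PE] Qt g disj; subst P.
pose F x y := \big[addb/false]_(f <- Q) hits n [fset x; y]%fset f.
have [us' ss' _] := polygon_map w (And3 us ss erefl).
suff : crossings n (closed_edges (map (+%R^~ w) s)) Q (+) crossings n (closed_edges s) Q = false.
  by do 2 case: crossings.
rewrite /crossings !big_closed_edges // [cyc (map _ s)]cyc_map big_map -big_split /=.
rewrite -[RHS](cyc_sum (fun a => F a (a + w)) s); apply: eq_big_seq => -[a b] /= ab.
have [as_ bs] := mem_cyc ab.
have inV z : z \in s -> (z \in s ++ map (+%R^~ w) s ++ t) && (z + w \in s ++ map (+%R^~ w) s ++ t).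
  by move=> zs; rewrite !mem_cat zs /= (map_f (+%R^~ w) zs) orbT.
have [/andP[aV awV] /andP[bV bwV]] := (inV a as_, inV b bs).
have sub x y z : x \in s ++ map (+%R^~ w) s ++ t -> y \in s ++ map (+%R^~ w) s ++ t ->
    z \in s ++ map (+%R^~ w) s ++ t -> gen_dir n ([:: x; y; z] ++ t).
  move=> xV yV zV; apply: gen_dirS g => u; rewrite mem_cat !inE.
  move=> /orP[/or3P[]/eqP->//|ut]; by rewrite !mem_cat ut !orbT.
have par x k k' r : 0 <= k -> 0 <= k' -> k + k' = 1 -> 0 <= r <= 1 ->
   x = k *: a + k' *: b + r *: w -> ~ polyline_points Q x.
  move=> k0 k'0 kk r01 ->; apply: disj => //; exists [fset a; b]%fset; first exact: mem_closed_edges.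
  by rewrite edge_pointsE; apply/segmentP; exists k, k'.
have h1 : F a b (+) F b (b + w) (+) F a (b + w) = false.
  apply: (prism_sum Qt (sub _ _ _ aV bV bwV)) => x [r0 [r1 [r2 [? ? ? rr xE]]]].
  apply: (par x r0 (r1 + r2) r2); [lra|lra|lra|lra|].
  by rewrite xE; apply/rowP => i; rewrite !mxE; ring.
have h2 : F a (a + w) (+) F (a + w) (b + w) (+) F a (b + w) = false.
  apply: (prism_sum Qt (sub _ _ _ aV awV bwV)) => x [r0 [r1 [r2 [? ? ? rr xE]]]].
  apply: (par x (r0 + r1) r2 (r1 + r2)); [lra|lra|lra|lra|].
  by rewrite xE; apply/rowP => i; rewrite !mxE; ring.
move: h1 h2; rewrite -/(F a b) -/(F (a + w) (b + w)).
by do 5 case: (F _ _).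
Qed.

Lemma dot_small m (k : R) : 0 < k -> exists2 e, 0 < e & forall w, near e 0 w -> `|dot w m| < k.
Proof.
move=> k0; pose M := 1 + `|m 0 0| + `|m 0 1| + `|m 0 2|.
have M0 : 0 < M by rewrite /M -!addrA ltr_pwDl // !addr_ge0.
exists (k / M) => [|w wn]; first by rewrite divr_gt0.
have b i : `|w 0 i| < k / M by have := wn i; rewrite subr0.
rewrite dotE (le_lt_trans (ler_normD _ _)) //.
have := ler_normD (w 0 0 * m 0 0) (w 0 1 * m 0 1); rewrite !normrM => h.
have kM : k / M * M = k by rewrite divfK // gt_eqF.
have h0 := ler_wpM2r (normr_ge0 (m 0 0)) (ltW (b 0)).
have h1 := ler_wpM2r (normr_ge0 (m 0 1)) (ltW (b 1)).
have h2 := ler_wpM2r (normr_ge0 (m 0 2)) (ltW (b 2)).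
have p : 0 < k / M by rewrite divr_gt0.
rewrite -[X in _ < X]kM /M !mulrDr mulr1; lra.
Qed.

Definition det3 a b c := dot (cross a b) c.

Lemma cramer a b c x :
  det3 a b c *: x = det3 x b c *: a + det3 a x c *: b + det3 a b x *: c.
Proof. by apply: point3P; rewrite /det3 !dotE !mxE /=; ring. Qed.

Lemma cross_normal a b n : n != 0 -> dot a n = 0 -> dot b n = 0 -> det3 a b n = 0 ->
  cross a b = 0.
Proof.
move=> n0 an bn dn.
have nn : dot n n != 0 by apply: contra_neq n0; exact: dot_eq0.
have E : dot n n *: cross a b = det3 a b n *: n
   + dot a n *: cross n b + dot b n *: cross a n.
  by apply: point3P; rewrite /det3 !dotE !mxE /=; ring.
have : dot n n *: cross a b == 0 by rewrite E an bn dn !scale0r !addr0.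
by rewrite scaler_eq0 (negbTE nn) => /eqP.
Qed.

Lemma cross0_collinear a b c d x : a != b ->
  cross (b - a) (d - c) = 0 -> segment a b x -> segment c d x ->
  collinear a b c /\ collinear a b d.
Proof.
set U := b - a; set V := d - c => ab c0 [s _ xE] [r _ xE'].
have UU : dot U U != 0.
  by apply: contra_neq ab => /dot_eq0/eqP; rewrite subr_eq0 => /eqP.
pose k := dot U V / dot U U.
have VE : V = k *: U.
  have E : dot U U *: V = dot U V *: U - cross U (cross U V).
    by apply: point3P; rewrite !dotE !mxE /=; ring.
  rewrite -[V]scale1r -(mulVf UU) -scalerA E c0 /k.
  apply: point3P; rewrite !mxE /=; field; exact: UU.
have cE : c = a + (s - r * k) *: U.
  have : c = x - r *: V by rewrite xE'; apply/rowP => i; rewrite !mxE; ring.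
  by move=> ->; rewrite VE xE; apply/rowP => i; rewrite !mxE; ring.
have dE : d = a + (s - r * k + k) *: U.
  have -> : d = c + V by rewrite addrC subrK.
  by rewrite VE cE -addrA -scalerDl.
by split; exists a, U => z; rewrite !inE => /or3P[] /eqP ->;
  [exists 0; rewrite scale0r addr0|exists 1; rewrite scale1r addrC subrK|eexists; exact: cE
  |exists 0; rewrite scale0r addr0|exists 1; rewrite scale1r addrC subrK|eexists; exact: dE].
Qed.
End Translation.

Lemma big_addb_single (T : eqType) (F : T -> bool) (s : seq T) (x : T) : uniq s -> x \in s ->
  F x -> (forall y, y \in s -> F y -> y = x) -> \big[addb/false]_(y <- s) F y = true.
Proof.
move=> us xs Fx Fu; rewrite (big_rem x) //= Fx big1_seq // => y /=.
rewrite (mem_rem_uniq _ us) !inE => /andP[yx ys].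
by apply/negP => /(Fu _ ys) e; rewrite e eqxx in yx.
Qed.
Section Projection.
Variable R : realType.
Implicit Types (a b c d x y w : point3 R) (S : plane R) (s t : seq (point3 R)).

Lemma normal_dot S : dot (normal S) (normal S) != 0.
Proof. by apply: contra_neq (normal_neq0 S); exact: dot_eq0. Qed.

Lemma project_along S x : exists k : R, x - project S x = k *: normal S.
Proof. by eexists; rewrite /project opprB addrC subrK. Qed.

Lemma project_eq S x y : project S x = project S y <-> exists k : R, x - y = k *: normal S.
Proof.
split=> [xy|[k xy]].
  have [[k kE] [l lE]] := (project_along S x, project_along S y).
  exists (k - l); rewrite scalerBl -kE -lE xy; apply/rowP => i; rewrite !mxE; ring.
have -> : x = y + k *: normal S by rewrite -xy addrC subrK.
rewrite /project dotDl dotZl; apply/rowP => i; rewrite !mxE.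
by field; exact: normal_dot.
Qed.

Lemma project_conv S (r r' : R) x y : r + r' = 1 ->
  project S (r *: x + r' *: y) = r *: project S x + r' *: project S y.
Proof.
move=> rr; rewrite /project dotDl !dotZl; apply/rowP => i; rewrite !mxE.
have -> : r' = 1 - r by rewrite -rr addrC addKr.
by field; exact: normal_dot.
Qed.

Lemma project_segment S a b x : segment a b x ->
  segment (project S a) (project S b) (project S x).
Proof.
move=> /segmentP[r [r' [r0 r'0 rr ->]]]; apply/segmentP; exists r, r'.
by split=> //; exact: project_conv.
Qed.

Lemma project_segment_lift S a b y : segment (project S a) (project S b) y ->
  exists2 x, segment a b x & project S x = y.
Proof.
move=> /segmentP[r [r' [r0 r'0 rr ->]]]; exists (r *: a + r' *: b).
  by apply/segmentP; exists r, r'.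
exact: project_conv.
Qed.

Lemma project_dot S x : dot (project S x) (normal S) = offset S.
Proof. by rewrite /project dotBl dotZl; field; exact: normal_dot. Qed.

Lemma within_image S e a b : within e (project S a) (project S b) <->
  project S @` edge_points [fset a; b]%fset `<=` edge_points e.
Proof.
rewrite edge_pointsE; split=> [h _ [x xab <-]|h y /project_segment_lift[x xab <-]].
  by apply: h; exact: project_segment.
by apply: h; exists x.
Qed.

Lemma subdivision_sub s t : subdivision s t -> {subset s <= t}.
Proof.
elim=> {t} [//|k t _ IH|a b c t _ IH _] x /IH; first by rewrite mem_rot.
by rewrite !inE => /or3P[->|->|->]; rewrite ?orbT.
Qed.

Lemma subdivision_size s t : subdivision s t -> (size s <= size t)%N.
Proof. by elim=> {t} [//|k t _|a b c t _ IH _]; rewrite ?size_rot //=; apply: leqW. Qed.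

Lemma enum_ord2 : enum 'I_2 = [:: ord0; ord_max].
Proof. by apply: (inj_map val_inj); rewrite val_enum_ord. Qed.

End Projection.

Section DiagramCount.
Variables (R : realType) (K : link R 2) (D : diagram R 2).
Hypothesis hD : diagram_of D K.
Local Notation n := (normal (dplane D)).
Local Notation pt := (project (dplane D)).
Local Notation L := (dlines D).
Implicit Types (a b c d x y w : point3 R) (e f : edge R).

Lemma diagram_lines i : [/\ uniq (L i), (2 < size (L i))%N & noncollinear (L i)].
Proof.
have [[sz uV nc _] _ _] := hD; rewrite enum_ord2 /= cats0 in uV nc.
have sub z : z \in L i -> z \in L ord0 ++ L ord_max.
  by rewrite mem_cat; case: (i =P ord0) => [->|/eqP/ord2_max->] ->; rewrite ?orbT.
split=> // [|a b c /sub aV /sub bV /sub cV]; last exact: nc.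
by move: uV; rewrite cat_uniq; case: (i =P ord0) => [->|/eqP/ord2_max->] /and3P[].
Qed.

Lemma diagram_all : [/\ uniq (L ord0 ++ L ord_max) & noncollinear (L ord0 ++ L ord_max)].
Proof. by have [[sz uV nc _] _ _] := hD; rewrite enum_ord2 /= cats0 in uV nc. Qed.

Lemma diagram_vertices i : exists w : seq (point3 R),
  [/\ polygon (K i) w & subdivision (L i) (map pt w)].
Proof.
have [_ /(_ i)[w [uw KE sd]] _] := hD; exists w; split=> //; split=> //.
have [_ sL _] := diagram_lines i; apply: leq_trans sL _.
by rewrite -(size_map pt w); exact: subdivision_size.
Qed.

Lemma diagram_dot i x : x \in L i -> dot x n = offset (dplane D).
Proof.
have [w [_ sd]] := diagram_vertices i.
by move=> /(subdivision_sub sd)/mapP[y _ ->]; exact: project_dot.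
Qed.

(** Two edges of the link over the same edge of the diagram whose projections share a point are
    equal or consecutive, by [subdivision_meet]; in the second case both points are the common
    vertex. *)
Lemma strand_inj i e x y : e \in closed_edges (L i) ->
  strand (dplane D) K i e x -> strand (dplane D) K i e y -> pt x = pt y -> x = y.
Proof.
move=> eL [g [gK gw xg]] [g' [g'K g'w yg']] xy.
have [w [[uw sw KE] sd]] := diagram_vertices i.
have [uL sL ncL] := diagram_lines i.
move: gK g'K gw g'w xg yg'; rewrite KE => /closed_edgesP[u uc ->] /closed_edgesP[v vc ->].
move=> /within_image wu /within_image wv; rewrite !edge_pointsE => xu yv.
have ptc z : z \in cyc w -> (pt z.1, pt z.2) \in cyc (map pt w).
  by move=> zc; rewrite /cyc cyc_map; apply/mapP; exists z.
have inj z a b : z \in cyc w -> segment z.1 z.2 a -> segment z.1 z.2 b -> pt a = pt b -> a = b.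
  move=> zc [r _ aE] [q _ bE]; have [ne _] := subdivision_within uL sL sd (ptc _ zc).
  rewrite aE bE !project_conv; [|ring|ring] => /(segment_param ne) -> //.
have := subdivision_meet uL sL ncL sd uw erefl eL uc vc wu wv (project_segment _ xu).
rewrite xy => /(_ (project_segment _ yv)) [uv|[e1 e2]|[e1 e2]].
- by rewrite -uv in yv; exact: (inj u).
- have -> : x = u.2 by apply: (inj u) => //; [exact: segment_r|rewrite xy].
  by rewrite e1; apply/esym/(inj v) => //; [exact: segment_l|rewrite e2 e1].
- have -> : x = u.1 by apply: (inj u) => //; [exact: segment_l|rewrite xy].
  by rewrite -e1; apply/esym/(inj v) => //; [exact: segment_r|rewrite e2 -e1].
Qed.

(** An endpoint of one edge on an edge of the other component would be collinear with the two ends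
    of the latter, against genericity. So common points of different components are crossings. *)
Lemma closed_edge_interior e f x : e \in closed_edges (L ord0) -> f \in closed_edges (L ord_max) ->
  edge_points e x -> edge_points f x -> crossing D ord0 ord_max e f x.
Proof.
move=> eL fL xe xf; have [uV ncV] := diagram_all.
have dj z : z \in L ord0 -> z \in L ord_max -> False.
  by move=> z0 z1; move: uV; rewrite cat_uniq => /and3P[_ /hasPn /(_ z z1)] /=; rewrite z0.
have nin i j e' f' z : i != j -> e' \in closed_edges (L i) -> f' \in closed_edges (L j) ->
    edge_points f' z -> z \notin e'.
  move=> ij eL' fL' zf; apply/negP => ze; have zi := edge_mem_vertex eL' ze.
  have inV k y : y \in L k -> y \in L ord0 ++ L ord_max.
    by rewrite mem_cat; case: (k =P ord0) => [->|/eqP/ord2_max->] ->; rewrite ?orbT.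
  have djij y : y \in L i -> y \in L j -> False.
    move: ij; case: (i =P ord0) => [->|/eqP/ord2_max->];
      case: (j =P ord0) => [->|/eqP/ord2_max->]; rewrite ?eqxx // => _ h1 h2;
      by [exact: dj h1 h2|exact: dj h2 h1].
  move: fL' zf => /closed_edgesP[[c d] cd ->]; rewrite edge_pointsE => zcd.
  have [cj dj'] := mem_cyc cd; have [uj sj _] := diagram_lines j.
  apply: (ncV c d z (inV j _ cj) (inV j _ dj') (inV i _ zi)); last exact: segment_collinear.
  rewrite /= !inE negb_or (cyc_neq uj (ltnW sj) cd) andbT /=.
  by apply/andP; split; apply/eqP => h; apply: (djij z) => //; rewrite -h.
split=> //.
  apply/eqP => ef; subst f; case/closed_edgesP: (eL) => -[a b] ab eE.
  have [a0 _] := mem_cyc ab.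
  by apply: (dj a a0); apply: (edge_mem_vertex fL); rewrite eE !inE eqxx.
split; split=> //=; apply/negP.
- exact: (nin ord0 ord_max e f x).
- exact: (nin ord_max ord0 f e x).
Qed.

(** Both edges are orthogonal to the normal, so a vanishing determinant would make them parallel;
    having a common point they would lie on one line, with three collinear vertices. *)
Lemma crossing_det a b c d x : (a, b) \in cyc (L ord0) -> (c, d) \in cyc (L ord_max) ->
  segment a b x -> segment c d x -> det3 (b - a) (d - c) n != 0.
Proof.
move=> ab cd xa xc; apply/eqP => d0; have [uV ncV] := diagram_all.
have [[a0 b0] [c1 d1]] := (mem_cyc ab, mem_cyc cd).
have [u0 s0 _] := diagram_lines ord0; have [u1 s1 _] := diagram_lines ord_max.
have abn := cyc_neq u0 (ltnW s0) ab.
have c0 : cross (b - a) (d - c) = 0.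
  apply: (cross_normal (normal_neq0 (dplane D))) d0; rewrite dotBl.
    by rewrite (diagram_dot a0) (diagram_dot b0) subrr.
  by rewrite (diagram_dot c1) (diagram_dot d1) subrr.
have [col _] := cross0_collinear abn c0 xa xc.
have inV0 z : z \in L ord0 -> z \in L ord0 ++ L ord_max by rewrite mem_cat => ->.
have inV1 z : z \in L ord_max -> z \in L ord0 ++ L ord_max by rewrite mem_cat orbC => ->.
apply: (ncV a b c (inV0 _ a0) (inV0 _ b0) (inV1 _ c1)) col.
rewrite /= !inE negb_or abn andbT /=.
have dj z : z \in L ord0 -> z != c.
  move=> z0; apply/eqP => zc; move: uV; rewrite cat_uniq => /and3P[_ /hasPn /(_ c c1)] /=.
  by rewrite -zc z0.
by rewrite !dj.
Qed.
End DiagramCount.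

(** * The linking number read off a diagram *)

Section CrossingStable.
Variable R : realType.
Implicit Types (a b c d n m x y w : point3 R).

(** By Cramer's rule the translation [w] splits along the two edges and [n]. The components along
    the edges are absorbed by moving the crossing point within each of them, which is possible
    because the point is interior and these components depend linearly on [w]. *)
Lemma crossing_stable a b c d n x : det3 (b - a) (d - c) n != 0 ->
  segment a b x -> segment c d x -> x \notin [:: a; b] -> x \notin [:: c; d] ->
  exists2 e, 0 < e & forall w, near e 0 w ->
    exists y z (k : R), [/\ segment a b y, segment c d z & y + w - z = k *: n].
Proof.
set U := b - a; set V := d - c; set D := det3 U V n => D0 [s /andP[s0 s1] xE] [r /andP[r0 r1] xE'].
rewrite !inE !negb_or => /andP[xa xb] /andP[xc xd].
have inside p q (k : R) : 0 <= k -> k <= 1 -> x = (1 - k) *: p + k *: q -> x != p -> x != q -> 0 < k < 1.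
  move=> k0 k1 xk xp xq; rewrite !lt_neqAle k0 k1 !andbT; apply/andP; split.
    by apply: contraNneq xp => kz; rewrite xk -kz subr0 scale1r scale0r addr0.
  by apply: contraNneq xq => kz; rewrite xk kz subrr scale1r scale0r add0r.
have /andP[s0' s1'] := inside _ _ _ s0 s1 xE xa xb.
have /andP[r0' r1'] := inside _ _ _ r0 r1 xE' xc xd.
(* The room left on both sides of the crossing point, measured in the parameters of the two
   segments. *)
pose k := Num.min (Num.min s (1 - s)) (Num.min r (1 - r)).
have k0 : 0 < k by rewrite !lt_min s0' r0' !subr_gt0 s1' r1'.
have [ks ks'] : k <= s /\ k <= 1 - s by rewrite !ge_min !lexx ?orbT.
have [kr kr'] : k <= r /\ k <= 1 - r by rewrite !ge_min !lexx ?orbT.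
have [e1 e10 h1] := dot_small (- D^-1 *: cross V n) k0.
have [e2 e20 h2] := dot_small (- D^-1 *: cross n U) k0.
exists (Num.min e1 e2) => [|w wn]; first by rewrite lt_min e10.
have w1 : near e1 0 w by move=> i; have := wn i; rewrite lt_min => /andP[].
have w2 : near e2 0 w by move=> i; have := wn i; rewrite lt_min => /andP[].
pose al := dot w (- D^-1 *: cross V n); pose be := dot w (- D^-1 *: cross n U).
have := h1 w w1; rewrite ltr_norml -/al => /andP[al0 al1].
have := h2 w w2; rewrite ltr_norml -/be => /andP[be0 be1].
exists (x + al *: U), (x - be *: V), (det3 U V w / D); split.
- exists (s + al); first by lra.
  by rewrite xE; apply/rowP => i; rewrite !mxE; ring.
- exists (r - be); first by lra.
  by rewrite xE'; apply/rowP => i; rewrite !mxE; ring.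
have wE : w = D^-1 *: (det3 w V n *: U + det3 U w n *: V + det3 U V w *: n).
  by rewrite -cramer scalerA mulVf // scale1r.
have alE : al = - (D^-1 * det3 w V n) by rewrite /al /det3 !dotE !mxE /=; ring.
have beE : be = - (D^-1 * det3 U w n) by rewrite /be /det3 !dotE !mxE /=; ring.
rewrite alE beE; move: (det3 w V n) (det3 U w n) (det3 U V w) wE => p1 p2 p3 -> {w wn w1 w2 al be al0 al1 be0 be1 alE beE}.
by apply/rowP => i; rewrite !mxE; ring.
Qed.

Lemma parallel_unique a b c d n w y z y' z' : det3 (b - a) (d - c) n != 0 ->
  segment a b y -> segment c d z -> segment a b y' -> segment c d z' ->
  (exists k : R, y + w - z = k *: n) -> (exists k : R, y' + w - z' = k *: n) ->
  y = y' /\ z = z'.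
Proof.
set U := b - a; set V := d - c => D0 [p _ yE] [q _ zE] [p' _ yE'] [q' _ zE'] [k kE] [k' kE'].
have E : (p - p') *: U - (q - q') *: V = (k - k') *: n.
  rewrite [RHS]scalerBl -kE -kE' yE zE yE' zE'; apply/rowP => i; rewrite !mxE; ring.
have h1 : (p - p') * det3 U V n = 0.
  (* Pairing with the cross product of [V] and [n] eliminates both and isolates the difference of
     the parameters on the first segment. *)
  have : dot ((p - p') *: U - (q - q') *: V) (cross V n) = dot ((k - k') *: n) (cross V n) by rewrite E.
  rewrite /det3 !dotE !mxE /= => h; lra.
have h2 : (q - q') * det3 U V n = 0.
  have : dot ((p - p') *: U - (q - q') *: V) (cross n U) = dot ((k - k') *: n) (cross n U) by rewrite E.
  rewrite /det3 !dotE !mxE /= => h; lra.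
move/eqP: h1; rewrite mulf_eq0 (negbTE D0) orbF subr_eq0 => /eqP pp.
move/eqP: h2; rewrite mulf_eq0 (negbTE D0) orbF subr_eq0 => /eqP qq.
by rewrite yE zE yE' zE' pp qq.
Qed.
End CrossingStable.

Section DiagramParity.
Variables (R : realType) (K : link R 2) (D : diagram R 2).
Hypothesis hD : diagram_of D K.
Local Notation n := (normal (dplane D)).
Local Notation pt := (project (dplane D)).
Local Notation L := (dlines D).
Implicit Types (a b c d x y : point3 R) (e f : edge R).
Variables (w0 w1 : seq (point3 R)).
Hypotheses (p0 : polygon (K ord0) w0) (p1 : polygon (K ord_max) w1).
Hypotheses (sd0 : subdivision (L ord0) (map pt w0)) (sd1 : subdivision (L ord_max) (map pt w1)).
Variable w : point3 R.

(* The direction of projection need not be transverse to K itself, only to K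
   with its first component translated by w. *)
Definition shifted_hit k (u v : point3 R * point3 R) := exists x y t,
  [/\ segment u.1 u.2 x, segment v.1 v.2 y, 0 <= t & x + w - y = t *: k].

(** [w] is so small that the translation creates no hit upwards, downwards or in place; the downward
    case is needed to exclude that the translated strands meet in the wrong order. *)
Hypothesis stabw : forall u v k, u \in cyc w0 -> v \in cyc w1 -> k \in [:: n; - n; 0] ->
  shifted_hit k u v -> hit k (segment u.1 u.2) (segment v.1 v.2).
Hypothesis crossw : forall a b c d x, (a, b) \in cyc (L ord0) -> (c, d) \in cyc (L ord_max) ->
  segment a b x -> segment c d x ->
  exists y z (k : R), [/\ segment a b y, segment c d z & y + w - z = k *: n].
(** The translated vertices of the first component are neither above nor below the second one; the
    next hypothesis is the same for the vertices of the second. *)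
Hypothesis genw0 : forall a v y (k : R), a \in w0 -> v \in cyc w1 -> segment v.1 v.2 y ->
  a + w - y <> k *: n.
Hypothesis genw1 : forall u c x (k : R), u \in cyc w0 -> c \in w1 -> segment u.1 u.2 x ->
  x + w - c <> k *: n.

Lemma strand_segment i s e u x : polygon (K i) s -> u \in cyc s ->
  within e (pt u.1) (pt u.2) -> segment u.1 u.2 x -> strand (dplane D) K i e x.
Proof.
move=> [_ _ KE] uc wu xu; exists [fset u.1; u.2]%fset; split.
- by rewrite KE; apply/closed_edgesP; exists u.
- exact/within_image.
- by rewrite edge_pointsE.
Qed.

(** If [e] crosses over [f], the translated projections still meet in exactly one point. It is not a
    projected vertex, so a single edge of the link in each strand is responsible for it, and the sum
    has one term. Otherwise a term would come from a hit of the untranslated strands, that is, from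
    such a crossing. *)
Lemma shifted_count e f : e \in closed_edges (L ord0) -> f \in closed_edges (L ord_max) ->
  \big[addb/false]_(u <- cyc w0) \big[addb/false]_(v <- cyc w1)
     [&& `[< within e (pt u.1) (pt u.2) >], `[< within f (pt v.1) (pt v.2) >] & `[< shifted_hit n u v >]] =
  `[< exists x, crossing D ord0 ord_max e f x >] && goes_over D e f.
Proof.
move=> eL fL.
have [uV ncV] := diagram_all hD.
have [[uw0 sw0 K0] [uw1 sw1 K1]] := (p0, p1).
have [_ _ hover] := hD.
have [uL0 sL0 nc0] := diagram_lines hD ord0; have [uL1 sL1 nc1] := diagram_lines hD ord_max.
have nn := normal_dot (dplane D).
have nn0 : 0 < dot n n.
  by rewrite lt_neqAle eq_sym nn dotE -!expr2 !addr_ge0 ?sqr_ge0.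
have lift0 u : u \in cyc w0 -> (pt u.1, pt u.2) \in cyc (map pt w0).
  by move=> uc; rewrite /cyc cyc_map; apply/mapP; exists u.
have lift1 u : u \in cyc w1 -> (pt u.1, pt u.2) \in cyc (map pt w1).
  by move=> uc; rewrite /cyc cyc_map; apply/mapP; exists u.
have noDisj u v x : u \in cyc w0 -> v \in cyc w1 -> segment u.1 u.2 x -> ~ segment v.1 v.2 x.
  move=> uc vc xu xv; have := @link_disjoint R 2 K ord0 ord_max isT x; apply.
    by rewrite K0; exists [fset u.1; u.2]%fset; [apply/closed_edgesP; exists u|rewrite edge_pointsE].
  by rewrite K1; exists [fset v.1; v.2]%fset; [apply/closed_edgesP; exists v|rewrite edge_pointsE].
case: (boolP (_ && _)) => [/andP[/asboolP[A crA] over]|no]; last first.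
  rewrite big1_seq // => u /= uc; rewrite big1_seq // => v /= vc.
  apply/negbTE; apply: contra no => /and3P[/asboolP wu /asboolP wv /asboolP h].
  have [|x [y [t [xu yv t0 e1]]]] := stabw uc vc _ h; first by rewrite inE eqxx.
  have pxy : pt x = pt y by apply/project_eq; exists t.
  have cr : crossing D ord0 ord_max e f (pt x).
    apply: (closed_edge_interior hD eL fL); first by apply: wu; exact: project_segment.
    by apply: wv; rewrite pxy; exact: project_segment.
  apply/andP; split; first by apply/asboolP; exists (pt x).
  apply/(hover _ _ _ _ _ cr); exists x, y; split=> //.
  - exact: (strand_segment p0 uc wu).
  - exact: (strand_segment p1 vc wv).
  - rewrite -subr_gt0 -dotBl e1 dotZl mulr_gt0 // lt_neqAle t0 andbT.
    apply/eqP => tz; apply: (noDisj _ _ _ uc vc xu); move: e1; rewrite -tz scale0r.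
    by move/eqP; rewrite subr_eq0 => /eqP ->.
have [eL' fL' _ [[xe xen] [xf xfn]]] := crA.
have [x [y [xs ys pxA pyA yx]]] := (hover _ _ _ _ _ crA).1 over.
move: eL fL (eL) (fL) => _ _ /closed_edgesP[[a b] ab eE] /closed_edgesP[[c d] cd fE].
rewrite /= in eE fE.
have abn := cyc_neq uL0 (ltnW sL0) ab; have cdn := cyc_neq uL1 (ltnW sL1) cd.
have xab : segment a b A by rewrite -edge_pointsE -eE.
have xcd : segment c d A by rewrite -edge_pointsE -fE.
have det0 := crossing_det hD ab cd xab xcd.
(* A downward hit would project to the same crossing point. Each strand has only one point there, so
   it would contradict that [e] is over [f]. *)
have nohit u v : u \in cyc w0 -> v \in cyc w1 -> within e (pt u.1) (pt u.2) ->
    within f (pt v.1) (pt v.2) -> ~ hit (- n) (segment u.1 u.2) (segment v.1 v.2).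
  move=> uc vc wu wv [x' [y' [t [x'u y'v t0 e1]]]].
  have pxy : pt x' = pt y' by apply/project_eq; exists (- t); rewrite e1 scalerN scaleNr.
  have pA : pt x' = A.
    apply: (proj1 (parallel_unique (w := 0) (z := pt x') (z' := A) det0 _ _ xab xcd _ _)).
    - by rewrite -edge_pointsE -eE; apply: wu; exact: project_segment.
    - by rewrite -edge_pointsE -fE pxy; apply: wv; exact: project_segment.
    - by exists 0; rewrite addr0 subrr scale0r.
    - by exists 0; rewrite addr0 subrr scale0r.
  have xx : x = x'.
    apply: (strand_inj hD eL' xs (strand_segment p0 uc wu x'u)); by rewrite pxA pA.
  have yy : y = y'.
    apply: (strand_inj hD fL' ys (strand_segment p1 vc wv y'v)); by rewrite pyA -pxy pA.
  move: yx; rewrite xx yy -subr_gt0 -dotBl e1 scalerN dotNl dotZl oppr_gt0 ltNge.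
  by rewrite mulr_ge0 // ltW.
have [B [C [k0 [Bab Ccd BC]]]] := crossw ab cd xab xcd.
have [pu1 [pu2 [puc pw pB]]] : exists a' b', [/\ (a', b') \in cyc (map pt w0), within e a' b' & segment a' b' B].
  by apply: (subdivision_cover uL0 sL0 sd0 eL'); rewrite eE edge_pointsE.
have [pv1 [pv2 [pvc pwv pC]]] : exists a' b', [/\ (a', b') \in cyc (map pt w1), within f a' b' & segment a' b' C].
  by apply: (subdivision_cover uL1 sL1 sd1 fL'); rewrite fE edge_pointsE.
move: puc pvc; rewrite /cyc !cyc_map => /mapP[u uc [u1E u2E]] /mapP[v vc [v1E v2E]].
rewrite u1E u2E in pw pB; rewrite v1E v2E in pwv pC.
have [x1 x1u x1B] := project_segment_lift pB; have [y1 y1v y1C] := project_segment_lift pC.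
have par1 z : exists k : R, z - pt z = k *: n by exact: project_along.
have [kx kxE] := par1 x1; have [ky kyE] := par1 y1; rewrite x1B in kxE; rewrite y1C in kyE.
have e1 : x1 + w - y1 = (kx + k0 - ky) *: n.
  by rewrite scalerBl scalerDl -kxE -kyE -BC; apply/rowP => i; rewrite !mxE; ring.
have huv : shifted_hit n u v.
  have [k00|/ltW k00] := leP 0 (kx + k0 - ky); first by exists x1, y1, (kx + k0 - ky).
  case: (nohit u v uc vc pw pwv); apply: stabw => //; first by rewrite !inE eqxx orbT.
  by exists x1, y1, (- (kx + k0 - ky)); rewrite oppr_ge0 scalerN scaleNr opprK.
(* By [parallel_unique] every other pair meets over the same points [B] and [C]. Two different edges
   of one strand could share such a point only at a vertex, which the choice of [w] excludes. *)
have uniq_uv u' v' : u' \in cyc w0 -> v' \in cyc w1 -> within e (pt u'.1) (pt u'.2) ->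
    within f (pt v'.1) (pt v'.2) -> shifted_hit n u' v' -> u' = u /\ v' = v.
  move=> u'c v'c wu' wv' [x2 [y2 [t2 [x2u y2v t20 e2]]]].
  have [kx2 kx2E] := par1 x2; have [ky2 ky2E] := par1 y2.
  have [BE CE] : B = pt x2 /\ C = pt y2.
    apply: (parallel_unique (w := w) det0 Bab Ccd).
    - by rewrite -edge_pointsE -eE; apply: wu'; exact: project_segment.
    - by rewrite -edge_pointsE -fE; apply: wv'; exact: project_segment.
    - by exists k0.
    - exists (t2 - kx2 + ky2); rewrite scalerDl scalerBl -kx2E -ky2E -e2.
      by apply/rowP => i; rewrite !mxE; ring.
  have mem2 (s : seq (point3 R)) z : z \in cyc s -> z.1 \in s /\ z.2 \in s.
    by case: z => z1 z2 /mem_cyc.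
  have bad0 z : z \in w0 -> pt z = B -> False.
    move=> zw zB; have [kz kzE] := par1 z; rewrite zB in kzE.
    apply: (genw0 (k := kz + k0 - ky) zw vc y1v).
    by rewrite scalerBl scalerDl -kzE -kyE -BC; apply/rowP => i; rewrite !mxE; ring.
  have bad1 z : z \in w1 -> pt z = C -> False.
    move=> zw zC; have [kz kzE] := par1 z; rewrite zC in kzE.
    apply: (genw1 (k := kx + k0 - kz) uc zw x1u).
    by rewrite scalerBl scalerDl -kzE -kxE -BC; apply/rowP => i; rewrite !mxE; ring.
  split.
  - have B2 : segment (pt u'.1) (pt u'.2) B by rewrite BE; exact: project_segment.
    have [//|[h1 h2]|[h1 h2]] := subdivision_meet uL0 sL0 nc0 sd0 uw0 erefl eL' u'c uc wu' pw B2 pB.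
      by case: (bad0 u'.2); rewrite ?(mem2 _ _ u'c).2.
    by case: (bad0 u'.1); rewrite ?(mem2 _ _ u'c).1.
  - have C2 : segment (pt v'.1) (pt v'.2) C by rewrite CE; exact: project_segment.
    have [//|[h1 h2]|[h1 h2]] := subdivision_meet uL1 sL1 nc1 sd1 uw1 erefl fL' v'c vc wv' pwv C2 pC.
      by case: (bad1 v'.2); rewrite ?(mem2 _ _ v'c).2.
    by case: (bad1 v'.1); rewrite ?(mem2 _ _ v'c).1.
apply: (big_addb_single (x := u)) => //; first exact: uniq_cyc.
  apply: (big_addb_single (x := v)) => //; first exact: uniq_cyc.
    by apply/and3P; split; exact/asboolP.
  move=> v' v'c /and3P[/asboolP wu' /asboolP wv' /asboolP h].
  by have [] := uniq_uv u v' uc v'c wu' wv' h.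
move=> u' u'c /negPn; rewrite negbK => /eqP; apply: contra_eq => u'u.
rewrite big1_seq // => v' /= v'c; apply/negP => /and3P[/asboolP wu' /asboolP wv' /asboolP h].
by have [h' _] := uniq_uv u' v' u'c v'c wu' wv' h; rewrite h' eqxx in u'u.
Qed.
End DiagramParity.

Section DiagramLk.
Variable R : realType.
Implicit Types (a b c d x y w : point3 R) (e f : edge R) (K : link R 2) (D : diagram R 2).

Lemma near_le w (r r' : R) : r' <= r -> near r' 0 w -> near r 0 w.
Proof. by move=> rr wn i; apply: lt_le_trans (wn i) rr. Qed.

Lemma near_scale w (r k : R) : 0 <= k <= 1 -> near r 0 w -> near r 0 (k *: w).
Proof.
move=> /andP[k0 k1] wn i; have := wn i; rewrite !subr0 mxE normrM ger0_norm //.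
by apply: le_lt_trans; rewrite ler_piMl.
Qed.

Lemma shifted_stable (s t : seq (point3 R)) (ks : seq (point3 R)) :
  exists2 r : R, 0 < r & forall w, near r 0 w -> forall u v k, u \in cyc s -> v \in cyc t ->
    k \in ks -> shifted_hit w k u v -> hit k (segment u.1 u.2) (segment v.1 v.2).
Proof.
pose zs := [seq (uv, k) | uv <- [seq (u, v) | u <- cyc s, v <- cyc t], k <- ks].
pose Q (z : (_ * _) * point3 R) (r : R) := forall w, near r 0 w ->
  shifted_hit w z.2 z.1.1 z.1.2 -> hit z.2 (segment z.1.1.1 z.1.1.2) (segment z.1.2.1 z.1.2.2).
have [|z r r' rr h w /(near_le rr)|r r0 h] := @small_enough R _ zs Q.
- move=> [[u v] k] _; case: (pselect (hit k (segment u.1 u.2) (segment v.1 v.2))) => [h|nh].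
    by exists 1.
  have [r r0 h] := stab nh; exists r => // w wn [x [y [t' [xu yv t0 e]]]].
  by case: (h w x y t' wn xu yv t0).
- exact: h.
exists r => // w wn u v k us vt kk; apply: (h ((u, v), k)) => //.
apply/allpairsP; exists ((u, v), k); split=> //=; by apply/allpairsP; exists (u, v).
Qed.

(** Only pairs with [ord0] over [ord_max] are counted. After the translation the direction of
    projection is transverse, and the hits of pairs of link edges are regrouped by the diagram edges
    that contain their projections. *)
Lemma lk_diagram D K : diagram_of D K ->
  lk_parity K = \big[addb/false]_(e <- closed_edges (dlines D ord0))
    \big[addb/false]_(f <- closed_edges (dlines D ord_max))
      (`[< exists x, crossing D ord0 ord_max e f x >] && goes_over D e f).
Proof.
move=> hD; set n := normal (dplane D); pose pt := project (dplane D).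
have [w0 [p0 sd0]] := diagram_vertices hD ord0.
have [w1 [p1 sd1]] := diagram_vertices hD ord_max.
have [[uw0 sw0 K0] [uw1 sw1 K1]] := (p0, p1).
have dj : disjoint_lines (K ord0) (K ord_max) by exact: link_disjoint.
have n0 : n != 0 := normal_neq0 (dplane D).
have [uL0 sL0 nc0] := diagram_lines hD ord0; have [uL1 sL1 nc1] := diagram_lines hD ord_max.
have [r1 r10 h1] := shifted_stable w0 w1 [:: n; - n; 0].
pose zs := [seq (u, v) | u <- cyc (dlines D ord0), v <- cyc (dlines D ord_max)].
pose Q (z : (point3 R * point3 R) * (point3 R * point3 R)) (r : R) := forall w, near r 0 w ->
  forall x, segment z.1.1 z.1.2 x -> segment z.2.1 z.2.2 x ->
  exists y z' (k : R), [/\ segment z.1.1 z.1.2 y, segment z.2.1 z.2.2 z' & y + w - z' = k *: n].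
have Qex z : z \in zs -> exists2 r : R, 0 < r & Q z r.
  move=> /allpairsP[[[a b] [c d]] [/= ab cd ->]].
  case: (pselect (exists x, segment a b x /\ segment c d x)) => [[x [xa xc]]|no]; last first.
    by exists 1 => // w _ x xa xc; case: no; exists x.
  have eL := mem_closed_edges ab; have fL := mem_closed_edges cd.
  have [_ _ _ [[_ xn] [_ xn']]] : crossing D ord0 ord_max [fset a; b]%fset [fset c; d]%fset x.
    by apply: (closed_edge_interior hD eL fL); rewrite edge_pointsE.
  have xab : x \notin [:: a; b] by apply/negP => h; apply: xn => /=; move: h; rewrite !inE.
  have xcd : x \notin [:: c; d] by apply/negP => h; apply: xn' => /=; move: h; rewrite !inE.
  have [r r0 h] := crossing_stable (crossing_det hD ab cd xa xc) xa xc xab xcd.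
  by exists r => // w wn x' _ _; exact: h.
have [r2 r20 h2] := small_enough Qex (fun z r r' rr h w wn => h w (near_le rr wn)).
(* For a vertex and an edge, the translations that bring the vertex above or below the edge lie in a
   plane parallel to [n] and to the edge. These are the planes that [w] avoids. *)
have [nor norP] := @boolp.choice _ _
  (fun (d : point3 R) m => m != 0 /\ (dot n m = 0 /\ dot d m = 0))
  (fun d => let: ex_intro2 m h h' := exists_normal n d in ex_intro _ m (conj h h')).
pose Ps := [seq (nor (v.2 - v.1), dot (v.1 - a) (nor (v.2 - v.1))) | a <- w0, v <- cyc w1] ++
           [seq (nor (u.2 - u.1), dot (c - u.1) (nor (u.2 - u.1))) | c <- w1, u <- cyc w0].
have Ps0 pl : pl \in Ps -> pl.1 != 0.
  by rewrite mem_cat => /orP[] /allpairsP[[? ?] [_ _ ->]] /=; apply: (proj1 (norP _)).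
have r0 : 0 < Num.min r1 r2 by rewrite lt_min r10.
have [w wn wP] := avoid_planes 0 r0 Ps0.
have wn1 : near r1 0 w by apply: (@near_le w r1 (Num.min r1 r2) _ wn); rewrite ge_min lexx.
have wn2 : near r2 0 w by apply: (@near_le w r2 (Num.min r1 r2) _ wn); rewrite ge_min lexx orbT.
have genw0 a v y (k : R) : a \in w0 -> v \in cyc w1 -> segment v.1 v.2 y -> a + w - y <> k *: n.
  move=> aw vc [q _ ->] e; have [_ [m1 m2]] := norP (v.2 - v.1).
  have : dot w (nor (v.2 - v.1)) != dot (v.1 - a) (nor (v.2 - v.1)).
    apply: (wP (nor (v.2 - v.1), dot (v.1 - a) (nor (v.2 - v.1)))).
    by rewrite mem_cat; apply/orP; left; apply/allpairsP; exists (a, v).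
  case/eqP; move/(congr1 (fun z => dot z (nor (v.2 - v.1)))): e; rewrite /= dotZl m1 mulr0.
  move: m2; rewrite !dotBl !dotDl !dotZl => /eqP; rewrite subr_eq0 => /eqP ->; lra.
have genw1 u c x (k : R) : u \in cyc w0 -> c \in w1 -> segment u.1 u.2 x -> x + w - c <> k *: n.
  move=> uc cw [q _ ->] e; have [_ [m1 m2]] := norP (u.2 - u.1).
  have : dot w (nor (u.2 - u.1)) != dot (c - u.1) (nor (u.2 - u.1)).
    apply: (wP (nor (u.2 - u.1), dot (c - u.1) (nor (u.2 - u.1)))).
    by rewrite mem_cat; apply/orP; right; apply/allpairsP; exists (c, u).
  case/eqP; move/(congr1 (fun z => dot z (nor (u.2 - u.1)))): e; rewrite /= dotZl m1 mulr0.
  move: m2; rewrite !dotBl !dotDl !dotZl => /eqP; rewrite subr_eq0 => /eqP ->; lra.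
have stabw u v k : u \in cyc w0 -> v \in cyc w1 -> k \in [:: n; - n; 0] ->
  shifted_hit w k u v -> hit k (segment u.1 u.2) (segment v.1 v.2) by exact: h1.
have crossw a b c d x : (a, b) \in cyc (dlines D ord0) -> (c, d) \in cyc (dlines D ord_max) ->
    segment a b x -> segment c d x ->
    exists y z (k : R), [/\ segment a b y, segment c d z & y + w - z = k *: n].
  move=> ab cd xa xc; apply: (h2 ((a, b), (c, d)) _ w wn2 x xa xc).
  by apply/allpairsP; exists ((a, b), (c, d)).
set s' := map (+%R^~ w) w0; pose P' := closed_edges s'.
have p' : polygon P' s' := polygon_map w p0.
(* The direction 0 in [shifted_stable] expresses that small translates stay disjoint. Shrinking [w]
   keeps it small, so the whole motion is covered. *)
have disj_shift x (k : R) : 0 <= k <= 1 -> polyline_points (K ord0) x ->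
    ~ polyline_points (K ord_max) (x + k *: w).
  move=> k01 [e]; rewrite {1}K0 => /closed_edgesP[u uc ->]; rewrite edge_pointsE => xu.
  move=> [f]; rewrite {1}K1 => /closed_edgesP[v vc ->]; rewrite edge_pointsE => xv.
  have zin : 0 \in [:: n; - n; 0] by rewrite !inE eqxx !orbT.
  have [|x' [y' [t [x'u y'v _]]]] := h1 _ (near_scale k01 wn1) u v 0 uc vc zin.
    by exists x, (x + k *: w), 0; rewrite subrr scale0r.
  rewrite scaler0 => /eqP; rewrite subr_eq0 => /eqP xy; apply: (dj x').
    by rewrite K0; exists [fset u.1; u.2]%fset; [apply/closed_edgesP; exists u|rewrite edge_pointsE].
  by rewrite K1 xy; exists [fset v.1; v.2]%fset; [apply/closed_edgesP; exists v|rewrite edge_pointsE].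
have dj' : disjoint_lines P' (K ord_max).
  move=> x [e /closed_edgesP[u' uc ->]]; rewrite edge_pointsE.
  move: uc; rewrite /cyc cyc_map => /mapP[u uc ->] /= /segment_add xu.
  have := @disj_shift (x - w) 1; rewrite scale1r subrK; apply; first by rewrite ler01 lexx.
  by rewrite K0; exists [fset u.1; u.2]%fset; [apply/closed_edgesP; exists u|rewrite edge_pointsE].
have mem2 (s : seq (point3 R)) z : z \in cyc s -> z.1 \in s /\ z.2 \in s.
  by case: z => z1 z2 /mem_cyc.
have tr : transverse n P' (K ord_max).
  move=> e f x; rewrite {1}K1 => /closed_edgesP[u' u'c ->] /closed_edgesP[v vc ->].
  move: u'c; rewrite /cyc cyc_map => /mapP[u uc ->] /=; rewrite !edge_pointsE.
  have [u1 u2] := mem2 _ _ uc; have [v1 v2] := mem2 _ _ vc.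
  split; rewrite !inE => xe.
    move=> [_ [y [t [-> yv _ e1]]]].
    by case/orP: xe e1 => /eqP ->; [exact: (genw0 _ _ _ _ u1 vc yv)|exact: (genw0 _ _ _ _ u2 vc yv)].
  move=> [y [_ [t [/segment_add yu -> _ e1]]]].
  by case/orP: xe e1 => /eqP ->; rewrite -[y](subrK w); [exact: (genw1 _ _ _ _ uc v1 yu)|exact: (genw1 _ _ _ _ uc v2 yu)].
(* The translation is carried out in a direction generic for the link and its translate together;
   only afterwards is this direction exchanged for [n]. *)
have [m g] := gen_dir_exists (w0 ++ s' ++ w1).
have m0 : m != 0.
  have [x0 x0s] : exists x, x \in w0 by case: w0 sw0 {p0 sd0 uw0 K0 h1 Ps Ps0 wP genw0 genw1 stabw s' P' p' disj_shift dj' tr g} => [//|x s _]; exists x; rewrite inE eqxx.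
  by apply: (gen_dir_neq0 (x := x0)) g; rewrite mem_cat x0s.
have g1 : gen_dir m (w0 ++ w1) by apply: gen_dirS g => z; rewrite !mem_cat => /orP[] ->; rewrite ?orbT.
have g2 : gen_dir m (s' ++ w1) by apply: gen_dirS g => z; rewrite !mem_cat => /orP[] ->; rewrite ?orbT.
rewrite (lk_parityE m0 (gen_dir_transverse p0 p1 dj g1)) -(crossings_translate p0 p1 g disj_shift).
rewrite (crossings_indep p' p1 dj' m0 n0 (gen_dir_transverse p' p1 dj' g2) tr).
have [us' ss' _] := p'.
transitivity (\big[addb/false]_(u <- cyc w0) \big[addb/false]_(v <- cyc w1) `[< shifted_hit w n u v >]).
  rewrite /crossings /P' big_closed_edges // {1}/cyc cyc_map big_map.
  apply: eq_bigr => u _; rewrite K1 big_closed_edges //; apply: eq_bigr => v _ /=.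
  rewrite hitsE; apply: asbool_equiv_eq; split=> [[x [y [t [/segment_add xu yv t0 e]]]]|[x [y [t [xu yv t0 e]]]]].
    by exists (x - w), y, t; rewrite subrK.
  by exists (x + w), y, t; split=> //; apply/segment_add; rewrite addrK.
(* The projection of each edge of the link lies in exactly one edge of the diagram, so a sum over
   diagram edges may be inserted. *)
have part i s u (b : bool) : subdivision (dlines D i) (map pt s) -> u \in cyc s ->
    b = \big[addb/false]_(e <- closed_edges (dlines D i)) (`[< within e (pt u.1) (pt u.2) >] && b).
  move=> sd us; have [uL sL ncL] := diagram_lines hD i.
  have uc : (pt u.1, pt u.2) \in cyc (map pt s) by rewrite /cyc cyc_map; apply/mapP; exists u.
  case: b; last by rewrite big1 // => e _; rewrite andbF.
  have [une [e eL we]] := subdivision_within uL sL sd uc.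
  apply/esym; apply: (big_addb_single (x := e)) => //.
    by rewrite andbT; apply/asboolP.
  move=> e' e'L; rewrite andbT => /asboolP we'.
  apply: (closed_edge_two uL sL ncL e'L eL une); do [apply: we'|apply: we];
    by [exact: segment_l|exact: segment_r].
transitivity (\big[addb/false]_(u <- cyc w0) \big[addb/false]_(v <- cyc w1)
   \big[addb/false]_(e <- closed_edges (dlines D ord0))
   \big[addb/false]_(f <- closed_edges (dlines D ord_max))
     [&& `[< within e (pt u.1) (pt u.2) >], `[< within f (pt v.1) (pt v.2) >] & `[< shifted_hit w n u v >]]).
  apply: eq_big_seq => u uc; apply: eq_big_seq => v vc.
  rewrite [LHS](part ord0 w0 u _ sd0 uc); apply: eq_bigr => e _.
  rewrite {1}(part ord_max w1 v `[< shifted_hit w n u v >] sd1 vc).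
  by case: `[< within e _ _ >] => //=; rewrite big1.
under eq_bigr => u _ do rewrite exchange_big.
rewrite exchange_big /=; apply: eq_big_seq => e eL.
under eq_bigr => u _ do rewrite exchange_big.
rewrite exchange_big /=; apply: eq_big_seq => f fL.
exact: (shifted_count hD p0 p1 sd0 sd1 stabw crossw genw0 genw1 eL fL).
Qed.
End DiagramLk.

Section CrossingChange.
Variable R : realType.
Implicit Types (a b c d x y w : point3 R) (e f : edge R) (K : link R 2) (D : diagram R 2).

Lemma strand_exists K D i e x : diagram_of D K -> e \in closed_edges (dlines D i) ->
  edge_points e x -> exists2 y, strand (dplane D) K i e y & project (dplane D) y = x.
Proof.
move=> hD eL xe; have [uL sL _] := diagram_lines hD i.
have [w [pw sd]] := diagram_vertices hD i.
have [a [b [ab we xab]]] := subdivision_cover uL sL sd eL xe.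
move: ab; rewrite /cyc cyc_map => /mapP[u uc [aE bE]]; rewrite aE bE in we xab.
have [y yu yx] := project_segment_lift xab; exists y => //.
exact: (strand_segment pw uc we yu).
Qed.

Lemma crossing_sym D i j e f x : crossing D i j e f x -> crossing D j i f e x.
Proof. by move=> [h1 h2 h3 [h4 h5]]; split=> //; rewrite eq_sym. Qed.

(** Each strand has exactly one point over the crossing, and two points of different components over
    the same point of the plane have different heights because the components are disjoint. *)
Lemma crossing_over K D i j e f x : diagram_of D K -> i != j -> crossing D i j e f x ->
  goes_over D f e = ~~ goes_over D e f.
Proof.
move=> hD ij cr; have [_ _ hover] := hD.
have [eL fL _ [[xe _] [xf _]]] := cr.
have [y ys yx] := strand_exists hD eL xe; have [z zs zx] := strand_exists hD fL xf.
have E1 := hover _ _ _ _ _ cr; have E2 := hover _ _ _ _ _ (crossing_sym cr).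
set n := normal (dplane D) in E1 E2.
have val1 : goes_over D e f = (dot z n < dot y n).
  apply/idP/idP => [/E1[y' [z' [y's z's y'x z'x]]]|lt]; last by apply/E1; exists y, z.
  have -> : y = y' by apply: (strand_inj hD eL ys y's); rewrite yx y'x.
  by have -> : z = z' by apply: (strand_inj hD fL zs z's); rewrite zx z'x.
have val2 : goes_over D f e = (dot y n < dot z n).
  apply/idP/idP => [/E2[z' [y' [z's y's z'x y'x]]]|lt]; last by apply/E2; exists z, y.
  have -> : y = y' by apply: (strand_inj hD eL ys y's); rewrite yx y'x.
  by have -> : z = z' by apply: (strand_inj hD fL zs z's); rewrite zx z'x.
rewrite val1 val2 -leNgt lt_neqAle; case: eqP => //= yz.
have /project_eq[k kE] : project (dplane D) y = project (dplane D) z by rewrite yx zx.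
have : k * dot n n = 0 by rewrite -dotZl -kE dotBl yz subrr.
move/eqP; rewrite mulf_eq0 (negbTE (normal_dot _)) orbF => /eqP k0.
move: kE; rewrite k0 scale0r => /eqP; rewrite subr_eq0 => /eqP yz'.
have in_link l h u : strand (dplane D) K l h u -> polyline_points (K l) u.
  by move=> [g [gK _ gu]]; exists g.
case: (link_disjoint ij (in_link _ _ _ ys)); rewrite yz'; exact: in_link zs.
Qed.

Lemma closed_edges_disjoint K D e : diagram_of D K ->
  e \in closed_edges (dlines D ord0) -> e \in closed_edges (dlines D ord_max) -> False.
Proof.
move=> hD e0 e1; case/closed_edgesP: (e0) => -[a b] ab eE.
have xe : edge_points e a by rewrite eE edge_pointsE; exact: segment_l.
have [_ _ _ [[_ +] _]] := closed_edge_interior hD e0 e1 xe xe.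
by apply; rewrite /= eE !inE eqxx.
Qed.

Lemma lk_parity_crossing_change Kp Km Dp Dm i j e f x :
  diagram_of Dp Kp -> diagram_of Dm Km -> crossing Dp i j e f x ->
  crossing_change Dp Dm e f -> lk_parity Kp (+) lk_parity Km = (i != j).
Proof.
move=> hp hm cr [_ lines swap1 swap2 same].
rewrite (lk_diagram hp) (lk_diagram hm) -!lines -big_split /=.
(* The terms of the two counts are added: [g] marks the crossings between components whose
   over-under information differs in the two diagrams. *)
pose g e' f' := `[< exists y, crossing Dp ord0 ord_max e' f' y >] &&
  (goes_over Dp e' f' (+) goes_over Dm e' f').
transitivity (\big[addb/false]_(e' <- closed_edges (dlines Dp ord0))
    \big[addb/false]_(f' <- closed_edges (dlines Dp ord_max)) g e' f').
  apply: eq_bigr => e' _; rewrite -big_split /=; apply: eq_bigr => f' _.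
  rewrite /g andb_addr; congr (_ (+) (_ && _)).
  by apply: asbool_equiv_eq; split=> -[y]; rewrite /crossing ?lines => h; exists y; rewrite /crossing ?lines.
have [eL fL ef _] := cr.
have dis z : z \in closed_edges (dlines Dp ord0) -> z \in closed_edges (dlines Dp ord_max) -> False.
  by move=> h1 h2; exact: (closed_edges_disjoint hp h1 h2).
(* Only the changed crossing can be marked, with its edges in either order. For [i = j] it is not
   marked, since the two components have no edge in common. *)
have gE e' f' : e' \in closed_edges (dlines Dp ord0) -> f' \in closed_edges (dlines Dp ord_max) ->
    g e' f' -> i != j /\ ((e' = e /\ f' = f) \/ (e' = f /\ f' = e)).
  move=> e'L f'L /andP[/asboolP[y cr']]; have [h|ne] := eqVneq [fset e'; f']%fset [fset e; f]%fset; last first.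
    by rewrite (same _ _ _ _ _ cr' ne) addbb.
  have hh : (e' = e /\ f' = f) \/ (e' = f /\ f' = e).
    have : e' \in [fset e; f]%fset by rewrite -h !inE eqxx.
    have : f' \in [fset e; f]%fset by rewrite -h !inE eqxx orbT.
    rewrite !inE => /orP[/eqP f'E|/eqP f'E] /orP[/eqP e'E|/eqP e'E]; auto.
      by case: (dis e); [rewrite -e'E|rewrite -f'E].
    by case: (dis f); [rewrite -e'E|rewrite -f'E].
  move=> _; split=> //; apply/eqP => ij; subst j.
  move: eL fL; case: (i =P ord0) => [->|/eqP/ord2_max->] eL fL.
    by case: hh => -[? ?]; subst; [apply: (dis f)|apply: (dis e)].
  by case: hh => -[? ?]; subst; [apply: (dis e)|apply: (dis f)].
have [ij|ij] := eqVneq i j; last first.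
  have ov := crossing_over hp ij cr.
  have one e' f' : crossing Dp ord0 ord_max e' f' x -> goes_over Dp e' f' (+) goes_over Dm e' f' ->
     (e' = e /\ f' = f) \/ (e' = f /\ f' = e) ->
     \big[addb/false]_(e0 <- closed_edges (dlines Dp ord0))
        \big[addb/false]_(f0 <- closed_edges (dlines Dp ord_max)) g e0 f0 = true.
    move=> cr' dif hh; have [e'L f'L _ _] := cr'.
    have un e0 f0 : e0 \in closed_edges (dlines Dp ord0) -> f0 \in closed_edges (dlines Dp ord_max) ->
        g e0 f0 -> e0 = e' /\ f0 = f'.
      move=> e0L f0L /(gE _ _ e0L f0L)[_ hh0].
      case: hh => -[e'E f'E]; case: hh0 => -[e0E f0E].
      - by rewrite e0E f0E e'E f'E.
      - by case: (dis e); [rewrite -e'E|rewrite -f0E].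
      - by case: (dis f); [rewrite -e'E|rewrite -f0E].
      - by rewrite e0E f0E e'E f'E.
    apply: (big_addb_single (x := e')) => //.
    - exact: fset_uniq.
    - apply: (big_addb_single (x := f')) => //.
      + exact: fset_uniq.
      + by apply/andP; split=> //; apply/asboolP; exists x.
      + by move=> f0 f0L /(un _ _ e'L f0L) [].
    move=> e0 e0L; apply: contraTeq => ne.
    rewrite big1_seq // => f0 /= f0L; apply/negP => /(un _ _ e0L f0L) [h _].
    by rewrite h eqxx in ne.
  have [i0|/eqP/ord2_max i1] := i =P ord0.
    have j1 : j = ord_max by apply: ord2_max; rewrite -i0 eq_sym.
    by apply: (one e f); [rewrite -i0 -j1|rewrite swap1 ov; case: goes_over|left].
  have j0 : j = ord0 by apply/eqP; apply: contraNT ij => /ord2_max ->; rewrite i1.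
  apply: (one f e); [rewrite -i1 -j0; exact: crossing_sym|rewrite swap2 ov; case: goes_over|right] => //.
rewrite big1_seq // => e' /= e'L; rewrite big1_seq // => f' /= f'L.
by apply/negP => /(gE _ _ e'L f'L)[]; rewrite ij eqxx.
Qed.

Lemma lk2_crossing_change Kp Km Dp Dm i j e f x :
  diagram_of Dp Kp -> diagram_of Dm Km -> crossing Dp i j e f x ->
  crossing_change Dp Dm e f -> lk2 Kp - lk2 Km = if i != j then 1 else 0.
Proof.
move=> hp hm cr ch; rewrite -(lk_parity_crossing_change hp hm cr ch) /lk2.
by case: (lk_parity Kp); case: (lk_parity Km); apply: val_inj.
Qed.
End CrossingChange.

(** * Perturbation into general position *)

Section VertexMove.
Variable R : realType.
Implicit Types (A B C a b c p q x y z : point3 R) (e f : edge R) (K : link R 2).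
Implicit Types (s : seq (point3 R)) (E P : {fset edge R}).

Definition embedded P := forall e f x, e \in P -> f \in P -> e != f ->
  edge_points e x -> edge_points f x -> x \in (e `&` f)%fset.

Lemma is_knot_polygon P s : polygon P s -> embedded P -> is_knot P.
Proof. by move=> [us ss PE] emb; exists s. Qed.

Lemma link_embedded k (K : link R k) i : embedded (K i).
Proof. by have [s [_ _ _ emb]] := component_knot K i. Qed.

Lemma link_ext K K' : (forall i, K i = K' i) -> K = K'.
Proof.
case: K K' => [k kk kd] [k' kk' kd'] /= h.
have E : k = k' by apply/funext.
by subst k'; congr Link; exact: Prop_irrelevance.
Qed.

Lemma replace_component K i E : is_knot E ->
  (forall j, j != i -> disjoint_lines E (K j)) ->
  exists K', K' i = E /\ forall j, j != i -> K' j = K j.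
Proof.
move=> kE dE; pose c j := if j == i then E else K j.
have ck j : is_knot (c j) by rewrite /c; case: eqP => // _; exact: component_knot.
have cd j l : j != l -> polyline_points (c j) `&` polyline_points (c l) = set0.
  move=> jl; apply/seteqP; split=> // x []; rewrite /c.
  case: (j =P i) => [ji|/eqP ji]; case: (l =P i) => [li|/eqP li] xj xl.
  - by rewrite ji li eqxx in jl.
  - exact: (dE l li x xj xl).
  - exact: (dE j ji x xl xj).
  - exact: (link_disjoint jl xj xl).
exists (Link ck cd); split=> [|j ji]; rewrite /= /c ?eqxx //.
by rewrite (negbTE ji).
Qed.

Lemma embedded_extend E (Old : edge R -> Prop) n1 n2 :
  (forall e, e \in E -> [\/ e = n1, e = n2 | Old e]) ->
  (forall x, edge_points n1 x -> edge_points n2 x -> x \in (n1 `&` n2)%fset) ->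
  (forall f x, Old f -> edge_points n1 x -> edge_points f x -> x \in (n1 `&` f)%fset) ->
  (forall f x, Old f -> edge_points n2 x -> edge_points f x -> x \in (n2 `&` f)%fset) ->
  (forall e f x, Old e -> Old f -> e != f -> edge_points e x -> edge_points f x ->
     x \in (e `&` f)%fset) ->
  embedded E.
Proof.
move=> cl h12 h1 h2 hO e f x /cl[->|->|eO] /cl[->|->|fO]; rewrite ?eqxx //.
- by move=> _; exact: h12.
- by move=> _; exact: h1.
- by move=> _ ? ?; rewrite fsetIC; exact: h12.
- by move=> _; exact: h2.
- by move=> _ ? ?; rewrite fsetIC; exact: h1.
- by move=> _ ? ?; rewrite fsetIC; exact: h2.
- exact: hO.
Qed.

Definition offline p q z := forall k : R, z != p + k *: (q - p).

Lemma offlineC p q z : offline p q z -> offline q p z.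
Proof.
move=> h k; apply: contraNneq (h (1 - k)) => ->; apply/eqP.
by apply/rowP => i; rewrite !mxE; ring.
Qed.

Lemma offline_l p q z x : offline p q z -> segment p z x -> segment p q x -> x = p.
Proof.
move=> off [k _ xE] [l _ xE']; have [k0|kn] := eqVneq k 0.
  by rewrite xE k0 subr0 scale1r scale0r addr0.
case/eqP: (off (l / k)); apply/rowP => i; rewrite xE in xE'.
move/rowP: xE' => /(_ i); rewrite !mxE => h; apply: (mulfI kn).
rewrite mulrDr mulrA mulrCA divff // mulr1; lra.
Qed.

Lemma offline_r p q z x : offline p q z -> segment z q x -> segment p q x -> x = q.
Proof. by move=> /offlineC off; rewrite segmentC (segmentC p); exact: offline_l. Qed.

Lemma offline_apex p q z x : p != q -> offline p q z -> segment p z x -> segment z q x -> x = z.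
Proof.
move=> pq off [k _ xE] [l _ xE']; have E : (1 - k) *: p + k *: z = (1 - l) *: z + l *: q by rewrite -xE -xE'.
have [kl|kl] := eqVneq (k + l - 1) 0.
  have : l *: (q - p) = 0.
    apply/rowP => i; move/rowP: E => /(_ i); rewrite !mxE (_ : k = 1 - l); [lra|].
    by move: kl; lra.
  move/eqP; rewrite scaler_eq0 subr_eq0 (eq_sym q) (negbTE pq) orbF => /eqP l0.
  by rewrite xE' l0 subr0 scale1r scale0r addr0.
case/eqP: (off (l / (k + l - 1))); apply/rowP => i.
move/rowP: E => /(_ i); rewrite !mxE => h; apply: (mulfI kl).
rewrite mulrDr mulrA mulrCA divff // mulr1; lra.
Qed.

(** The edges of the closed polygon [C, B, s] that are not incident to [C]; they are untouched when
    [C] moves. *)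
Definition path_edges B s := [seq [fset ab.1; ab.2]%fset : edge R | ab <- zip (belast B s) s].

Lemma closed_edges_path C B s e : e \in closed_edges [:: C, B & s] =
  [|| e == [fset C; B]%fset, e \in path_edges B s | e == [fset last B s; C]%fset].
Proof.
have cycE : cyc [:: C, B & s] = (C, B) :: rcons (zip (belast B s) s) (last B s, C).
  rewrite cyc_cons2 (lastI B s); congr (_ :: _).
  have : size (belast B s) = size s by rewrite size_belast.
  move: (belast B s) (last B s) => u z; clear; by elim: u s => [|x u IH] [|y v] //= [] /IH ->.
apply/closed_edgesP/or3P; rewrite cycE.
  move=> [ab]; rewrite inE mem_rcons inE => /or3P[/eqP-> ->|/eqP-> ->|h ->].
  - by constructor 1.
  - by constructor 3.
  - by constructor 2; apply/mapP; exists ab.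
case=> [/eqP->|/mapP[ab h ->]|/eqP->].
- by exists (C, B); rewrite ?inE ?eqxx.
- by exists ab; rewrite // inE mem_rcons inE h !orbT.
- by exists (last B s, C); rewrite // inE mem_rcons inE eqxx orbT.
Qed.

Lemma path_edges_mem B s e x : e \in path_edges B s -> x \in e -> x \in B :: s.
Proof.
move=> /mapP[[a b] ab ->].
have {ab} [aB bB] : a \in belast B s /\ b \in s.
  move: (belast B s) ab => t; elim: t s => [|u v IH] [|y t] //=.
  by rewrite !inE => /orP[/eqP[-> ->]|/IH[h1 h2]]; rewrite ?eqxx // h1 h2 !orbT.
rewrite !inE => /orP[] /eqP->; last by rewrite bB orbT.
by have := mem_belast aB; rewrite inE.
Qed.

Lemma polygon_vertex P s x : polygon P s -> x \in s -> polyline_points P x.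
Proof.
move=> [us ss ->] /mem_cyc_out[b xb]; exists [fset x; b]%fset; first exact: mem_closed_edges.
by rewrite edge_pointsE; exact: segment_l.
Qed.

(** Two elementary moves through the polygon [C', C, B, s], in which both positions of the vertex
    occur. Removing [C'] from it gives back [K], and removing [C] gives the link sought. *)
Lemma vertex_move K i C B s C' : polygon (K i) [:: C, B & s] ->
  (forall x, triangle (last B s) C C' x -> link_points K x -> segment (last B s) C x) ->
  (forall x, triangle C' B C x -> link_points K x -> segment C B x) ->
  (forall x, triangle (last B s) C C' x -> triangle C' B C x -> segment C' C x) ->
  offline (last B s) C C' -> offline C B C' ->
  exists K', [/\ isotopic K K', polygon (K' i) [:: C', B & s]
               & forall j, j != i -> K' j = K j].
Proof.
set A := last B s => Pi TA TB TAB offA offB.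
have [us ss KiE] := Pi.
have sn : s != [::] by move: ss; case: (s).
have AB : A \in B :: s by rewrite /A mem_last.
have As : A \in s.
  by move: sn; rewrite /A; case: (s) => //= y t _; exact: mem_last.
have nC : C \notin B :: s by have := us; rewrite cons_uniq => /andP[].
have uBs : uniq (B :: s) by have := us; rewrite cons_uniq => /andP[].
have nB : B \notin s by have := uBs; rewrite cons_uniq => /andP[].
have nAB : A != B by apply: contraNneq nB => <-.
have nAC : A != C by apply: contraNneq nC => <-.
have nCB : C != B by apply: contraNneq nC => ->; rewrite inE eqxx.
have Ki e : e \in K i = [|| e == [fset C; B]%fset, e \in path_edges B s | e == [fset A; C]%fset].
  by rewrite KiE closed_edges_path.
have eAC : [fset A; C]%fset \in K i by rewrite Ki eqxx !orbT.
have eCB : [fset C; B]%fset \in K i by rewrite Ki eqxx.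
have nACB : [fset A; C]%fset != [fset C; B]%fset :> edge R.
  by apply/eqP => /fset2_inj[[h _]|[h _]]; [rewrite h eqxx in nAC|rewrite h eqxx in nAB].
have onK e x : e \in K i -> edge_points e x -> link_points K x.
  by move=> eK xe; exists i; exists e.
have emb := @link_embedded _ K i.
have vK x : x \in [:: C, B & s] -> link_points K x by move=> xs; exists i; exact: polygon_vertex Pi xs.
have T1a x : segment A C' x -> triangle A C C' x by move=> h; apply: triangle_seg; auto.
have T1c x : segment C' C x -> triangle A C C' x by rewrite segmentC => h; apply: triangle_seg; auto.
have T2c x : segment C' C x -> triangle C' B C x by move=> h; apply: triangle_seg; auto.
have T2b x : segment C' B x -> triangle C' B C x by move=> h; apply: triangle_seg; auto.
have C'K : ~ link_points K C'.
  move=> /(TA _ (T1a _ (segment_r _ _))) h.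
  by have := offline_l offA (segment_r _ _) h => e; have := offA 0; rewrite scale0r addr0 e eqxx.
have C's : C' \notin [:: C, B & s] by apply/negP => /vK.
have F1 f x : f \in K i -> f != [fset A; C]%fset -> triangle A C C' x -> edge_points f x ->
    [/\ segment A C x, x \in f & x \in [fset A; C]%fset].
  move=> fK fn xT xf; have xs := TA x xT (onK _ _ fK xf).
  have := emb f _ x fK eAC fn xf; rewrite edge_pointsE => /(_ xs).
  by rewrite in_fsetI => /andP[].
have F2 f x : f \in K i -> f != [fset C; B]%fset -> triangle C' B C x -> edge_points f x ->
    [/\ segment C B x, x \in f & x \in [fset C; B]%fset].
  move=> fK fn xT xf; have xs := TB x xT (onK _ _ fK xf).
  have := emb f _ x fK eCB fn xf; rewrite edge_pointsE => /(_ xs).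
  by rewrite in_fsetI => /andP[].
have offC' : offline C A C' := offlineC offA.
have offB' : offline B C C' := offlineC offB.
have pathK f : f \in path_edges B s -> [/\ f \in K i, f != [fset A; C]%fset & f != [fset C; B]%fset].
  move=> fp; have nf : C \notin f by apply: contra nC => /(path_edges_mem fp).
  split; first by rewrite Ki fp orbT.
    by apply: contraNneq nf => ->; rewrite !inE eqxx orbT.
  by apply: contraNneq nf => ->; rewrite !inE eqxx.
pose w2 := [:: C', C, B & s]; pose w1 := [:: C', B & s].
have p2 : polygon (closed_edges w2) w2 by split=> //; rewrite /w2 cons_uniq C's.
have p1 : polygon (closed_edges w1) w1.
  split=> //; rewrite /w1 cons_uniq uBs andbT; apply: contra C's => h.
  by rewrite inE h orbT.
have w2E e : e \in closed_edges w2 = [|| e == [fset C'; C]%fset, e == [fset C; B]%fset,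
     e \in path_edges B s | e == [fset A; C']%fset].
  by rewrite closed_edges_path /= /path_edges /= inE -!orbA.
have w1E e : e \in closed_edges w1 = [|| e == [fset C'; B]%fset, e \in path_edges B s
     | e == [fset A; C']%fset] by rewrite closed_edges_path.
have emb2 : embedded (closed_edges w2).
  apply: (embedded_extend (Old := fun e => e \in K i /\ e != [fset A; C]%fset)
    (n1 := [fset C'; C]%fset) (n2 := [fset A; C']%fset)).
  - move=> e; rewrite w2E => /or4P[/eqP->|/eqP->|/pathK[h1 h2 _]|/eqP->];
      [by constructor 1|by constructor 3; split=> //; rewrite eq_sym|by constructor 3|by constructor 2].
  - move=> x; rewrite !edge_pointsE => h1 h2.
    by rewrite (offline_apex nAC offA h2 h1) in_fsetI !inE !eqxx orbT.
  - move=> f x [fK fn]; rewrite !edge_pointsE => xn xf; have [xs xf' _] := F1 f x fK fn (T1c x xn) xf.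
    by rewrite in_fsetI xf' (offline_r offA xn xs) !inE eqxx orbT.
  - move=> f x [fK fn]; rewrite !edge_pointsE => xn xf; have [xs xf' _] := F1 f x fK fn (T1a x xn) xf.
    by rewrite in_fsetI xf' (offline_l offA xn xs) !inE eqxx.
  - by move=> e f x [eK _] [fK _]; exact: emb.
have emb1 : embedded (closed_edges w1).
  apply: (embedded_extend (Old := fun e => e \in path_edges B s)
    (n1 := [fset C'; B]%fset) (n2 := [fset A; C']%fset)).
  - move=> e; rewrite w1E => /or3P[/eqP->|h|/eqP->]; by [constructor 1|constructor 3|constructor 2].
  - move=> x; rewrite !edge_pointsE => h1 h2.
    have xs := TAB x (T1a x h2) (T2b x h1); rewrite segmentC in xs.
    have -> : x = C'.
      exact: (offline_apex nCB offB xs h1).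
    by rewrite in_fsetI !inE !eqxx orbT.
  - move=> f x /pathK[fK fn fn']; rewrite !edge_pointsE => xn xf.
    have [xs xf' _] := F2 f x fK fn' (T2b x xn) xf.
    by rewrite in_fsetI xf' (offline_r offB xn xs) !inE eqxx orbT.
  - move=> f x /pathK[fK fn fn']; rewrite !edge_pointsE => xn xf.
    have [xs xf' _] := F1 f x fK fn (T1a x xn) xf.
    by rewrite in_fsetI xf' (offline_l offA xn xs) !inE eqxx.
  - by move=> e f x /pathK[eK _ _] /pathK[fK _ _]; exact: emb.
have AC_pts x : segment A C x -> polyline_points (K i) x by exists [fset A; C]%fset; rewrite ?edge_pointsE.
have CB_pts x : segment C B x -> polyline_points (K i) x by exists [fset C; B]%fset; rewrite ?edge_pointsE.
have offK x j : j != i -> triangle A C C' x \/ triangle C' B C x -> ~ polyline_points (K j) x.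
  move=> ji xT xj; apply: (@link_disjoint _ _ K j i ji x xj); have xK : link_points K x by exists j.
  by case: xT => [/TA/(_ xK)|/TB/(_ xK)]; auto.
have dis2 j : j != i -> disjoint_lines (closed_edges w2) (K j).
  move=> ji x [e]; rewrite w2E => /or4P[/eqP->|/eqP->|/pathK[eK _ _]|/eqP->].
  - by rewrite edge_pointsE => h; apply: offK => //; auto.
  - by rewrite edge_pointsE => h xj; apply: (link_disjoint ji xj); auto.
  - by move=> h xj; apply: (link_disjoint ji xj); exists e.
  - by rewrite edge_pointsE => h; apply: offK => //; auto.
have dis1 j : j != i -> disjoint_lines (closed_edges w1) (K j).
  move=> ji x [e]; rewrite w1E => /or3P[/eqP->|/pathK[eK _ _]|/eqP->].
  - by rewrite edge_pointsE => h; apply: offK => //; auto.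
  - by move=> h xj; apply: (link_disjoint ji xj); exists e.
  - by rewrite edge_pointsE => h; apply: offK => //; auto.
have [K2 [K2i K2j]] := replace_component (is_knot_polygon p2 emb2) dis2.
have [K1 [K1i K1j]] := replace_component (is_knot_polygon p1 emb1) dis1.
have nC' e : e \in K i -> C' \notin e.
  move=> eK; apply: contra C's => C'e; rewrite KiE in eK; exact: edge_mem_vertex eK C'e.
have neq e p : e \in K i -> (e == [fset C'; p]%fset) = false /\ (e == [fset p; C']%fset) = false.
  by move=> /nC' h; split; apply: contraNF h => /eqP ->; rewrite !inE eqxx ?orbT.
exists K1; split; [|by rewrite K1i|by []].
have K2pts x : link_points K2 x -> polyline_points (closed_edges w2) x \/
    exists2 j, j != i & polyline_points (K j) x.
  move=> [j]; have [->|ji] := eqVneq j i; first by rewrite K2i; left.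
  by rewrite K2j //; right; exists j.
have nCBAC : [fset C; B]%fset != [fset A; C]%fset :> edge R by rewrite eq_sym.
have endsAC x : x \in [fset A; C]%fset -> (segment A C' `|` segment C' C) x.
  by rewrite !inE => /orP[] /eqP ->; [left; exact: segment_l|right; exact: segment_r].
have mv1 : elementary_move K2 K.
  exists i, A, C, C'; split.
  - by rewrite K2i w2E eqxx !orbT.
  - by rewrite K2i w2E eqxx.
  - move=> x [/K2pts[[e eL xe]|[j ji xj]] xT].
      move: eL xe; rewrite w2E => /or4P[/eqP->|/eqP->|/pathK[eK en _]|/eqP->].
      + by rewrite edge_pointsE; right.
      + move=> xe; have [_ _] := F1 _ x eCB nCBAC xT xe; exact: endsAC.
      + move=> xe; have [_ _] := F1 e x eK en xT xe; exact: endsAC.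
      + by rewrite edge_pointsE; left.
    case: (offK x j ji (or_introl xT) xj).
  - apply/fsetP => e; rewrite in_fset1U in_fsetD in_fset2 K2i w2E.
    have [eK|eK] := boolP (e \in K i).
      have [-> _] := neq e C eK; have [_ ->] := neq e A eK.
      by move: eK; rewrite Ki orbF /=; do 2 case: (_ == _); case: (_ \in _).
    move: eK; rewrite Ki !negb_or => /and3P[/negbTE-> /negbTE-> /negbTE->].
    by do 2 case: (_ == _).
  - by move=> j ji; rewrite K2j.
have mv2 : elementary_move K2 K1.
  exists i, C', B, C; split.
  - by rewrite K2i w2E eqxx.
  - by rewrite K2i w2E eqxx orbT.
  - move=> x [/K2pts[[e eL xe]|[j ji xj]] xT].
      move: eL xe; rewrite w2E => /or4P[/eqP->|/eqP->|/pathK[eK _ en]|/eqP->].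
      + by rewrite edge_pointsE; left.
      + by rewrite edge_pointsE; right.
      + move=> xe; have [xs _ _] := F2 e x eK en xT xe; by right.
      + by rewrite edge_pointsE => xs; left; apply: TAB => //; exact: T1a.
    case: (offK x j ji (or_intror xT) xj).
  - apply/fsetP => e; rewrite in_fset1U in_fsetD in_fset2 K2i K1i w2E w1E.
    have [/eqP eE|eAC'] := boolP (e == [fset A; C']%fset).
      have -> : (e == [fset C'; C]%fset) = false.
        apply/eqP; rewrite eE => /fset2_inj[[_ h]|[h _]]; last by rewrite h eqxx in nAC.
        by move: C's; rewrite h mem_head.
      have -> : (e == [fset C; B]%fset) = false.
        by apply/eqP => eE'; have [_] := neq _ A eCB; rewrite -eE' eE eqxx.
      by rewrite !orbT.
    have [ep|_] := boolP (e \in path_edges B s).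
      have [eK _ /negbTE ->] := pathK e ep; have [-> _] := neq e C eK.
      by rewrite !orbT.
    by rewrite !orbF; do 3 case: (_ == _).
  - by move=> j ji; rewrite K2j ?K1j.
apply: rst_trans (rst_step _ _ _ _ mv2); apply: rst_sym; exact: rst_step.
Qed.
End VertexMove.

Section Perturb.
Variable R : realType.
Implicit Types (A B C a b c d p q u v x y z : point3 R) (e f : edge R) (K : link R 2).
Implicit Types (s V : seq (point3 R)) (E P : {fset edge R}) (Ps : seq (point3 R * R)).

Definition planes Ps := forall pl, pl \in Ps -> pl.1 != 0.
Definition off_planes Ps x := forall pl, pl \in Ps -> dot x pl.1 != pl.2.

Lemma near_planes_all (Z : eqType) (zs : seq Z) (G : Z -> point3 R -> Prop) c :
  (forall z : Z, z \in zs -> exists2 e : R, 0 < e & exists2 pl : point3 R * R, pl.1 != 0 &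
     forall x, near e c x -> dot x pl.1 != pl.2 -> G z x) ->
  exists2 e : R, 0 < e & exists2 Ps, planes Ps &
     forall x, near e c x -> off_planes Ps x -> forall z : Z, z \in zs -> G z x.
Proof.
elim: zs => [|z zs IH] h; first by exists 1 => //; exists [::].
have [|e e0 [Ps Ps0 hPs]] := IH; first by move=> k kz; apply: h; rewrite inE kz orbT.
have [e' e'0 [pl pl0 hpl]] := h z (mem_head _ _).
exists (Num.min e e'); first by rewrite lt_min e0.
exists (pl :: Ps) => [pl'|x xn xo k]; first by rewrite inE => /orP[/eqP->|/Ps0].
have [x1 x2] : near e c x /\ near e' c x.
  by split=> i; have := xn i; rewrite lt_min => /andP[].
rewrite inE => /orP[/eqP->|kz]; first by apply: hpl => //; apply: xo; rewrite mem_head.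
by apply: hPs => // pl' h'; apply: xo; rewrite inE h' orbT.
Qed.

(** Treated for each edge of the link separately. An edge disjoint from [AC] stays away from the
    thin triangle by stability. An edge that meets [AC] shares an endpoint with it, and then it
    suffices that [C'] is off a plane containing both edges. *)
Lemma apex_near K i A C : [fset A; C]%fset \in K i ->
  exists2 e : R, 0 < e & exists2 Ps, planes Ps &
    forall C', near e C C' -> off_planes Ps C' ->
    forall x, triangle A C C' x -> link_points K x -> segment A C x.
Proof.
move=> eAC.
have [|e e0 [Ps Ps0 h]] := @near_planes_all _
  (enum_fset (K ord0) ++ enum_fset (K ord_max))
  (fun f C' => forall x, triangle A C C' x -> edge_points f x -> segment A C x) C; last first.
  exists e => //; exists Ps => // C' C'n C'o x xT [j [f fK xf]].
  apply: (h C' C'n C'o f) xf => //; rewrite mem_cat.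
  by move: fK; case: (j =P ord0) => [->|/eqP/ord2_max->] fK; apply/orP; [left|right].
move=> f fK.
have {fK} [j fK] : exists j, f \in K j.
  by move: fK; rewrite mem_cat => /orP[] h; [exists ord0|exists ord_max].
have e1n0 : vec 1 0 0 != 0 :> point3 R.
  by apply/eqP => /rowP/(_ 0)/eqP; rewrite !mxE oner_eq0.
have [->|fAC] := eqVneq f [fset A; C]%fset.
  (* Nothing has to be avoided for [AC] itself; radius and plane are placeholders. *)
  by exists 1 => //; exists (vec 1 0 0, 0) => // x _ _ y _; rewrite edge_pointsE.
have [s [us ss KjE]] := link_polygon K j.
have [[p q] pq fE] : exists2 pq, pq \in cyc s & f = [fset pq.1; pq.2]%fset.
  by apply/closed_edgesP; rewrite -KjE.
rewrite /= in fE; subst f.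
have [[x [xAC xpq]]|no] := pselect (exists x, segment A C x /\ segment p q x); last first.
  (* A point of the triangle is a point of [AC] translated by a multiple [t *: (C' - C)] with [t] at
     most 1, so [stab] with direction 0 applies. *)
  have nh : ~ hit 0 (segment A C) (segment p q).
    move=> [x [y [t [xAC ypq _]]]]; rewrite scaler0 => /eqP; rewrite subr_eq0 => /eqP xy.
    by apply: no; exists x; split=> //; rewrite xy.
  have [e e0 h] := stab nh; exists e => //; exists (vec 1 0 0, 0) => // C' C'n _.
  move=> x [r [r' [t [r0 r'0 t0 rrt xE]]]]; rewrite edge_pointsE => xpq.
  have t1 : t <= 1 by lra.
  have tn : near e 0 (t *: (C' - C)).
    move=> k; rewrite subr0 mxE normrM ger0_norm //.
    by apply: le_lt_trans (C'n k); rewrite ler_piMl.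
  case: (h (t *: (C' - C)) (r *: A + (r' + t) *: C) x 0 tn) => //.
    by apply/segmentP; exists r, (r' + t); split=> //; lra.
  by rewrite scaler0 xE; apply/rowP => k; rewrite !mxE; ring.
have [z [zAC zpq]] : exists z, z \in [fset A; C]%fset /\ z \in [fset p; q]%fset.
  have ij : j = i.
    apply/eqP/negPn/negP => ji; apply: (link_disjoint (K := K) ji (x := x)).
      by exists [fset p; q]%fset; rewrite ?edge_pointsE.
    by exists [fset A; C]%fset; rewrite ?edge_pointsE.
  exists x; rewrite ij in fK; have := link_embedded eAC fK.
  rewrite eq_sym fAC !edge_pointsE => /(_ x isT xAC xpq).
  by rewrite in_fsetI => /andP[].
(* A plane through [A], [C], [p] and [q], which exists because [z] is a common endpoint; [o] is the
   other end of [pq]. A point of [pq] in the triangle must have coefficient 0 at [C']. *)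
have [m m0 [mA mq]] : exists2 m : point3 R, m != 0 & dot A m = dot C m /\ dot p m = dot C m /\ dot q m = dot C m.
  pose o := if z == p then q else p.
  have [m m0 [h1 h2]] := exists_normal (A - C) (o - C).
  rewrite dotBl in h1; rewrite dotBl in h2.
  have hA : dot A m = dot C m by lra.
  have ho : dot o m = dot C m by lra.
  have hz : dot z m = dot C m by move: zAC; rewrite !inE => /orP[] /eqP ->.
  exists m => //; split=> //; move: zpq ho; rewrite /o !inE.
  by case: (eqVneq z p) hz => [->|_] hz //= /eqP h; rewrite -h.
exists 1 => //; exists (m, dot C m) => // C' _ C'm x' [r [r' [t [r0 r'0 t0 rrt xE]]]].
rewrite edge_pointsE => /segmentP[k [k' [_ _ kk xE']]].
have : t * (dot C' m - dot C m) = 0.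
  have := congr1 (fun y => dot y m) xE; rewrite xE' !dotDl !dotZl mA mq.1 mq.2.
  by rewrite -mulrDl kk (_ : r = 1 - r' - t); lra.
move/eqP; rewrite mulf_eq0 subr_eq0 (negbTE C'm) orbF => /eqP t0'.
apply/segmentP; exists r, r'; split=> //; first by lra.
by rewrite xE t0' scale0r addr0.
Qed.

Lemma triangle_rot a b c x : triangle a b c x -> triangle b c a x.
Proof.
move=> [r [s [t [? ? ? rst ->]]]]; exists s, t, r; split=> //; first by lra.
by rewrite -addrA [LHS]addrC.
Qed.

(** [C'] is chosen near [C] and off the prescribed planes, off those needed for the triangles on
    both sides of [C], and off a plane through [A], [B], [C], so that the two triangles meet only
    along [C'C]. *)
Lemma perturb_vertex K i C B s Ps : planes Ps -> polygon (K i) [:: C, B & s] ->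
  exists C' K', [/\ off_planes Ps C', isotopic K K', polygon (K' i) [:: C', B & s]
               & forall j, j != i -> K' j = K j].
Proof.
move=> Ps0 Pi; have [us ss KiE] := Pi; pose A := last B s.
have eAC : [fset A; C]%fset \in K i by rewrite KiE closed_edges_path eqxx !orbT.
have eCB : [fset C; B]%fset \in K i by rewrite KiE closed_edges_path eqxx.
have eBC : [fset B; C]%fset \in K i by rewrite fset2C.
have nACB : [fset A; C]%fset != [fset C; B]%fset :> edge R.
  have nC : C \notin B :: s by have := us; rewrite cons_uniq => /andP[].
  have nB : B \notin s by have := us; rewrite !cons_uniq => /and3P[].
  have sn : s != [::] by move: ss; case: (s).
  have As : A \in s.
    by move: sn; rewrite /A; case: (s) => //= y t _; exact: mem_last.
  apply/eqP => /fset2_inj[[h _]|[h _]]; last by rewrite -h As in nB.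
  by rewrite -h inE As orbT in nC.
have [e1 e10 [P1 P10 h1]] := apex_near eAC; have [e2 e20 [P2 P20 h2]] := apex_near eBC.
have [m m0 [mA mB]] := exists_normal (A - C) (B - C).
rewrite dotBl in mA; rewrite dotBl in mB.
have {mA} mA : dot A m = dot C m by lra.
have {mB} mB : dot B m = dot C m by lra.
have e0 : 0 < Num.min e1 e2 by rewrite lt_min e10.
have [|C' C'n C'o] := @avoid_planes R ((m, dot C m) :: Ps ++ P1 ++ P2) C _ e0.
  move=> pl; rewrite inE !mem_cat => /or4P[/eqP->//|/Ps0|/P10|/P20] //.
have C'm : dot C' m != dot C m by apply: (C'o (m, dot C m)); rewrite mem_head.
have oPs : off_planes Ps C' by move=> pl h; apply: C'o; rewrite inE !mem_cat h !orbT.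
have oP1 : off_planes P1 C' by move=> pl h; apply: C'o; rewrite inE !mem_cat h !orbT.
have oP2 : off_planes P2 C' by move=> pl h; apply: C'o; rewrite inE !mem_cat h !orbT.
have [n1 n2] : near e1 C C' /\ near e2 C C'.
  by split=> k; have := C'n k; rewrite lt_min => /andP[].
have [||||| K' [iso pK' oth]] := @vertex_move R K i C B s C' Pi.
- exact: h1.
- move=> x /triangle_rot xT xK; rewrite segmentC; exact: h2 xK.
- move=> x [r [r' [t [r0 r'0 t0 rrt xE]]]] /triangle_rot[k [k' [l [k0 k'0 l0 kkl xE']]]].
  rewrite -/A in xE.
  have tl : t = l.
    have := congr1 (fun y => dot y m) xE; rewrite xE' !dotDl !dotZl mA mB.
    have -> : k = 1 - k' - l by lra.
    have -> : r = 1 - r' - t by lra.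
    move=> h; have : (t - l) * (dot C' m - dot C m) = 0 by lra.
    by move/eqP; rewrite mulf_eq0 !subr_eq0 (negbTE C'm) orbF => /eqP.
  subst l; apply/segmentP; exists t, (1 - t); split=> //; [by lra|by lra|].
  have [t1|tn1] := eqVneq t 1.
    have r00 : r = 0 by lra.
    have r'00 : r' = 0 by lra.
    by rewrite xE t1 r00 r'00 subrr !scale0r !addr0 !add0r.
  have ut : 1 - t != 0 by rewrite subr_eq0 eq_sym.
  have ut0 : 0 < 1 - t by rewrite lt_neqAle eq_sym ut /=; lra.
  (* The central projection from [C'] of a common point of the two triangles. It lies on both [AC]
     and [CB], hence equals [C]. *)
  pose y := (1 - t)^-1 *: (r *: A + r' *: C).
  have yE : y = (1 - t)^-1 *: (k *: B + k' *: C).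
    by rewrite /y; congr (_ *: _); apply: (addIr (t *: C')); rewrite -xE -xE'.
  have yAC : edge_points [fset A; C]%fset y.
    rewrite edge_pointsE; apply/segmentP; exists ((1 - t)^-1 * r), ((1 - t)^-1 * r').
    rewrite !mulr_ge0 ?invr_ge0 ?(ltW ut0) //; split=> //.
      by rewrite -mulrDr (_ : r + r' = 1 - t) ?mulVf //; lra.
    by rewrite /y scalerDr !scalerA.
  have yCB : edge_points [fset C; B]%fset y.
    rewrite fset2C edge_pointsE; apply/segmentP; exists ((1 - t)^-1 * k), ((1 - t)^-1 * k').
    rewrite !mulr_ge0 ?invr_ge0 ?(ltW ut0) //; split=> //.
      by rewrite -mulrDr (_ : k + k' = 1 - t) ?mulVf //; lra.
    by rewrite yE scalerDr !scalerA.
  have yC : y = C.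
    have := link_embedded eAC eCB nACB yAC yCB; rewrite in_fsetI !inE => /andP[/orP[/eqP yA|/eqP//] /orP[/eqP//|/eqP yB]].
    by case/eqP: nACB; rewrite -yA -yB fset2C.
  have CE : (1 - t) *: C = r *: A + r' *: C by rewrite -{1}yC /y scalerA divff // scale1r.
  by rewrite xE addrC CE.
- move=> k; apply: contraNneq C'm => ->; apply/eqP; rewrite dotDl dotZl dotBl mA; lra.
- move=> k; apply: contraNneq C'm => ->; apply/eqP; rewrite dotDl dotZl dotBl mB; lra.
by exists C', K'.
Qed.
End Perturb.

(** * Adding a point to a planar set in general position *)

Section GenericPoints.
Variable R : realType.
Implicit Types (a b c d p q u v x y z : point3 R) (e f : edge R).
Implicit Types (s V : seq (point3 R)) (Ps : seq (point3 R * R)).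

Lemma collinear_line a b c : collinear a b c -> b != c -> exists k : R, a = b + k *: (c - b).
Proof.
move=> [p [d h]] bc.
have [|ka aE] := h a; first by rewrite inE eqxx.
have [|kb bE] := h b; first by rewrite !inE eqxx orbT.
have [|kc cE] := h c; first by rewrite !inE eqxx !orbT.
have kn : kc - kb != 0 by rewrite subr_eq0; apply: contraNneq bc => kk; rewrite bE cE kk.
exists ((ka - kb) / (kc - kb)); apply/rowP => i; rewrite aE bE cE !mxE; field.
exact: kn.
Qed.

Lemma collinear_perm a b c a' b' c' : perm_eq [:: a; b; c] [:: a'; b'; c'] ->
  collinear a b c -> collinear a' b' c'.
Proof. by move=> pr [p [d h]]; exists p, d => z; rewrite -(perm_mem pr); exact: h. Qed.

Lemma edge_subset_pair V e x : {subset e <= V} -> edge_interior e x ->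
  exists a b, [/\ e = [fset a; b]%fset, a \in V, b \in V, a != b & segment a b x].
Proof.
move=> eV [[a [b [eE xab]]] xn]; exists a, b; subst e; split=> //.
- by apply: eV; rewrite !inE eqxx.
- by apply: eV; rewrite !inE eqxx orbT.
- apply/eqP => ab; subst b; apply: xn => /=.
  by case: xab => r _ ->; rewrite -scalerDl subrK scale1r !inE eqxx.
Qed.

Definition no_triple V := forall e1 e2 e3 : edge R,
  {subset e1 <= V} -> {subset e2 <= V} -> {subset e3 <= V} ->
  uniq [:: e1; e2; e3] ->
  edge_interior e1 `&` edge_interior e2 `&` edge_interior e3 = set0.

Definition general_position V := [/\ uniq V, noncollinear V & no_triple V].

Lemma general_position_sub V V' : {subset V' <= V} -> uniq V' ->
  general_position V -> general_position V'.
Proof.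
move=> sub uV' [_ nc nt]; split=> //.
  by move=> a b c /sub aV /sub bV /sub cV; exact: nc.
move=> e1 e2 e3 h1 h2 h3; apply: nt => x xe; apply: sub; [exact: h1|exact: h2|exact: h3].
Qed.

Lemma interior_unique V e f x y : noncollinear V -> {subset e <= V} -> {subset f <= V} ->
  e != f -> edge_interior e x -> edge_interior f x -> edge_interior e y -> edge_interior f y -> x = y.
Proof.
move=> nc eV fV ef xe xf ye yf; apply/eqP; apply: contraNT ef => xy; apply/eqP.
have [a [b [eE aV bV ab xab]]] := edge_subset_pair eV xe.
have [c [d [fE cV dV cd xcd]]] := edge_subset_pair fV xf.
rewrite eE fE; apply: (two_points nc aV bV cV dV ab cd xy) => //.
  by have [] := ye; rewrite eE edge_pointsE.
by have [] := yf; rewrite fE edge_pointsE.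
Qed.

Definition hplane : plane R.
Proof.
by apply: (@Plane R (vec 0 0 1) 0); apply/eqP => /rowP/(_ 2)/eqP; rewrite !mxE oner_eq0.
Defined.
Local Notation pr := (project hplane).
Definition flat x := x 0 2 = 0.

Lemma prE x : pr x = vec (x 0 0) (x 0 1) 0.
Proof. by apply: point3P; rewrite /project /= !dotE !mxE /=; field; rewrite ?oner_eq0. Qed.

Lemma pr_flat x : flat (pr x).
Proof. by rewrite prE /flat mxE. Qed.

Lemma flat_pr x : flat x -> pr x = x.
Proof. by move=> xf; apply: point3P; rewrite prE !mxE. Qed.

(** The vertical plane over the line through the two points. For equal points it is some vertical
    plane through the point, so that avoiding it also avoids coincidence. *)
Definition wall (uv : point3 R * point3 R) : point3 R * R :=
  if uv.1 == uv.2 then (vec 1 0 0, uv.1 0 0) else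
  let m := vec (uv.1 0 1 - uv.2 0 1) (uv.2 0 0 - uv.1 0 0) 0 in (m, dot uv.1 m).

Lemma wall_neq0 u v : flat u -> flat v -> (wall (u, v)).1 != 0.
Proof.
move=> uf vf; rewrite /wall /=; have [_|uv] := eqVneq u v.
  by apply/eqP => /rowP/(_ 0)/eqP; rewrite !mxE oner_eq0.
apply: contra_neq uv => /rowP h; have := h 0; have := h 1; rewrite !mxE /= => h1 h0.
by apply: point3P; [lra|lra|rewrite uf vf].
Qed.

Lemma off_wall_line u v q (k : R) : dot q (wall (u, v)).1 != (wall (u, v)).2 -> u != v ->
  pr q <> u + k *: (v - u).
Proof.
rewrite /wall /= => + uv; rewrite (negbTE uv) /= => /eqP h e; apply: h.
have e0 := congr1 (fun x => x 0 0) e; have e1 := congr1 (fun x => x 0 1) e.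
rewrite prE !mxE /= in e0 e1; rewrite !dotE !mxE /= e0 e1; ring.
Qed.

Lemma off_wall_point u q : dot q (wall (u, u)).1 != (wall (u, u)).2 -> pr q <> u.
Proof.
rewrite /wall /= eqxx /= => /eqP h e; apply: h.
by rewrite dotE !mxE /= -e prE !mxE /=; ring.
Qed.

Lemma flat_conv a b x : flat a -> flat b -> segment a b x -> flat x.
Proof. by move=> af bf [r _ ->]; rewrite /flat !mxE af bf; ring. Qed.

(** The new point avoids all lines through two points of [Y], which contains the old points and the
    crossings of segments between them. Lines through old points exclude collinear triples; lines
    through an old point and a crossing exclude concurrent triples with one new segment. *)
Lemma extend_general V : general_position V -> (forall v, v \in V -> flat v) ->
  exists2 Ps, planes Ps & forall q, off_planes Ps q -> general_position (pr q :: V).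
Proof.
move=> [uV nc nt] Vflat.
pose Es := [seq [fset a; b]%fset : edge R | a <- V, b <- V].
(* [xget] returns the crossing of [e] and [f], unique by [interior_unique], or the default 0 if
   there is none; the latter only adds lines to avoid. *)
pose Xs := [seq pr (xget 0 (edge_interior e `&` edge_interior f)) | e <- Es, f <- Es].
pose Y := V ++ Xs.
have Yflat y : y \in Y -> flat y.
  by rewrite mem_cat => /orP[/Vflat//|/allpairsP[? [_ _ ->]]]; exact: pr_flat.
exists [seq wall (u, v) | u <- Y, v <- Y] => [_ /allpairsP[[u v] [/= uY vY ->]]|q qo].
  by apply: wall_neq0; exact: Yflat.
have offl u v k : u \in Y -> v \in Y -> u != v -> pr q <> u + k *: (v - u).
  by move=> uY vY; apply: off_wall_line; apply: qo; apply/allpairsP; exists (u, v).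
have VY v : v \in V -> v \in Y by rewrite /Y mem_cat => ->.
have qV : pr q \notin V.
  apply/negP => qV; apply: (@off_wall_point (pr q) q) => //.
  by apply: qo; apply/allpairsP; exists (pr q, pr q); split=> //; exact: VY.
have ncq b c : b \in V -> c \in V -> b != c -> ~ collinear (pr q) b c.
  move=> bV cV bc /collinear_line /(_ bc) [k]; apply: offl => //; exact: VY.
have nc' : noncollinear (pr q :: V).
  move=> a b c; rewrite !inE => /orP[/eqP->|aV] /orP[/eqP->|bV] /orP[/eqP->|cV];
    rewrite /= !inE ?eqxx ?orbT ?andbF //=; rewrite ?andbT ?negb_or.
  - by move=> /andP[_ bc]; exact: ncq.
  - move=> /andP[/andP[_ ac] _] col; apply: (ncq a c aV cV ac); apply: collinear_perm col.
    by apply/permP => z /=; lia.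
  - move=> /andP[/andP[ab _] _] col; apply: (ncq a b aV bV ab); apply: collinear_perm col.
    by apply/permP => z /=; lia.
  - by move=> h; apply: nc => //=; rewrite !inE negb_or andbT.
split=> //; first by rewrite cons_uniq qV.
have mk e x : {subset e <= pr q :: V} -> edge_interior e x ->
    {subset e <= V} \/ exists a, [/\ a \in V, e = [fset pr q; a]%fset & edge_interior e x].
  move=> eS xe; have [a [b [eE]]] := edge_subset_pair eS xe.
  rewrite !inE => /orP[/eqP aE|aV] /orP[/eqP bE|bV] ab xab.
  - by rewrite aE bE eqxx in ab.
  - by right; exists b; split=> //; rewrite eE aE.
  - by right; exists a; split=> //; rewrite eE bE fset2C.
  - by left => z; rewrite eE !inE => /orP[] /eqP->.
(* Two new segments share the endpoint [pr q]; a further common point makes them equal. *)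
have two a b x : a \in V -> b \in V -> edge_interior [fset pr q; a]%fset x ->
    edge_interior [fset pr q; b]%fset x -> a = b.
  move=> aV bV xa xb; apply/eqP/negPn/negP => ab.
  have [xa1 xa2 _] := edge_interiorP xa; have [xb1 _ _] := edge_interiorP xb.
  have sub z c : c \in V -> z \in [fset pr q; c]%fset -> z \in pr q :: V.
    by move=> cV; rewrite !inE => /orP[/eqP->|/eqP->]; rewrite ?eqxx // cV orbT.
  have qin : pr q \in pr q :: V by rewrite mem_head.
  have inV z : z \in V -> z \in pr q :: V by move=> zV; rewrite inE zV orbT.
  have qn z : z \in V -> pr q != z by move=> zV; apply: contraNneq qV => ->.
  have := two_points nc' qin (inV _ aV) qin (inV _ bV) (qn _ aV) (qn _ bV) xa2 xa1 (segment_l _ _) xb1 (segment_l _ _).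
  move=> /fset2_inj[[_ h]|[h _]]; first by rewrite h eqxx in ab.
  by rewrite -h (negbTE qV) in bV.
(* A new segment through a crossing of two old ones would put [pr q] on the line through [a] and
   that crossing. *)
have one a e f x : a \in V -> {subset e <= V} -> {subset f <= V} -> e != f ->
    edge_interior [fset pr q; a]%fset x -> edge_interior e x -> edge_interior f x -> False.
  move=> aV eV fV ef xa xe xf.
  have [xqa xq xna] := edge_interiorP xa.
  have inEs g z : {subset g <= V} -> edge_interior g z -> g \in Es.
    move=> gV /(edge_subset_pair gV)[c [d [gE cV dV _ _]]]; apply/allpairsP.
    by exists (c, d).
  have xflat : flat x.
    have [c [d [eE cV dV _ xcd]]] := edge_subset_pair eV xe.
    exact: (flat_conv (Vflat _ cV) (Vflat _ dV) xcd).
  have xX : x \in Y.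
    rewrite mem_cat; apply/orP; right; apply/allpairsP; exists (e, f).
    split; rewrite /= ?(inEs _ x) //.
    have [h1 h2] : (edge_interior e `&` edge_interior f) (xget 0 (edge_interior e `&` edge_interior f)).
      by apply: (@xgetPex _ 0); exists x.
    by rewrite -(interior_unique nc eV fV ef xe xf h1 h2) flat_pr.
  have [k /andP[k0 k1] xE] := xqa.
  have kn : 1 - k != 0.
    by apply: contraNneq xna => k1'; rewrite xE k1' (_ : k = 1) ?scale0r ?scale1r ?add0r //; lra.
  apply: (offl a x ((1 - k)^-1) (VY _ aV) xX); first by rewrite eq_sym.
  by rewrite xE; move: (pr q) => z; apply/rowP => i; rewrite !mxE; field; rewrite ?kn.
move=> e1 e2 e3 h1 h2 h3 u3; apply/seteqP; split=> // x [[x1 x2] x3].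
move: u3; rewrite /= !inE negb_or andbT => /andP[/andP[n12 n13] n23].
have [g1|[a1 [a1V E1 _]]] := mk _ x h1 x1; have [g2|[a2 [a2V E2 _]]] := mk _ x h2 x2;
  have [g3|[a3 [a3V E3 _]]] := mk _ x h3 x3.
- have u3 : uniq [:: e1; e2; e3] by rewrite /= !inE negb_or n12 n13 n23.
  by have : (edge_interior e1 `&` edge_interior e2 `&` edge_interior e3) x by []; rewrite nt.
- by rewrite E3 in x3; case: (one a3 e1 e2 x).
- by rewrite E2 in x2; case: (one a2 e1 e3 x).
- rewrite E2 in x2; rewrite E3 in x3; have h := two a2 a3 x a2V a3V x2 x3.
  by rewrite E2 E3 h eqxx in n23.
- by rewrite E1 in x1; case: (one a1 e2 e3 x).
- rewrite E1 in x1; rewrite E3 in x3; have h := two a1 a3 x a1V a3V x1 x3.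
  by rewrite E1 E3 h eqxx in n13.
- rewrite E1 in x1; rewrite E2 in x2; have h := two a1 a2 x a1V a2V x1 x2.
  by rewrite E1 E2 h eqxx in n12.
- rewrite E1 in x1; rewrite E2 in x2; have h := two a1 a2 x a1V a2V x1 x2.
  by rewrite E1 E2 h eqxx in n12.
Qed.
End GenericPoints.
Notation pr := (project (hplane _)).

Section PerturbLink.
Variable R : realType.
Implicit Types (s V D G : seq (point3 R)) (K : link R 2).

Lemma polygon_rot (P : {fset edge R}) k s : polygon P s -> polygon P (rot k s).
Proof. by move=> [us ss ->]; split; rewrite ?rot_uniq ?size_rot ?closed_edges_rot. Qed.

Lemma general_position_nil : general_position (@nil (point3 R)).
Proof.
split=> // e1 e2 e3 h1 _ _ _; apply/seteqP; split=> // x [[x1 _] _].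
by have [a [b [_ []]]] := edge_subset_pair h1 x1.
Qed.

(** [D] contains the vertices already moved and [rest] those still to be moved; a rotation brings
    the next one to the front. [G] carries the projections of a component that is already
    settled. *)
Lemma perturb_component i rest D K G : polygon (K i) (D ++ rest) ->
  (forall v, v \in G -> flat v) -> general_position (map pr D ++ G) ->
  exists K' w, [/\ isotopic K K', polygon (K' i) w, general_position (map pr w ++ G)
    & forall j, j != i -> K' j = K j].
Proof.
move=> + Gf; elim: rest D K => [|C rest IH] D K pK gD.
  by exists K, D; rewrite cats0 in pK; split=> //; exact: rst_refl.
have flatV v : v \in map pr D ++ G -> flat v.
  by rewrite mem_cat => /orP[/mapP[u _ ->]|/Gf//]; exact: pr_flat.
have [Ps Ps0 hPs] := extend_general gD flatV.
have := polygon_rot (size D) pK; rewrite rot_size_cat /=.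
case E : (rest ++ D) => [|B s] pK'; first by have [_] := pK'.
have [C' [K1 [C'o iso pK1 oth]]] := perturb_vertex Ps0 pK'.
have [||K2 [w [iso2 pw gw oth2]]] := IH (rcons D C') K1.
- by rewrite cat_rcons -[D ++ _](rot_size_cat (C' :: rest) D) /= E; exact: polygon_rot.
- apply: general_position_sub (hPs _ C'o).
    move=> x; rewrite map_rcons mem_cat mem_rcons !inE mem_cat -!orbA; by [].
  have [] := hPs _ C'o; rewrite map_rcons cat_rcons => u _ _.
  by rewrite -cat1s uniq_catCA.
exists K2, w; split=> //; first exact: rst_trans iso iso2.
by move=> j ji; rewrite oth2 // oth.
Qed.

Lemma perturb_link K : exists K' (W : 'I_2 -> seq (point3 R)),
  [/\ isotopic K K', forall i, polygon (K' i) (W i)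
    & general_position (map pr (W ord0) ++ map pr (W ord_max))].
Proof.
have [s0 p0] := link_polygon K ord0.
have fl0 (v : point3 R) : v \in [::] -> flat v by [].
have [K1 [w0 [iso1 pw0 g0 _]]] := @perturb_component ord0 s0 [::] K [::] p0 fl0 general_position_nil.
rewrite cats0 in g0.
have [s1 p1] := link_polygon K1 ord_max.
have fl1 (v : point3 R) : v \in map pr w0 -> flat v by move=> /mapP[u _ ->]; exact: pr_flat.
have [K2 [w1 [iso2 pw1 g1 oth]]] := @perturb_component ord_max s1 [::] K1 (map pr w0) p1 fl1 g0.
exists K2, (fun i => if i == ord0 then w0 else w1); split.
- exact: rst_trans iso1 iso2.
- move=> i; case: (i =P ord0) => [->|/eqP/ord2_max->] //.
  by rewrite oth.
- apply: (general_position_sub _ _ g1); first by move=> x; rewrite /= !mem_cat orbC.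
  by rewrite uniq_catC; have [] := g1.
Qed.
End PerturbLink.

(** * Chambers of a hyperplane arrangement *)

Section Signs.
Variable R : realFieldType.
Implicit Types x y t : R.

(** The ratio is the parameter at which the affine function with values [x] at 0 and [y] at 1
    vanishes. *)
Lemma opposite_ratio x y : x != 0 -> y != 0 -> (0 < x) != (0 < y) -> 0 < x / (x - y) < 1.
Proof.
move=> x0 y0; case: (ltgtP 0 x) x0 => // hx _; case: (ltgtP 0 y) y0 => // hy _ _.
  by rewrite divr_gt0 ?ltr_pdivrMr ?mul1r //; lra.
have -> : x / (x - y) = - x / (y - x) by rewrite -[in RHS]opprB invrN mulrNN.
by rewrite divr_gt0 ?ltr_pdivrMr ?mul1r //; lra.
Qed.

Lemma same_sign x y t : 0 < t < 1 -> x != 0 -> y != 0 -> (0 < x) == (0 < y) ->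
  (1 - t) * x + t * y != 0 /\ (0 < (1 - t) * x + t * y) = (0 < x).
Proof.
move=> /andP[t0 t1] x0 y0; case: (ltgtP 0 x) x0 => // hx _; case: (ltgtP 0 y) y0 => // hy _ _.
  have h : 0 < (1 - t) * x + t * y by rewrite addr_gt0 ?mulr_gt0 // subr_gt0.
  by rewrite h gt_eqF.
have h : (1 - t) * x + t * y < 0.
  by rewrite -oppr_gt0 opprD -!mulrN addr_gt0 ?mulr_gt0 ?oppr_gt0 // subr_gt0.
by rewrite lt_eqF //; split=> //; apply/negbTE; rewrite -leNgt ltW.
Qed.

Lemma opposite_sign x y t : x != 0 -> y != 0 -> (0 < x) != (0 < y) -> t != x / (x - y) ->
  (1 - t) * x + t * y != 0 /\
  (0 < (1 - t) * x + t * y) = if t < x / (x - y) then 0 < x else 0 < y.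
Proof.
move=> x0 y0 xy tn.
have d0 : x - y != 0 by rewrite subr_eq0; apply: contraNneq xy => ->.
have E : (1 - t) * x + t * y = (x - y) * (x / (x - y) - t) by field.
rewrite E mulf_neq0 // ?subr_eq0 1?eq_sym //; split=> //.
move: xy; case: (ltgtP 0 x) x0 => // hx _; case: (ltgtP 0 y) y0 => // hy _ _.
  rewrite pmulr_rgt0 ?subr_gt0; last by lra.
  by case: ifP.
rewrite nmulr_rgt0 ?subr_lt0; last by lra.
by case: (ltgtP t) tn; rewrite ?eqxx.
Qed.

Lemma ratio_inj x y z : x != 0 -> (0 < x) != (0 < z) -> (0 < x) != (0 < y) ->
  x / (x - z) = x / (x - y) -> z = y.
Proof.
move=> x0 xz xy /(mulfI x0) /invr_inj /addrI; exact: oppr_inj.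
Qed.
End Signs.

Section Chambers.
Variables (R : realType) (V : Type) (W : eqType) (ws : seq W).
Variables (l : W -> (V -> R) -> R) (G : (V -> R) -> Prop).
Implicit Types (h u : V -> R) (w : W).

Definition off_walls h := forall w, w \in ws -> l w h != 0.
Definition flips h h' := [seq w <- ws | (0 < l w h) != (0 < l w h')].

Lemma mem_flips h h' w : (w \in flips h h') = ((0 < l w h) != (0 < l w h')) && (w \in ws).
Proof. exact: mem_filter. Qed.

Hypothesis linear : forall w (a b : R) h h',
  l w (fun v => a * h v + b * h' v) = a * l w h + b * l w h'.
(** The walls are pairwise different hyperplanes. If two of them coincided, they could be crossed
    only together, and [wall_crossing] would never apply. *)
Hypothesis independent : forall w w', w \in ws -> w' \in ws -> w != w' ->
  exists u, l w u = 0 /\ l w' u != 0.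
Hypothesis wall_crossing : forall h h' w, off_walls h -> off_walls h' ->
  w \in ws -> (forall w', w' \in ws -> ((0 < l w' h) != (0 < l w' h')) = (w' == w)) ->
  G h <-> G h'.
Hypothesis uws : uniq ws.

Let T h h' w := l w h / (l w h - l w h').

(** A point [z] of the segment between the two parameters: a wall separating [h] from [h'] separates
    [z] from exactly one of them, and no other wall separates [z] from either. *)
Lemma split_chambers h h' w w' : off_walls h -> off_walls h' ->
  w \in flips h h' -> w' \in flips h h' -> T h h' w < T h h' w' ->
  exists z, [/\ off_walls z, w \in flips h z, w' \in flips z h' &
    size (flips h h') = (size (flips h z) + size (flips z h'))%N].
Proof.
move=> nh nh' wf w'f TT.
have D0 : 0 < T h h' w' - T h h' w by rewrite subr_gt0.
have pn0 : all (fun p : {poly R} => p != 0)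
    [seq 'X - (T h h' w'' - T h h' w)%:P | w'' <- ws].
  by apply/allP => _ /mapP[w'' _ ->]; rewrite polyXsubC_eq0.
have [d /andP[d0 dD] /allP hd] := avoid_roots D0 pn0.
(* The shift [d] is less than the gap between the two parameters and avoids the finitely many values
   that would put [z] on a wall. *)
pose t := T h h' w + d; pose z v := (1 - t) * h v + t * h' v.
have zE w'' : l w'' z = (1 - t) * l w'' h + t * l w'' h' by rewrite linear.
have tT w'' : w'' \in ws -> t != T h h' w''.
  move=> ww; have := hd _ (map_f _ ww); rewrite hornerXsubC subr_eq0.
  by apply: contra_neq; rewrite /t => <-; ring.
have mem w'' : w'' \in flips h h' -> (0 < l w'' h) != (0 < l w'' h') /\ w'' \in ws.
  by rewrite mem_flips => /andP.
have [[sw ww] [sw' w'w]] := (mem _ wf, mem _ w'f).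
have T01 w'' : w'' \in flips h h' -> 0 < T h h' w'' < 1.
  by move=> /mem[sg ww'']; exact: opposite_ratio (nh _ ww'') (nh' _ ww'') sg.
have [/andP[Tw0 _] /andP[_ Tw'1]] := (T01 _ wf, T01 _ w'f).
have t01 : 0 < t < 1 by rewrite /t addr_gt0 //=; lra.
have same w'' : w'' \in ws -> (0 < l w'' h) == (0 < l w'' h') ->
    l w'' z != 0 /\ (0 < l w'' z) = (0 < l w'' h).
  by move=> h1 h2; rewrite zE; exact: same_sign t01 (nh _ h1) (nh' _ h1) h2.
have opp w'' : w'' \in flips h h' ->
    l w'' z != 0 /\ (0 < l w'' z) = (if t < T h h' w'' then 0 < l w'' h else 0 < l w'' h').
  move=> /mem[h2 h1]; rewrite zE; exact: opposite_sign (nh _ h1) (nh' _ h1) h2 (tT _ h1).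
have tw : t < T h h' w = false by rewrite /t; apply/negbTE; rewrite -leNgt; lra.
have tw' : t < T h h' w' by rewrite /t; lra.
exists z; split.
- move=> w'' h1; have [h2|h2] := boolP ((0 < l w'' h) == (0 < l w'' h')).
    by have [] := same _ h1 h2.
  by have [|//] := opp w''; rewrite mem_flips h2.
- by rewrite mem_flips ww andbT; have [_ ->] := opp _ wf; rewrite tw.
- by rewrite mem_flips w'w andbT; have [_ ->] := opp _ w'f; rewrite tw'.
- rewrite !size_filter -count_predUI [X in _ = (_ + X)%N](_ : _ = 0%N) ?addn0; last first.
    apply/eqP; rewrite -leqn0 leqNgt -has_count; apply/hasPn => w'' h1 /=.
    have [h2|h2] := boolP ((0 < l w'' h) == (0 < l w'' h')).
      by have [_ ->] := same _ h1 h2; rewrite eqxx.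
    have [|_ ->] := opp w''; first by rewrite mem_flips h2.
    by case: ifP => _; rewrite eqxx ?andbF.
  apply: eq_in_count => w'' h1 /=.
  have [h2|h2] := boolP ((0 < l w'' h) == (0 < l w'' h')).
    by have [_ ->] := same _ h1 h2; rewrite h2 eqxx.
  have [|_ ->] := opp w''; first by rewrite mem_flips h2.
  by case: ifP => _; rewrite h2 ?orbT.
Qed.

(** A step along a direction inside the wall [w] but not inside [w'], too short to change the sign
    of any form at [h']. *)
Lemma perturb_chamber h' w w' : off_walls h' -> w \in ws -> w' \in ws -> w != w' ->
  exists h'', [/\ off_walls h'', forall w, w \in ws -> (0 < l w h'') = (0 < l w h'),
    l w h'' = l w h' & l w' h'' != l w' h'].
Proof.
move=> nh' ww w'w ne; have [u [u0 u'0]] := independent ww w'w ne.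
pose Q (w0 : W) (e : R) := e * `|l w0 u| < `|l w0 h'|.
have [|w0 e e' ee|e e0 he] := @small_enough R _ ws Q.
- move=> w0 w0w; have M0 : 0 < 1 + `|l w0 u| by rewrite ltr_pwDl.
  exists (`|l w0 h'| / (1 + `|l w0 u|)); first by rewrite divr_gt0 // normr_gt0 nh'.
  rewrite /Q mulrAC ltr_pdivrMr // mulrDr mulr1 ltrDr normr_gt0; exact: nh'.
- by apply: le_lt_trans; rewrite ler_wpM2r.
pose h'' v := 1 * h' v + e * u v.
have h''E w0 : l w0 h'' = l w0 h' + e * l w0 u by rewrite linear mul1r.
have small w0 : w0 \in ws -> `|e * l w0 u| < `|l w0 h'|.
  by move=> /he; rewrite /Q normrM (ger0_norm (ltW e0)).
exists h''; split.
- move=> w0 w0w; rewrite h''E addr_eq0; apply/eqP => e1.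
  by have := small _ w0w; rewrite e1 normrN ltxx.
- move=> w0 w0w; rewrite h''E; move: (nh' _ w0w) (small _ w0w).
  move: (l w0 h') (e * _) => x y x0; rewrite ltr_norml => /andP[h1 h2].
  case: (ltP 0 x) h1 h2 => hx; [rewrite gtr0_norm //|rewrite ler0_norm //] => h1 h2.
    by rewrite (_ : 0 < x + y); [|lra].
  by apply/negbTE; rewrite -leNgt; lra.
- by rewrite h''E u0 mulr0 addr0.
- by rewrite h''E -subr_eq0 addrC addKr mulf_neq0 // gt_eqF.
Qed.

(* The segment from h to h' meets the wall w at the parameter T h h' w.  If two
   walls are met at the same point, h' is moved slightly within its chamber. *)
Lemma chambers_connected h h' : off_walls h -> off_walls h' ->
  (0 < size (flips h h'))%N -> G h <-> G h'.
Proof.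
have [n] := ubnP (size (flips h h')); elim: n h h' => // n IH h h' sn nh nh' s0.
(* The intermediate point is constructed on the segment towards [h''], but the number of walls
   depends only on signs, so the induction hypothesis may be applied with [h'] itself. *)
have split w w' h'' : off_walls h'' -> (forall w, w \in ws -> (0 < l w h'') = (0 < l w h')) ->
    w \in flips h h' -> w' \in flips h h' -> T h h'' w < T h h'' w' -> G h <-> G h'.
  move=> nh'' sg wf w'f TT.
  have fE z : flips z h'' = flips z h' by apply: eq_in_filter => w0 w0w; rewrite sg.
  have [wf' w'f'] : w \in flips h h'' /\ w' \in flips h h'' by rewrite !fE.
  have [z [nz f1 f2 sz]] := split_chambers nh nh'' wf' w'f' TT.
  rewrite !fE in sz f2.
  have s1 : (0 < size (flips h z))%N by case: (flips h z) f1.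
  have s2 : (0 < size (flips z h'))%N by case: (flips z h') f2.
  rewrite sz in sn.
  have G1 : G h <-> G z by apply: IH => //; lia.
  have G2 : G z <-> G h' by apply: IH => //; lia.
  by rewrite G1.
have uf : uniq (flips h h') by exact: filter_uniq.
case E : (flips h h') s0 uf => [//|w [|w' r]] _ uf.
  have wf : w \in flips h h' by rewrite E mem_head.
  apply: (wall_crossing (w := w)) => //; first by move: wf; rewrite mem_flips => /andP[].
  move=> w0 w0w; have : (w0 \in flips h h') = (w0 == w) by rewrite E !inE.
  by rewrite mem_flips w0w andbT.
have wf : w \in flips h h' by rewrite E mem_head.
have w'f : w' \in flips h h' by rewrite E !inE eqxx orbT.
have ne : w != w' by move: uf; rewrite /= !inE negb_or => /andP[/andP[]].
have [sw ww] : (0 < l w h) != (0 < l w h') /\ w \in ws by move: wf; rewrite mem_flips => /andP.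
have [sw' w'w] : (0 < l w' h) != (0 < l w' h') /\ w' \in ws by move: w'f; rewrite mem_flips => /andP.
have [TT|TT|TT] := ltgtP (T h h' w) (T h h' w').
- exact: (split w w' h').
- exact: (split w' w h').
have [h'' [nh'' sg e1 e2]] := perturb_chamber nh' ww w'w ne.
have Tw : T h h'' w = T h h' w by rewrite /T e1.
have Tw' : T h h'' w' != T h h' w'.
  have sg' : (0 < l w' h) != (0 < l w' h'') by rewrite (sg _ w'w).
  by apply/eqP => /(ratio_inj (nh _ w'w) sg' sw') e; rewrite e eqxx in e2.
have [TT'|TT'|TT'] := ltgtP (T h h'' w) (T h h'' w').
- exact: (split w w' h'').
- exact: (split w' w h'').
by rewrite -TT' Tw TT eqxx in Tw'.
Qed.

(* Points of one chamber are compared with a point of the opposite chamber, which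
   is a different one only if there is a wall. *)
Lemma chambers_equivalent h h' : ws != [::] -> off_walls h -> off_walls h' ->
  G h <-> G h'.
Proof.
move=> ws0 nh nh'; pose k v := (-1) * h v + 0 * h v.
have kE w : l w k = - l w h by rewrite linear mul0r addr0 mulN1r.
have nk : off_walls k by move=> w ww; rewrite kE oppr_eq0 nh.
have [s0|s0] := posnP (size (flips h h')); last exact: chambers_connected.
have sg w : w \in ws -> (0 < l w h) = (0 < l w h').
  move=> ww; apply/eqP/negPn/negP => ne.
  by have : w \in flips h h'; [rewrite mem_flips ne|move: s0; case: (flips h h')].
have fl x : off_walls x -> (forall w, w \in ws -> (0 < l w x) = (0 < l w h)) ->
    (0 < size (flips x k))%N.
  move=> nx xs; case E : ws ws0 => [//|w r] _.
  have ww : w \in ws by rewrite E mem_head.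
  have : w \in flips x k.
    rewrite mem_flips ww andbT kE oppr_gt0 (xs _ ww); have := nh _ ww.
    by case: (ltgtP 0 (l w h)).
  by case: (flips x k).
have G1 : G h <-> G k by apply: chambers_connected => //; exact: fl.
have G2 : G h' <-> G k.
  by apply: chambers_connected => //; apply: fl => // w ww; rewrite sg.
by rewrite G1 G2.
Qed.
End Chambers.

(** * Links over a planar diagram *)

Section Lifts.
Variable R : realType.
Implicit Types (a b c d p q u v x y z : point3 R) (e f : edge R) (K : link R 2).
Implicit Types (h : point3 R -> R) (L : 'I_2 -> seq (point3 R)).

Definition hlift h q : point3 R := vec (q 0 0) (q 0 1) (h q).

Record planar L := Planar {
  planar_size : forall i, (2 < size (L i))%N;
  planar_flat : forall i q, q \in L i -> flat q;
  planar_general : general_position (L ord0 ++ L ord_max) }.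

Lemma lift_mem L i q : q \in L i -> q \in L ord0 ++ L ord_max.
Proof. by rewrite mem_cat; case: (i =P ord0) => [->|/eqP/ord2_max->] ->; rewrite ?orbT. Qed.

Lemma planar_uniq L i : planar L -> uniq (L i).
Proof.
move=> [_ _ [+ _ _]]; rewrite cat_uniq.
by case: (i =P ord0) => [->|/eqP/ord2_max->] /and3P[].
Qed.

Lemma planar_disjoint L i j q : planar L -> q \in L i -> q \in L j -> i = j.
Proof.
move=> [_ _ [+ _ _]]; rewrite cat_uniq => /and3P[_ /hasPn no _] qi qj.
apply/eqP/negPn/negP => ij; move: qi qj ij.
case: (i =P ord0) => [->|/eqP/ord2_max->]; case: (j =P ord0) => [->|/eqP/ord2_max->];
  rewrite ?eqxx // => q0 q1 _.
  by have := no _ q1; rewrite /= q0.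
by have := no _ q0; rewrite /= q1.
Qed.

Lemma pr_lift h q : flat q -> pr (hlift h q) = q.
Proof. by move=> qf; apply: point3P; rewrite prE !mxE. Qed.

Lemma lift_pr x h : h (pr x) = x 0 2 -> hlift h (pr x) = x.
Proof. by move=> hx; rewrite /hlift hx prE; apply: point3P; rewrite !mxE. Qed.

Lemma lift_inj L h i : planar L -> {in L i &, injective (hlift h)}.
Proof.
move=> pL p q pi qi e.
by rewrite -(pr_lift h (planar_flat pL pi)) e pr_lift //; exact: (planar_flat pL qi).
Qed.

Lemma lift_polygon L h i : planar L ->
  polygon (closed_edges (map (hlift h) (L i))) (map (hlift h) (L i)).
Proof.
move=> pL; split=> //; last by rewrite size_map; exact: planar_size.
by rewrite map_inj_in_uniq; [exact: planar_uniq|exact: lift_inj].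
Qed.

Lemma lift_segment_pr h a b x : flat a -> flat b -> segment (hlift h a) (hlift h b) x ->
  segment a b (pr x).
Proof. by move=> af bf /(project_segment (hplane R)); rewrite !pr_lift. Qed.

Lemma lift_segment_inj h a b x y : flat a -> flat b -> a != b ->
  segment (hlift h a) (hlift h b) x -> segment (hlift h a) (hlift h b) y -> pr x = pr y -> x = y.
Proof.
move=> af bf ab [r _ xE] [k _ yE]; rewrite xE yE !project_conv ?subrK // !pr_lift //.
by move=> /(segment_param ab) ->.
Qed.

Lemma lift_edgeP L h i e : e \in closed_edges (map (hlift h) (L i)) ->
  exists a b, (a, b) \in cyc (L i) /\ e = [fset hlift h a; hlift h b]%fset.
Proof.
move=> /closed_edgesP[ab']; rewrite /cyc cyc_map => /mapP[[a b] ab ->] ->.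
by exists a, b.
Qed.

Lemma cyc_flat L i a b : planar L -> (a, b) \in cyc (L i) -> [/\ flat a, flat b, a != b, a \in L i & b \in L i].
Proof.
move=> pL ab; have [ai bi] := mem_cyc ab.
split=> //; [exact: (planar_flat pL ai)|exact: (planar_flat pL bi)|].
exact: (cyc_neq (planar_uniq i pL) (ltnW (planar_size pL i)) ab).
Qed.

(** Only sides with four distinct ends need a condition: by [lift_shared], sides with a common end
    can meet only over that end, whatever the heights. *)
Definition lift_embedded L h := forall i j a b c d x, (a, b) \in cyc (L i) -> (c, d) \in cyc (L j) ->
  uniq [:: a; b; c; d] -> segment (hlift h a) (hlift h b) x -> ~ segment (hlift h c) (hlift h d) x.

Definition is_lift L h K := forall i, K i = closed_edges (map (hlift h) (L i)).

Lemma lift_shared L h i j a b c d x p : planar L -> (a, b) \in cyc (L i) -> (c, d) \in cyc (L j) ->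
  p \in [fset a; b]%fset -> p \in [fset c; d]%fset -> [fset a; b]%fset != [fset c; d]%fset :> edge R ->
  segment (hlift h a) (hlift h b) x -> segment c d (pr x) -> x = hlift h p.
Proof.
move=> pL ab cd pab pcd ne xab xcd.
have [af bf abn ai bi] := cyc_flat pL ab; have [cf df cdn ci di] := cyc_flat pL cd.
have [_ ncV _] := planar_general pL.
have end_in y z q : q \in [fset y; z]%fset -> segment y z q.
  by rewrite !inE => /orP[] /eqP ->; [exact: segment_l|exact: segment_r].
have pE : pr x = p.
  apply/eqP/negPn/negP => xp; case/eqP: ne.
  apply: (two_points ncV (lift_mem ai) (lift_mem bi) (lift_mem ci) (lift_mem di) abn cdn xp).
  - exact: lift_segment_pr xab.
  - exact: end_in.
  - exact: xcd.
  - exact: end_in.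
have pf : flat p by move: pab; rewrite !inE => /orP[] /eqP ->.
apply: (lift_segment_inj af bf abn xab); last by rewrite pr_lift.
by move: pab; rewrite !inE => /orP[] /eqP ->; [exact: segment_l|exact: segment_r].
Qed.

Lemma lift_link L h : planar L -> lift_embedded L h -> exists K, is_lift L h K.
Proof.
move=> pL emb.
have knot i : is_knot (closed_edges (map (hlift h) (L i))).
  apply: (is_knot_polygon (lift_polygon h i pL)) => e f x.
  move=> /lift_edgeP[a [b [ab ->]]] /lift_edgeP[c [d [cd ->]]] ne.
  rewrite !edge_pointsE => xab xcd.
  have [af bf abn ai bi] := cyc_flat pL ab; have [cf df cdn ci di] := cyc_flat pL cd.
  have ne' : [fset a; b]%fset != [fset c; d]%fset :> edge R.
    by apply: contra_neq ne => /fset2_inj[[-> ->]|[-> ->]] //; rewrite fset2C.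
  have xcd' : segment c d (pr x) by exact: lift_segment_pr xcd.
  have shared p : p \in [fset a; b]%fset -> p \in [fset c; d]%fset ->
      x \in ([fset hlift h a; hlift h b] `&` [fset hlift h c; hlift h d])%fset.
    move=> pab pcd; rewrite (lift_shared pL ab cd pab pcd ne' xab xcd') in_fsetI.
    by apply/andP; split; [move: pab|move: pcd]; rewrite !inE => /orP[] /eqP ->; rewrite eqxx ?orbT.
  have [ac|ac] := eqVneq a c; first by apply: (shared a); rewrite !inE ?ac eqxx.
  have [ad|ad] := eqVneq a d; first by apply: (shared a); rewrite !inE ?ad eqxx ?orbT.
  have [bc|bc] := eqVneq b c; first by apply: (shared b); rewrite !inE ?bc eqxx ?orbT.
  have [bd|bd] := eqVneq b d; first by apply: (shared b); rewrite !inE ?bd eqxx ?orbT.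
  case: (emb _ _ _ _ _ _ _ ab cd _ xab xcd).
  by rewrite /= !inE !negb_or abn ac ad bc bd cdn.
have dis i j : i != j -> polyline_points (closed_edges (map (hlift h) (L i))) `&`
    polyline_points (closed_edges (map (hlift h) (L j))) = set0.
  move=> ij; apply/seteqP; split=> // x [[e eK xe] [f fK xf]].
  move: eK xe fK xf => /lift_edgeP[a [b [ab ->]]] + /lift_edgeP[c [d [cd ->]]].
  rewrite !edge_pointsE => xab xcd; apply: (emb _ _ _ _ _ _ _ ab cd _ xab xcd).
  have [af bf abn ai bi] := cyc_flat pL ab; have [cf df cdn ci di] := cyc_flat pL cd.
  have dj p q : p \in L i -> q \in L j -> p != q.
    by move=> pi qj; apply: contraNneq ij => pq; apply/eqP/(planar_disjoint pL pi); rewrite pq.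
  by rewrite /= !inE !negb_or abn cdn !dj.
by exists (Link knot dis).
Qed.

Lemma link_lift K (W : 'I_2 -> seq (point3 R)) : (forall i, polygon (K i) (W i)) ->
  general_position (map pr (W ord0) ++ map pr (W ord_max)) ->
  exists h, [/\ planar (fun i => map pr (W i)), is_lift (fun i => map pr (W i)) h K
              & lift_embedded (fun i => map pr (W i)) h].
Proof.
move=> pW gp; have [u _ _] := gp; rewrite -map_cat in u.
pose V := W ord0 ++ W ord_max; have inj := map_uniq_inj u.
(* Projections of vertices are distinct, so the vertex over [q], and with it its height, can be
   recovered from the position of [q] in the list. *)
pose h q := (nth 0 V (index q (map pr V))) 0 2.
have hE x : x \in V -> h (pr x) = x 0 2.
  move=> xV; rewrite /h.
  have ix : (index (pr x) (map pr V) < size V)%N by rewrite -(size_map pr V) index_mem map_f.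
  suff -> : nth 0 V (index (pr x) (map pr V)) = x by [].
  apply: (inj _ _ (mem_nth 0 ix) xV).
  by rewrite -(nth_map _ (pr 0)) ?nth_index ?map_f.
have WV i x : x \in W i -> x \in V.
  by rewrite /V mem_cat; case: (i =P ord0) => [->|/eqP/ord2_max->] ->; rewrite ?orbT.
have mapE i : map (hlift h) (map pr (W i)) = W i.
  rewrite -map_comp; apply: map_id_in => x /WV xV /=.
  exact/lift_pr/hE.
have pL : planar (fun i => map pr (W i)).
  split=> // [i|i q /mapP[x _ ->]]; last exact: pr_flat.
  by rewrite size_map; have [] := pW i.
have lK : is_lift (fun i => map pr (W i)) h K.
  by move=> i; rewrite mapE; have [] := pW i.
exists h; split=> // i j a b c d x ab cd ne xab xcd.
have edgeK k p q : (p, q) \in cyc (map pr (W k)) -> [fset hlift h p; hlift h q]%fset \in K k.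
  move=> pq; rewrite lK; apply/closed_edgesP; exists (hlift h p, hlift h q) => //.
  by rewrite /cyc cyc_map; apply/mapP; exists (p, q).
have [af bf abn ai bi] := cyc_flat pL ab; have [cf df cdn ci di] := cyc_flat pL cd.
have eab : edge_points [fset hlift h a; hlift h b]%fset x by rewrite edge_pointsE.
have ecd : edge_points [fset hlift h c; hlift h d]%fset x by rewrite edge_pointsE.
have [ij|ij] := eqVneq i j; last first.
  exact: (link_disjoint ij (polyline_edge (edgeK _ _ _ ab) eab) (polyline_edge (edgeK _ _ _ cd) ecd)).
subst j; have nee : [fset hlift h a; hlift h b]%fset != [fset hlift h c; hlift h d]%fset :> edge R.
  apply/eqP => /fset2_inj[[/(lift_inj pL ai ci) e1 _]|[/(lift_inj pL ai di) e1 _]];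
    by move: ne; rewrite e1 /= !inE eqxx ?orbT.
have := link_embedded (edgeK _ _ _ ab) (edgeK _ _ _ cd) nee eab ecd.
rewrite in_fsetI !inE => /andP[/orP[]/eqP x1 /orP[]/eqP x2]; rewrite x1 in x2.
- by move: ne; rewrite (lift_inj pL ai ci x2) /= !inE eqxx ?orbT.
- by move: ne; rewrite (lift_inj pL ai di x2) /= !inE eqxx ?orbT.
- by move: ne; rewrite (lift_inj pL bi ci x2) /= !inE eqxx ?orbT ?andbF.
- by move: ne; rewrite (lift_inj pL bi di x2) /= !inE eqxx ?orbT ?andbF.
Qed.
End Lifts.

(** * The hyperplanes of height functions at which two strands meet *)

Section Walls.
Variable R : realType.
Implicit Types (a b c d p q x y z : point3 R) (e f : edge R) (K : link R 2).
Implicit Types (h : point3 R -> R).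
Variable L : 'I_2 -> seq (point3 R).
Hypothesis pL : planar L.
Local Notation V := (L ord0 ++ L ord_max).
Implicit Types (u v : point3 R * point3 R).

Definition sides := cyc (L ord0) ++ cyc (L ord_max).

Lemma sidesP u : reflect (exists i, u \in cyc (L i)) (u \in sides).
Proof.
apply: (iffP idP) => [|[i]]; rewrite mem_cat.
  by case/orP=> h; [exists ord0|exists ord_max].
by case: (i =P ord0) => [->|/eqP/ord2_max->] ->; rewrite ?orbT.
Qed.

Lemma side_facts u : u \in sides -> [/\ flat u.1, flat u.2, u.1 != u.2, u.1 \in V & u.2 \in V].
Proof.
case/sidesP => i; case: u => a b /(cyc_flat pL)[? ? ? ai bi]; split=> //=; [exact: (lift_mem ai)|exact: (lift_mem bi)].
Qed.

Lemma side_inj u v : u \in sides -> v \in sides ->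
  [fset u.1; u.2]%fset = [fset v.1; v.2]%fset :> edge R -> u = v.
Proof.
case/sidesP => i ui /sidesP[j vj] e.
have ij : i = j.
  have : u.1 \in [fset v.1; v.2]%fset by rewrite -e !inE eqxx.
  case: u v ui vj e => a b [c d] ab cd _; have [ai _] := mem_cyc ab; have [cj dj] := mem_cyc cd.
  by rewrite !inE => /orP[] /eqP /= h; rewrite h in ai; exact: (planar_disjoint pL ai).
subst j; exact: (closed_edges_inj (planar_uniq i pL) (planar_size pL i) ui vj e).
Qed.

Definition apart u v := uniq [:: u.1; u.2; v.1; v.2].

Lemma apart_sym u v : apart u v -> apart v u.
Proof. by rewrite /apart -[[:: u.1, _ & _]]/([:: u.1; u.2] ++ _) uniq_catC. Qed.

Definition crossing_at u v (s r : R) := [/\ 0 <= s <= 1, 0 <= r <= 1 &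
  (1 - s) *: u.1 + s *: u.2 = (1 - r) *: v.1 + r *: v.2].

Lemma crossing_at_sym u v s r : crossing_at u v s r -> crossing_at v u r s.
Proof. by move=> [h1 h2 h3]; split. Qed.

Lemma apart_neq u v : u \in sides -> v \in sides -> apart u v ->
  [fset u.1; u.2]%fset != [fset v.1; v.2]%fset :> edge R.
Proof.
move=> us vs ap; apply/eqP => /(side_inj us vs) e; move: ap; rewrite e.
by rewrite /apart /= !inE eqxx ?orbT.
Qed.

Lemma crossing_unique u v s r s' r' : u \in sides -> v \in sides -> apart u v ->
  crossing_at u v s r -> crossing_at u v s' r' -> s = s' /\ r = r'.
Proof.
move=> us vs ap [s01 r01 e] [s'01 r'01 e'].
have [uf1 uf2 un u1 u2] := side_facts us; have [vf1 vf2 vn v1 v2] := side_facts vs.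
have [_ ncV _] := planar_general pL.
have [xy|xy] := eqVneq ((1 - s) *: u.1 + s *: u.2) ((1 - s') *: u.1 + s' *: u.2).
  split; first exact: (segment_param un).
  by apply: (segment_param vn); rewrite -e -e'.
case/eqP: (apart_neq us vs ap).
by apply: (two_points ncV u1 u2 v1 v2 un vn xy);
  [exists s|exists s'|exists r|exists r'].
Qed.

Lemma crossing_inside u v s r : u \in sides -> v \in sides -> apart u v ->
  crossing_at u v s r -> 0 < s < 1.
Proof.
move=> us vs ap [/andP[s0 s1] r01 e].
have [uf1 uf2 un u1 u2] := side_facts us; have [vf1 vf2 vn v1 v2] := side_facts vs.
have [_ ncV _] := planar_general pL.
have no z : z \in V -> uniq [:: v.1; v.2; z] -> (1 - s) *: u.1 + s *: u.2 != z.
  move=> zV uz; apply/eqP => ez; apply: (ncV _ _ _ v1 v2 zV uz); apply: segment_collinear.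
  by exists r; rewrite // -ez e.
have : uniq [:: v.1; v.2; u.1] /\ uniq [:: v.1; v.2; u.2].
  move: ap; rewrite /apart /= !inE !negb_or vn !andbT.
  by move=> /andP[/and3P[_ h1 h2] /andP[h3 h4]]; rewrite ![v.1 == _]eq_sym ![v.2 == _]eq_sym h1 h2 h3 h4.
move=> [/(no _ u1) n1 /(no _ u2) n2].
rewrite !lt_neqAle s0 s1 !andbT; apply/andP; split.
  by apply: contraNneq n1 => <-; rewrite subr0 scale1r scale0r addr0.
by apply: contraNneq n2 => ->; rewrite subrr scale1r scale0r add0r.
Qed.

Definition crossing_param u v : R * R :=
  xget (0, 0) [set sr | crossing_at u v sr.1 sr.2].

(** The height of the first strand minus that of the second at their crossing, a linear form in [h].
    The default parameters [(0, 0)] are used only for pairs that do not cross. *)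
Definition gap (uv : (point3 R * point3 R) * (point3 R * point3 R)) h : R :=
  let: (s, r) := crossing_param uv.1 uv.2 in
  (1 - s) * h uv.1.1 + s * h uv.1.2 - ((1 - r) * h uv.2.1 + r * h uv.2.2).

Lemma gapE u v s r h : u \in sides -> v \in sides -> apart u v -> crossing_at u v s r ->
  gap (u, v) h = (1 - s) * h u.1 + s * h u.2 - ((1 - r) * h v.1 + r * h v.2).
Proof.
move=> us vs ap cr; rewrite /gap /=; case E : (crossing_param u v) => [s' r'].
have : crossing_at u v (crossing_param u v).1 (crossing_param u v).2.
  by apply: (@xgetPex _ (0, 0) [set sr | crossing_at u v sr.1 sr.2]); exists (s, r).
by rewrite E /= => cr'; have [-> ->] := crossing_unique us vs ap cr cr'.
Qed.

Lemma gapN u v s r h : u \in sides -> v \in sides -> apart u v -> crossing_at u v s r ->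
  gap (v, u) h = - gap (u, v) h.
Proof.
move=> us vs ap cr; rewrite (gapE h us vs ap cr).
by rewrite (gapE h vs us (apart_sym ap) (crossing_at_sym cr)) opprB.
Qed.

(** The condition on indices keeps one order of each pair; both orders define the same hyperplane
    and would violate the independence of the walls. *)
Definition walls := [seq uv <- [seq (u, v) | u <- sides, v <- sides] |
  [&& (index uv.1 sides < index uv.2 sides)%N, apart uv.1 uv.2 &
      `[< exists s r, crossing_at uv.1 uv.2 s r >]]].

Lemma wallsP u v : reflect
  [/\ u \in sides, v \in sides, (index u sides < index v sides)%N, apart u v &
      exists s r, crossing_at u v s r]
  ((u, v) \in walls).
Proof.
rewrite mem_filter; apply: (iffP andP).
  by move=> [/and3P[h1 h2 /asboolP h3] /allpairsP[[u' v'] [/= us vs [e1 e2]]]]; subst.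
move=> [us vs h1 h2 h3]; split; first by apply/and3P; split=> //; exact/asboolP.
by apply/allpairsP; exists (u, v).
Qed.

Lemma sides_uniq : uniq sides.
Proof.
rewrite cat_uniq !uniq_cyc ?planar_uniq // andbT /=; apply/hasPn => -[a b] /mem_cyc[a1 _].
by apply/negP => /mem_cyc[a0 _]; have := planar_disjoint pL a0 a1.
Qed.

Lemma walls_uniq : uniq walls.
Proof.
apply: filter_uniq; apply: (allpairs_uniq sides_uniq sides_uniq); by move=> [? ?] [? ?] _ _ [-> ->].
Qed.

Lemma wall_either u v s r : u \in sides -> v \in sides -> apart u v -> crossing_at u v s r ->
  (u, v) \in walls \/ (v, u) \in walls.
Proof.
move=> us vs ap cr; case: (ltngtP (index u sides) (index v sides)) => lt.
- by left; apply/wallsP; split=> //; exists s, r.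
- by right; apply/wallsP; split=> //; [exact: apart_sym|exists r, s; exact: crossing_at_sym].
- have uv : u = v by rewrite -[LHS](nth_index u us) lt nth_index.
  by move: ap; rewrite uv /apart /= !inE eqxx ?orbT.
Qed.

Lemma gap_linear uv (k k' : R) h h' :
  gap uv (fun x => k * h x + k' * h' x) = k * gap uv h + k' * gap uv h'.
Proof. by rewrite /gap; case: (crossing_param _ _) => s r; ring. Qed.

(** The crossing is interior to both sides, so the form has a nonzero coefficient at each of the
    four endpoints. *)
Lemma gap_delta u v p : (u, v) \in walls -> p \in [:: u.1; u.2; v.1; v.2] ->
  gap (u, v) (fun x => (x == p)%:R) != 0.
Proof.
move=> /wallsP[us vs uv ap [s [r cr]]]; rewrite (gapE _ us vs ap cr).
have /andP[s0 s1] := crossing_inside us vs ap cr.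
have /andP[r0 r1] := crossing_inside vs us (apart_sym ap) (crossing_at_sym cr).
have del x y : x != y -> (x == y)%:R = 0 :> R by move=> /negbTE ->.
have del2 x y : y != x -> (x == y)%:R = 0 :> R by rewrite eq_sym; exact: del.
move: ap; rewrite /apart /= !inE !negb_or andbT => /and3P[/and3P[h1 h2 h3] /andP[h4 h5] h6].
case/or4P => /eqP ->; rewrite eqxx.
- rewrite (del2 u.2) // (del2 v.1) // (del2 v.2) // !mulr0 ?mulr1 ?addr0 ?add0r ?subr0 ?sub0r ?addr0.
  by rewrite ?oppr_eq0 ?subr_eq0 gt_eqF.
- rewrite (del u.1) // (del2 v.1) // (del2 v.2) // !mulr0 ?mulr1 ?addr0 ?add0r ?subr0 ?sub0r ?addr0.
  by rewrite ?oppr_eq0 ?subr_eq0 gt_eqF.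
- rewrite (del u.1) // (del u.2) // (del2 v.2) // !mulr0 ?mulr1 ?addr0 ?add0r ?subr0 ?sub0r ?addr0.
  by rewrite ?oppr_eq0 ?subr_eq0 gt_eqF.
- rewrite (del u.1) // (del u.2) // (del v.1) // !mulr0 ?mulr1 ?addr0 ?add0r ?subr0 ?sub0r ?addr0.
  by rewrite ?oppr_eq0 ?subr_eq0 gt_eqF.
Qed.

(** If [w'] has an endpoint that [w] lacks, the indicator of that endpoint works. Otherwise both
    walls have the same four endpoints, paired differently into sides. *)
Lemma gap_independent w w' : w \in walls -> w' \in walls -> w != w' ->
  exists k : point3 R -> R, gap w k = 0 /\ gap w' k != 0.
Proof.
case: w w' => u v [u' v'] /wallsP[us vs uv ap [s [r cr]]] ww' ne.
have /wallsP[u's v's uv' ap' [s' [r' cr']]] := ww'.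
have /andP[s0 s1] := crossing_inside us vs ap cr.
have /andP[s'0 s'1] := crossing_inside u's v's ap' cr'.
have /andP[r'0 r'1] := crossing_inside v's u's (apart_sym ap') (crossing_at_sym cr').
pose supp := [:: u.1; u.2; v.1; v.2]; pose supp' := [:: u'.1; u'.2; v'.1; v'.2].
have [/hasP[p p' pn]|/hasPn sub] := boolP (has (fun p => p \notin supp) supp').
  exists (fun x => (x == p)%:R); split; last exact: gap_delta.
  rewrite (gapE _ us vs ap cr); move: pn; rewrite !inE !negb_or ![p == _]eq_sym.
  by move=> /and4P[/negbTE-> /negbTE-> /negbTE-> /negbTE->]; rewrite !mulr0 !addr0 subr0.
have same : supp' =i supp.
  apply: (uniq_min_size ap' _ _).2 => // x x'; apply/negPn; exact: sub.
(* The values at [u.1] and [u.2] cancel at the crossing of [w]. In [w'] these two points belong to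
   different strands, so their contributions have the same sign there. *)
pose k x : R := s * (x == u.1)%:R - (1 - s) * (x == u.2)%:R.
have [uf1 uf2 un u1 u2] := side_facts us.
move: (ap); rewrite /apart /= !inE !negb_or andbT => /and3P[/and3P[_ h2 h3] /andP[h4 h5] h6].
have kE x : k x = if x == u.1 then s else if x == u.2 then - (1 - s) else 0.
  rewrite /k; have [->|_] := eqVneq x u.1; first by rewrite (negbTE un) mulr0 mulr1 subr0.
  by case: eqP => _; rewrite ?mulr0 ?mulr1 ?subr0 ?sub0r.
exists k; split.
  rewrite (gapE _ us vs ap cr) !kE !eqxx (eq_sym u.2) (negbTE un).
  rewrite !(eq_sym _ u.1) !(eq_sym _ u.2) (negbTE h2) (negbTE h3) (negbTE h4) (negbTE h5).
  by ring.
have i1 : u.1 \in supp' by rewrite same !inE eqxx.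
have i2 : u.2 \in supp' by rewrite same !inE eqxx orbT.
have inVw x : x \in supp -> x \notin [fset u.1; u.2]%fset -> x \in [:: v.1; v.2].
  by rewrite !inE => /or4P[]->; rewrite ?orbT.
have supp'E x : (x \in supp') = (x \in [fset u'.1; u'.2]%fset) || (x \in [fset v'.1; v'.2]%fset).
  by rewrite !inE orbA.
have H2 : (v.1 == u.1) = false by rewrite eq_sym (negbTE h2).
have H3 : (v.2 == u.1) = false by rewrite eq_sym (negbTE h3).
have H4 : (v.1 == u.2) = false by rewrite eq_sym (negbTE h4).
have H5 : (v.2 == u.2) = false by rewrite eq_sym (negbTE h5).
have pair_eq y z : u.1 \in [fset y; z]%fset -> u.2 \in [fset y; z]%fset ->
    [fset u.1; u.2]%fset = [fset y; z]%fset :> edge R.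
  rewrite !inE => /orP[/eqP z1|/eqP z1] /orP[/eqP z2|/eqP z2]; rewrite z1 z2 //.
  - by move: un; rewrite z1 z2 eqxx.
  - exact: fset2C.
  - by move: un; rewrite z1 z2 eqxx.
have rest (y z : point3 R * point3 R) : (forall x, (x \in supp') = (x \in [fset y.1; y.2]%fset) || (x \in [fset z.1; z.2]%fset)) ->
    [fset u.1; u.2]%fset = [fset y.1; y.2]%fset :> edge R -> [fset v.1; v.2]%fset = [fset z.1; z.2]%fset :> edge R.
  move=> yz uy; have vz x : x \in [:: v.1; v.2] -> x \in [fset z.1; z.2]%fset.
    move=> xv; have : x \in supp' by rewrite same !inE; move: xv; rewrite !inE => /orP[] ->; rewrite ?orbT.
    rewrite yz -uy => /orP[|//]; rewrite !inE; move: xv.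
    by rewrite !inE => /orP[] /eqP ->; rewrite ?H2 ?H3 ?H4 ?H5.
  have := vz v.1 (mem_head _ _); have := vz v.2; rewrite !inE eqxx orbT => /(_ isT).
  move=> /orP[/eqP z2|/eqP z2] /orP[/eqP z1|/eqP z1]; rewrite z1 z2 //.
  - by move: h6; rewrite z1 z2 eqxx.
  - exact: fset2C.
  - by move: h6; rewrite z1 z2 eqxx.
have samepair : u.1 \in [fset u'.1; u'.2]%fset -> u.2 \in [fset u'.1; u'.2]%fset -> False.
  move=> m1 m2; have uu : [fset u.1; u.2]%fset = [fset u'.1; u'.2]%fset :> edge R by exact: pair_eq.
  have vv := rest _ _ supp'E uu.
  by move: ne; rewrite (side_inj us u's uu) (side_inj vs v's vv) eqxx.
have swapped : u.1 \in [fset v'.1; v'.2]%fset -> u.2 \in [fset v'.1; v'.2]%fset -> False.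
  move=> m1 m2; have uu : [fset u.1; u.2]%fset = [fset v'.1; v'.2]%fset :> edge R by exact: pair_eq.
  have vv : [fset v.1; v.2]%fset = [fset u'.1; u'.2]%fset :> edge R.
    by apply: rest uu => x; rewrite supp'E orbC.
  by move: uv'; rewrite -(side_inj us v's uu) -(side_inj vs u's vv) ltnNge (ltnW uv).
have P k1 k2 : 0 < k1 -> 0 < k2 -> 0 < k1 * s + k2 * (1 - s).
  by move=> ? ?; rewrite addr_gt0 ?mulr_gt0 // subr_gt0.
have s'1' : 0 < 1 - s' by rewrite subr_gt0.
have r'1' : 0 < 1 - r' by rewrite subr_gt0.
rewrite (gapE _ u's v's ap' cr').
move: (ap'); rewrite /apart /= !inE !negb_or andbT => /and3P[/and3P[g1 g2 g3] /andP[g4 g5] g6].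
have sym x y : x != y -> (x == y) = false /\ (y == x) = false.
  by move=> h; split; [exact: negbTE|rewrite eq_sym; exact: negbTE].
have [[G1 G1'] [G2 G2'] [G3 G3']] := And3 (sym _ _ g1) (sym _ _ g2) (sym _ _ g3).
have [[G4 G4'] [G5 G5'] [G6 G6']] := And3 (sym _ _ g4) (sym _ _ g5) (sym _ _ g6).
move: i1 i2; rewrite !supp'E => /orP[m1|m1] /orP[m2|m2].
- by case: (samepair m1 m2).
- move: m1 m2; rewrite !inE => /orP[]/eqP e1 /orP[]/eqP e2; rewrite !kE e1 e2 ?eqxx ?G1 ?G1' ?G2 ?G2' ?G3 ?G3' ?G4 ?G4' ?G5 ?G5' ?G6 ?G6'.
  + by rewrite (_ : _ - _ = (1 - s') * s + (1 - r') * (1 - s)); [rewrite gt_eqF ?P|ring].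
  + by rewrite (_ : _ - _ = (1 - s') * s + r' * (1 - s)); [rewrite gt_eqF ?P|ring].
  + by rewrite (_ : _ - _ = s' * s + (1 - r') * (1 - s)); [rewrite gt_eqF ?P|ring].
  + by rewrite (_ : _ - _ = s' * s + r' * (1 - s)); [rewrite gt_eqF ?P|ring].
- move: m1 m2; rewrite !inE => /orP[]/eqP e1 /orP[]/eqP e2; rewrite !kE e1 e2 ?eqxx ?G1 ?G1' ?G2 ?G2' ?G3 ?G3' ?G4 ?G4' ?G5 ?G5' ?G6 ?G6'.
  + by rewrite (_ : _ - _ = - ((1 - r') * s + (1 - s') * (1 - s))); [rewrite oppr_eq0 gt_eqF ?P|ring].
  + by rewrite (_ : _ - _ = - ((1 - r') * s + s' * (1 - s))); [rewrite oppr_eq0 gt_eqF ?P|ring].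
  + by rewrite (_ : _ - _ = - (r' * s + (1 - s') * (1 - s))); [rewrite oppr_eq0 gt_eqF ?P|ring].
  + by rewrite (_ : _ - _ = - (r' * s + s' * (1 - s))); [rewrite oppr_eq0 gt_eqF ?P|ring].
- by case: (swapped m1 m2).
Qed.
End Walls.

Section LiftDiagrams.
Variable R : realType.
Implicit Types (a b c d p q x y z : point3 R) (e f : edge R) (K : link R 2).
Implicit Types (h : point3 R -> R).
Variable L : 'I_2 -> seq (point3 R).
Hypothesis pL : planar L.
Implicit Types (u v : point3 R * point3 R).
Local Notation walls := (walls L).

Lemma lift_conv h a b (s : R) : flat a -> flat b ->
  [/\ segment (hlift h a) (hlift h b) ((1 - s) *: hlift h a + s *: hlift h b) \/ ~ (0 <= s <= 1),
   pr ((1 - s) *: hlift h a + s *: hlift h b) = (1 - s) *: a + s *: b &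
   ((1 - s) *: hlift h a + s *: hlift h b) 0 2 = (1 - s) * h a + s * h b].
Proof.
move=> af bf; split; last by rewrite !mxE.
  by case: (boolP (0 <= s <= 1)) => h01; [left; exists s|right].
by rewrite project_conv ?subrK // !pr_lift.
Qed.

Lemma lift_meet h u v x y : u \in sides L -> v \in sides L -> apart u v ->
  segment (hlift h u.1) (hlift h u.2) x -> segment (hlift h v.1) (hlift h v.2) y -> pr x = pr y ->
  exists s r, crossing_at u v s r /\ gap (u, v) h = x 0 2 - y 0 2.
Proof.
move=> us vs ap [s s01 xE] [r r01 yE] xy.
have [uf1 uf2 _ _ _] := side_facts pL us; have [vf1 vf2 _ _ _] := side_facts pL vs.
have [_ px hx] := lift_conv h s uf1 uf2; have [_ py hy] := lift_conv h r vf1 vf2.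
have cr : crossing_at u v s r by split=> //; rewrite -px -py -xE -yE.
by exists s, r; split=> //; rewrite (gapE pL h us vs ap cr) xE yE hx hy.
Qed.

Lemma lift_point h u (s : R) : u \in sides L -> 0 <= s <= 1 ->
  exists x, [/\ segment (hlift h u.1) (hlift h u.2) x, pr x = (1 - s) *: u.1 + s *: u.2
    & x 0 2 = (1 - s) * h u.1 + s * h u.2].
Proof.
move=> us s01; have [uf1 uf2 _ _ _] := side_facts pL us.
have [[xs|//] px hx] := lift_conv h s uf1 uf2.
by eexists; split; [exact: xs|exact: px|exact: hx].
Qed.

Lemma lift_embeddedP h : lift_embedded L h <-> off_walls walls (@gap R) h.
Proof.
split=> [emb [u v] /(wallsP L)[us vs _ ap [s [r cr]]]|nd i j a b c d x ab cd ap xab xcd].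
  apply/eqP; rewrite (gapE pL h us vs ap cr) => g0.
  have [s01 r01 e] := cr.
  have [x [xu px hx]] := lift_point h us s01; have [y [yv py hy]] := lift_point h vs r01.
  have xy : x = y.
    have pxy : pr x = pr y by rewrite px py.
    have h0 := congr1 (fun z => z 0 0) pxy; have h1 := congr1 (fun z => z 0 1) pxy.
    move: h0 h1; rewrite !prE !mxE /= => h0 h1.
    by apply: point3P => //; rewrite hx hy; apply/eqP; rewrite -subr_eq0 g0.
  have [i ui] := elimT (sidesP L u) us; have [j vj] := elimT (sidesP L v) vs.
  case: u v ui vj ap xu yv {us vs cr g0 s01 r01 e px hx py hy} => a b [c d] ab cd ap /= xu yv.
  by apply: (emb i j a b c d x ab cd ap xu); rewrite xy.
have us : (a, b) \in sides L by apply/(sidesP L); exists i.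
have vs : (c, d) \in sides L by apply/(sidesP L); exists j.
have [s [r [cr]]] := lift_meet us vs ap xab xcd erefl; rewrite subrr => g0.
case: (wall_either us vs ap cr) => /nd; rewrite ?(gapN pL h us vs ap cr) ?g0 ?oppr0 eqxx //.
Qed.

(** Edges are unordered, so the relation quantifies over both ways to name their endpoints. *)
Definition lift_over h e f : bool := `[< exists u v x y,
  [/\ e = [fset u.1; u.2]%fset, f = [fset v.1; v.2]%fset,
      segment (hlift h u.1) (hlift h u.2) x, segment (hlift h v.1) (hlift h v.2) y
    & pr x = pr y /\ y 0 2 < x 0 2] >].

Definition lift_diagram h : diagram R 2 := Diagram (hplane R) L (lift_over h).

Lemma segment_same_pair (g : point3 R -> point3 R) u v x :
  [fset u.1; u.2]%fset = [fset v.1; v.2]%fset :> edge R ->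
  segment (g u.1) (g u.2) x -> segment (g v.1) (g v.2) x.
Proof. by move=> /fset2_inj[[-> ->]|[-> ->]] //; rewrite segmentC. Qed.

Lemma lift_overE h u v s r : u \in sides L -> v \in sides L -> apart u v ->
  crossing_at u v s r ->
  lift_over h [fset u.1; u.2]%fset [fset v.1; v.2]%fset = (0 < gap (u, v) h).
Proof.
move=> us vs ap cr; apply/asboolP/idP => [[u' [v' [x [y [eu ev xu yv [xy lt]]]]]]|g0].
  have xu' := segment_same_pair (g := hlift h) (esym eu) xu.
  have yv' := segment_same_pair (g := hlift h) (esym ev) yv.
  by have [_ [_ [_ ->]]] := lift_meet us vs ap xu' yv' xy; rewrite subr_gt0.
have [s01 r01 e] := cr; rewrite (gapE pL h us vs ap cr) subr_gt0 in g0.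
have [x [xu px hx]] := lift_point h us s01; have [y [yv py hy]] := lift_point h vs r01.
by exists u, v, x, y; rewrite px py hx hy; split.
Qed.

Lemma lift_crossing h i j e f x : crossing (lift_diagram h) i j e f x ->
  exists u v s r, [/\ u \in cyc (L i), v \in cyc (L j), e = [fset u.1; u.2]%fset,
    f = [fset v.1; v.2]%fset & [/\ apart u v, crossing_at u v s r & x = (1 - s) *: u.1 + s *: u.2]].
Proof.
move=> [/= /closed_edgesP[u ui eE] /closed_edgesP[v vj fE] ne [[xe xne] [xf xnf]]].
have us : u \in sides L by apply/(sidesP L); exists i.
have vs : v \in sides L by apply/(sidesP L); exists j.
have [uf1 uf2 un u1 u2] := side_facts pL us; have [vf1 vf2 vn v1 v2] := side_facts pL vs.
have [_ ncV _] := planar_general pL.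
rewrite eE edge_pointsE in xe; rewrite fE edge_pointsE in xf.
have shared p : p \in [fset u.1; u.2]%fset -> p \in [fset v.1; v.2]%fset -> False.
  move=> pu pv; apply: xne => /=; rewrite eE.
  suff -> : x = p by [].
  apply/eqP/negPn/negP => xp; case/eqP: ne; rewrite eE fE.
  have end_in y z q : q \in [fset y; z]%fset -> segment y z q.
    by rewrite !inE => /orP[] /eqP ->; [exact: segment_l|exact: segment_r].
  exact: (two_points ncV u1 u2 v1 v2 un vn xp xe (end_in _ _ _ pu) xf (end_in _ _ _ pv)).
have [s s01 xE] := xe; have [r r01 xE'] := xf.
exists u, v, s, r; split=> //; split=> //; last by split=> //; rewrite -xE.
rewrite /apart /= !inE !negb_or un vn andbT /=.
have neq p q : p \in [fset u.1; u.2]%fset -> q \in [fset v.1; v.2]%fset -> p != q.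
  by move=> pu qv; apply/eqP => pq; apply: (shared p) => //; rewrite pq.
by rewrite !neq // !inE eqxx ?orbT.
Qed.

Lemma lift_strand h K i u x : is_lift L h K -> u \in cyc (L i) ->
  strand (hplane R) K i [fset u.1; u.2]%fset x <-> segment (hlift h u.1) (hlift h u.2) x.
Proof.
move=> lK ui; have us : u \in sides L by apply/(sidesP L); exists i.
have [uf1 uf2 un u1 u2] := side_facts pL us; have [_ ncV _] := planar_general pL.
split=> [[g [gK sub xg]]|xu].
  move: gK sub xg; rewrite lK => /lift_edgeP[a [b [ab ->]]] /within_image.
  have [af bf abn ai bi] := cyc_flat pL ab.
  rewrite /within !pr_lift // !edge_pointsE => sub.
  have [ha hb] := in_edge_segment sub.
  have e : [fset a; b]%fset = [fset u.1; u.2]%fset :> edge R.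
    by apply: (two_points ncV (lift_mem ai) (lift_mem bi) u1 u2 abn un abn) => //;
      [exact: segment_l|exact: segment_r].
  exact: (segment_same_pair (u := (a, b)) (g := hlift h)).
exists [fset hlift h u.1; hlift h u.2]%fset; split.
- by rewrite lK; apply/closed_edgesP; exists (hlift h u.1, hlift h u.2) => //;
    rewrite /cyc cyc_map; apply/mapP; exists u.
- by apply/within_image; rewrite /within !pr_lift // edge_pointsE.
- by rewrite edge_pointsE.
Qed.

Lemma dot_e3 x : dot x (normal (hplane R)) = x 0 2.
Proof. by rewrite dotE !mxE /=; ring. Qed.

Lemma lift_diagram_of h K : is_lift L h K -> diagram_of (lift_diagram h) K.
Proof.
move=> lK; split.
- have [uV ncV ntV] := planar_general pL.
  by split=> /=; rewrite ?enum_ord2 /= ?cats0 //; exact: planar_size.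
- move=> i; exists (map (hlift h) (L i)); have [uw _ _] := lift_polygon h i pL.
  split=> //=; rewrite -map_comp map_id_in; first exact: subdivision_refl.
  by move=> q qi /=; rewrite pr_lift //; exact: (planar_flat pL qi).
- move=> i j e f x cr; have [u [v [s [r [ui vj eE fE [ap crs xE]]]]]] := lift_crossing cr.
  have us : u \in sides L by apply/(sidesP L); exists i.
  have vs : v \in sides L by apply/(sidesP L); exists j.
  rewrite /= eE fE (lift_overE h us vs ap crs); split=> [g0|[y [z [ys zs yx zx]]]].
    have [s01 r01 e1] := crs; rewrite (gapE pL h us vs ap crs) subr_gt0 in g0.
    have [y [yu py hy]] := lift_point h us s01; have [z [zv pz hz]] := lift_point h vs r01.
    exists y, z; rewrite !dot_e3 py pz hy hz -e1 -xE; split=> //.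
      exact/(lift_strand _ lK ui).
    exact/(lift_strand _ lK vj).
  rewrite !dot_e3 => lt.
  have yu := (lift_strand y lK ui).1 ys; have zv := (lift_strand z lK vj).1 zs.
  have yz : pr y = pr z by rewrite yx zx.
  by have [_ [_ [_ ->]]] := lift_meet us vs ap yu zv yz; rewrite subr_gt0.
Qed.

Variable Good : link R 2 -> Prop.
Hypothesis good_crossing : forall Kp Km Dp Dm i j e f x,
  diagram_of Dp Kp -> diagram_of Dm Km -> crossing Dp i j e f x ->
  crossing_change Dp Dm e f -> Good Kp <-> Good Km.

(** A lift of [L] with heights [h] is unique by [link_ext]; the universal quantifier gives the
    property a meaning for all heights, embedded or not. *)
Definition good_lift h := forall K, is_lift L h K -> Good K.

Lemma good_liftE h K : is_lift L h K -> good_lift h <-> Good K.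
Proof.
move=> lK; split=> [/(_ _ lK)//|g K' lK'].
by rewrite (_ : K' = K) //; apply: link_ext => i; rewrite lK lK'.
Qed.

(** The over-under information at a crossing is the sign of its gap, so heights that differ in the
    sign of one gap only have diagrams that differ by one crossing change. *)
Lemma good_wall_crossing h h' w : off_walls walls (@gap R) h -> off_walls walls (@gap R) h' ->
  w \in walls ->
  (forall w', w' \in walls -> ((0 < gap w' h) != (0 < gap w' h')) = (w' == w)) ->
  good_lift h <-> good_lift h'.
Proof.
move=> nh nh' ww flip.
have [K lK] := lift_link pL ((lift_embeddedP h).2 nh).
have [K' lK'] := lift_link pL ((lift_embeddedP h').2 nh').
rewrite (good_liftE lK) (good_liftE lK').
case: w ww flip => u v ww flip.
have /(wallsP L)[us vs _ ap [s [r cr]]] := ww.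
have [i ui] := elimT (sidesP L u) us; have [j vj] := elimT (sidesP L v) vs.
have sgn (x y : R) : x != 0 -> y != 0 -> (0 < x) != (0 < y) -> (0 < y) = (0 < - x) /\ (0 < - y) = (0 < x).
  rewrite !oppr_gt0 => x0 y0; case: (ltgtP 0 x) x0 => // hx _; by case: (ltgtP 0 y) y0.
have sgn' (x y : R) : x != 0 -> y != 0 -> (0 < x) = (0 < y) -> (0 < - y) = (0 < - x).
  rewrite !oppr_gt0 => x0 y0; case: (ltgtP 0 x) x0 => // hx _; by case: (ltgtP 0 y) y0.
have ap' := apart_sym ap; have cr' := crossing_at_sym cr.
have fl : (0 < gap (u, v) h) != (0 < gap (u, v) h') by rewrite flip.
have [s1 s2] := sgn _ _ (nh _ ww) (nh' _ ww) fl.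
have [s01 r01 e] := cr.
have [/andP[s0' s1'] /andP[r0' r1']] :=
  (crossing_inside pL us vs ap cr, crossing_inside pL vs us ap' cr').
have inside p q (k : R) : p != q -> 0 < k < 1 -> (1 - k) *: p + k *: q \notin [fset p; q]%fset.
  move=> pq /andP[k0 k1]; rewrite !inE negb_or; apply/andP; split; apply/eqP => ek.
    have : k = 0 by apply: (segment_param pq); rewrite ek subr0 scale1r scale0r addr0.
    by move=> kz; rewrite kz ltxx in k0.
  have : k = 1 by apply: (segment_param pq); rewrite ek subrr scale1r scale0r add0r.
  by move=> kz; rewrite kz ltxx in k1.
have [_ _ un _ _] := side_facts pL us; have [_ _ vn _ _] := side_facts pL vs.
apply: (good_crossing (i := i) (j := j) (e := [fset u.1; u.2]%fset) (f := [fset v.1; v.2]%fset)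
  (x := (1 - s) *: u.1 + s *: u.2) (lift_diagram_of lK) (lift_diagram_of lK')).
- split; rewrite /=.
  + by apply/closed_edgesP; exists u.
  + by apply/closed_edgesP; exists v.
  + exact: (apart_neq pL us vs ap).
  + split; split; rewrite /= ?edge_pointsE; [by exists s|apply/negP; apply: inside => //; exact/andP|
      by rewrite e; exists r|rewrite e; apply/negP; apply: inside => //; exact/andP].
- split=> //=.
  + rewrite (lift_overE h' us vs ap cr) (lift_overE h vs us ap' cr').
    by rewrite (gapN pL h us vs ap cr).
  + rewrite (lift_overE h' vs us ap' cr') (lift_overE h us vs ap cr).
    by rewrite (gapN pL h' us vs ap cr).
  + move=> k l e' f' x' crx ne.
    have [u' [v' [s' [r' [u'k v'l eE fE [apx crs xE]]]]]] := lift_crossing crx.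
    have us' : u' \in sides L by apply/(sidesP L); exists k.
    have vs' : v' \in sides L by apply/(sidesP L); exists l.
    rewrite eE fE !(lift_overE _ us' vs' apx crs).
    rewrite eE fE in ne.
    have same w' : w' \in walls -> w' != (u, v) -> (0 < gap w' h) = (0 < gap w' h').
      by move=> w'w /negbTE w'n; have := flip _ w'w; rewrite w'n => /negbFE /eqP.
    (* Any other crossing is recorded as a wall in one of its two orders. In the reversed order the
       gaps change sign for both height functions, so the comparison is unaffected. *)
    case: (wall_either us' vs' apx crs) => w'w.
      rewrite same //; apply: contra_neq ne => -[-> ->] //.
    have n1 : (v', u') != (u, v) by apply: contra_neq ne => -[-> ->]; rewrite fsetUC.
    have := gapN pL h us' vs' apx crs; have := gapN pL h' us' vs' apx crs.
    move=> /(congr1 (-%R)); rewrite opprK => <- /(congr1 (-%R)); rewrite opprK => <-.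
    by apply: sgn'; [exact: nh|exact: nh'|exact: same].
Qed.

Lemma good_lift_equiv h h' : walls != [::] -> lift_embedded L h -> lift_embedded L h' ->
  good_lift h <-> good_lift h'.
Proof.
move=> w0 /lift_embeddedP nh /lift_embeddedP nh'.
apply: (chambers_equivalent (l := @gap R) _ _ good_wall_crossing (walls_uniq pL) w0 nh nh').
  exact: gap_linear.
exact: (gap_independent pL).
Qed.
End LiftDiagrams.

(** * Diagrams without crossings *)

Section VerticalMoves.
Variable R : realType.
Implicit Types (a b c d p q x y z : point3 R) (e f : edge R) (K : link R 2).
Implicit Types (h : point3 R -> R).
Variable L : 'I_2 -> seq (point3 R).
Hypothesis pL : planar L.
Hypothesis no_walls : walls L = [::].

Lemma no_walls_embedded h : lift_embedded L h.
Proof. by apply/(lift_embeddedP pL) => w; rewrite no_walls. Qed.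

(** Without crossings, a point of the link over a side belongs to the lift of that side or lies over
    a common end. *)
Lemma no_walls_above h i j a b p q x : (a, b) \in cyc (L i) -> (p, q) \in cyc (L j) ->
  segment a b (pr x) -> segment (hlift h p) (hlift h q) x -> segment (hlift h a) (hlift h b) x.
Proof.
move=> ab pq xab xpq.
have [af bf abn ai bi] := cyc_flat pL ab; have [pf qf pqn pj qj] := cyc_flat pL pq.
have abs : (a, b) \in sides L by apply/(sidesP L); exists i.
have pqs : (p, q) \in sides L by apply/(sidesP L); exists j.
have [e|ne] := eqVneq [fset p; q]%fset [fset a; b]%fset.
  exact: (segment_same_pair (u := (p, q)) (v := (a, b)) (g := hlift h) e xpq).
have shared r : r \in [fset p; q]%fset -> r \in [fset a; b]%fset -> segment (hlift h a) (hlift h b) x.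
  move=> rp ra; rewrite (lift_shared pL pq ab rp ra ne xpq xab).
  by move: ra; rewrite !inE => /orP[] /eqP ->; [exact: segment_l|exact: segment_r].
have [pa|pa] := eqVneq p a; first by apply: (shared p); rewrite !inE ?pa eqxx.
have [pb|pb] := eqVneq p b; first by apply: (shared p); rewrite !inE ?pb eqxx ?orbT.
have [qa|qa] := eqVneq q a; first by apply: (shared q); rewrite !inE ?qa eqxx ?orbT.
have [qb|qb] := eqVneq q b; first by apply: (shared q); rewrite !inE ?qb eqxx ?orbT.
have ap : apart (p, q) (a, b) by rewrite /apart /= !inE !negb_or pqn pa pb qa qb abn.
have xpq' := lift_segment_pr pf qf xpq.
have [s s01 xE] := xpq'; have [r r01 xE'] := xab.
have cr : crossing_at (p, q) (a, b) s r by split=> //=; rewrite -xE -xE'.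
by case: (wall_either pqs abs ap cr); rewrite no_walls.
Qed.

(** [vertex_move] with [C'] above or below [C]. Both triangles are vertical, hence project into the
    sides at [c], and by [no_walls_above] they meet the link only along the lifts of these sides. *)
Lemma vertical_move h i c (k : R) K : is_lift L h K -> c \in L i ->
  exists2 K', isotopic K K' & is_lift L (fun q => if q == c then k else h q) K'.
Proof.
move=> lK ci; pose h' q := if q == c then k else h q.
suff [K' iso lK'] : exists2 K', isotopic K K' & is_lift L h' K' by exists K'.
have outside q : q != c -> hlift h' q = hlift h q by move=> qc; rewrite /hlift /h' (negbTE qc).
have other j : j != i -> map (hlift h') (L j) = map (hlift h) (L j).
  move=> ji; apply/eq_in_map => q qj; apply: outside.
  by apply: contraNneq ji => qc; apply/eqP; apply: (planar_disjoint pL qj); rewrite qc.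
have [kc|kc] := eqVneq k (h c).
  exists K; first exact: rst_refl.
  move=> j; rewrite lK; congr closed_edges; apply/esym/eq_in_map => q _.
  by rewrite /hlift /h'; case: eqP => // ->; rewrite kc.
have uL := planar_uniq i pL; have sL := planar_size pL i.
have [m w rE] := rot_to ci.
case: w rE => [|b s] rE; first by move: sL; rewrite -(size_rot m) rE.
have uw : uniq [:: c, b & s] by rewrite -rE rot_uniq.
have pK : polygon (K i) [:: hlift h c, hlift h b & map (hlift h) s].
  have := polygon_rot m (lift_polygon h i pL); rewrite -lK -map_rot rE; exact.
pose a := last b s.
have aE : last (hlift h b) (map (hlift h) s) = hlift h a by rewrite last_map.
have sn : s != [::] by move: sL; rewrite -(size_rot m) rE; case: (s).
have cb : (c, b) \in cyc (L i).
  by rewrite -(perm_mem (cyc_rot m (L i))) rE cyc_cons2 mem_head.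
have ac : (a, c) \in cyc (L i).
  have : [fset a; c]%fset \in closed_edges (L i).
    by rewrite -(closed_edges_rot m) rE closed_edges_path eqxx !orbT.
  (* The edge determines only an unordered pair. In the reversed order [a] would be the successor
     [b] of [c], which repeats a vertex. *)
  move=> /closed_edgesP[[p q] pq /fset2_inj[[-> ->] //|[e1 e2]]]; rewrite /= in e1 e2.
  have qb : q = b by apply: (cyc_next uL (a := c)) => //; rewrite e2.
  have : uniq (b :: s) by move: uw => /andP[].
  rewrite cons_uniq => /andP[bs _]; case/negP: bs.
  by rewrite -qb -e1 /a; case: (s) sn => //= y t _; exact: mem_last.
have [af cf acn _ _] := cyc_flat pL ac; have [_ bf cbn _ bi] := cyc_flat pL cb.
have ai : a \in L i by have [] := mem_cyc ac.
have [_ ncV _] := planar_general pL.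
have ab : [fset a; c]%fset != [fset c; b]%fset :> edge R.
  apply/eqP => /fset2_inj[[e1 _]|[e1 _]]; first by rewrite e1 eqxx in acn.
  have : uniq (b :: s) by move: uw => /andP[].
  rewrite cons_uniq => /andP[bs _]; case/negP: bs.
  by rewrite -e1 /a; case: (s) sn => //= y t _; exact: mem_last.
have C'E : hlift h' c = vec (c 0 0) (c 0 1) k by rewrite /hlift /h' eqxx.
set C' := hlift h' c.
have prC' : pr C' = c by rewrite pr_lift.
have prT p q r1 r2 r3 y z w : pr y = p -> pr z = q -> pr w = q -> r1 + r2 + r3 = 1 :> R ->
    pr (r1 *: y + r2 *: z + r3 *: w) = r1 *: p + (r2 + r3) *: q.
  move=> <- <- zw rr; rewrite !prE; move: zw; rewrite !prE => zw.
  have e0 := congr1 (fun x => x 0 0) zw; have e1 := congr1 (fun x => x 0 1) zw.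
  rewrite !mxE /= in e0 e1.
  by apply: point3P; rewrite !mxE /= ?e0 ?e1; ring.
have offC q (l : R) : flat q -> q != c -> C' != hlift h q + l *: (hlift h c - hlift h q).
  move=> qf qc; apply/eqP => e.
  have e' : hlift h q + l *: (hlift h c - hlift h q) = (1 - l) *: hlift h q + l *: hlift h c.
    by apply/rowP => t; rewrite !mxE; ring.
  have : pr C' = (1 - l) *: q + l *: c by rewrite e e' project_conv ?subrK // !pr_lift.
  rewrite prC' => cE; have l1 : l = 1.
    by apply: (segment_param qc); rewrite -cE subrr scale0r scale1r add0r.
  move: e; rewrite e' l1 subrr scale0r scale1r add0r => /(congr1 (fun x => x 0 2)).
  by rewrite /C' C'E !mxE /= => kh; rewrite kh eqxx in kc.
have bc : b != c by rewrite eq_sym.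
have onK x : link_points K x -> exists j p q, (p, q) \in cyc (L j) /\ segment (hlift h p) (hlift h q) x.
  move=> [j [e]]; rewrite lK => /lift_edgeP[p [q [pq ->]]]; rewrite edge_pointsE => xs.
  by exists j, p, q.
have [||||| K' [iso pK' oth]] := @vertex_move R K i (hlift h c) (hlift h b) _ C' pK.
- rewrite aE => x [r1 [r2 [r3 [r10 r20 r30 rr xE]]]] /onK[j [p [q [pq xpq]]]].
  apply: (no_walls_above ac pq) xpq; apply/segmentP; exists r1, (r2 + r3).
  split=> //; [by rewrite addr_ge0|by rewrite addrA|].
  by rewrite xE; apply: prT => //; rewrite pr_lift.
- move=> x [r1 [r2 [r3 [r10 r20 r30 rr xE]]]] /onK[j [p [q [pq xpq]]]].
  apply: (no_walls_above cb pq) xpq; rewrite segmentC; apply/segmentP; exists r2, (r3 + r1).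
  split=> //; [by rewrite addr_ge0|by lra|].
  have -> : x = r2 *: hlift h b + r3 *: hlift h c + r1 *: C'.
    by rewrite xE; apply/rowP => t; rewrite !mxE; ring.
  by apply: prT; rewrite ?pr_lift //; lra.
- rewrite aE => x [r1 [r2 [r3 [r10 r20 r30 rr xE]]]] [l1 [l2 [l3 [l10 l20 l30 ll xE']]]].
  have px : pr x = r1 *: a + (r2 + r3) *: c by rewrite xE; apply: prT; rewrite ?pr_lift.
  have px' : pr x = l2 *: b + (l3 + l1) *: c.
    have -> : x = l2 *: hlift h b + l3 *: hlift h c + l1 *: C'.
      by rewrite xE'; apply/rowP => t; rewrite !mxE; ring.
    by apply: prT; rewrite ?pr_lift //; lra.
  have pxac : segment a c (pr x).
    by rewrite px; apply/segmentP; exists r1, (r2 + r3); split=> //; [rewrite addr_ge0|rewrite addrA].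
  have pxcb : segment c b (pr x).
    by rewrite px' segmentC; apply/segmentP; exists l2, (l3 + l1); split=> //; [rewrite addr_ge0|lra].
  have pxc : pr x = c.
    apply/eqP/negPn/negP => pxn; case/eqP: ab.
    by apply: (two_points ncV (lift_mem ai) (lift_mem ci) (lift_mem ci) (lift_mem bi) acn cbn pxn pxac (segment_r _ _) pxcb (segment_l _ _)).
  have r1z : r1 = 0.
    have : 1 - r1 = 1.
      apply: (segment_param acn); rewrite subrr scale0r scale1r add0r subKr -[RHS]pxc px.
      by rewrite (_ : r2 + r3 = 1 - r1) // -rr; ring.
    lra.
  apply/segmentP; exists r3, r2; split=> //; first by lra.
  by rewrite xE r1z scale0r add0r addrC.
- by rewrite aE => l; exact: offC.
- move=> l; have := offC b (1 - l) bf bc; apply: contra_neq => ->.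
  by apply/rowP => t; rewrite !mxE; ring.
exists K' => // j; have [->|ji] := eqVneq j i; last by rewrite oth // lK other.
have [_ _ ->] := pK'; rewrite -[RHS](closed_edges_rot m) -map_rot rE /= -/C'.
have nc : c \notin b :: s by move: uw => /andP[].
rewrite outside //; congr (closed_edges [:: _, _ & _]).
apply/eq_in_map => q qs; apply/esym/outside.
by apply: contraNneq nc => <-; rewrite inE qs orbT.
Qed.
End VerticalMoves.

Section FlatDiagrams.
Variable R : realType.
Variable L : 'I_2 -> seq (point3 R).
Hypotheses (pL : planar L) (no_walls : walls L = [::]).
Variable Good : link R 2 -> Prop.
Hypothesis good_isotopic : forall K K', isotopic K K' -> Good K <-> Good K'.

(* chambers_equivalent is void in the absence of walls, so the heights are changed
   one vertex at a time, by isotopies. *)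
Lemma good_lift_flat h h' : good_lift L Good h <-> good_lift L Good h'.
Proof.
pose mix (s : seq (point3 R)) (q : point3 R) : R := if q \in s then h' q else h q.
have step (s : seq (point3 R)) : {subset s <= L ord0 ++ L ord_max} ->
    good_lift L Good h <-> good_lift L Good (mix s).
  elim: s => [|c s IH] sub; first by rewrite (_ : mix [::] = h) //; apply/funext.
  rewrite IH; last by move=> x xs; apply: sub; rewrite inE xs orbT.
  have [i ci] : exists i, c \in L i.
    by have := sub c (mem_head _ _); rewrite mem_cat => /orP[] h1; [exists ord0|exists ord_max].
  have [K lK] := lift_link pL (@no_walls_embedded _ _ pL no_walls (mix s)).
  have [K' iso lK'] := vertical_move pL no_walls (h' c) lK ci.
  rewrite (good_liftE Good lK) (good_isotopic iso) -(good_liftE Good lK').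
  rewrite (_ : (fun q => _) = mix (c :: s)) //; apply/funext => q.
  by rewrite /mix inE; case: eqP => [->|].
rewrite (step (L ord0 ++ L ord_max)) //.
have E i : map (hlift (mix (L ord0 ++ L ord_max))) (L i) = map (hlift h') (L i).
  by apply/eq_in_map => q /lift_mem qV; rewrite /hlift /mix qV.
by split=> g K lK; apply: g => i; rewrite lK E.
Qed.
End FlatDiagrams.

(** * Removal of a vertex *)

Section TopHeights.
Variable R : realType.
Implicit Types (a b c d p q x y z : point3 R) (h : point3 R -> R).
Implicit Types (L : 'I_2 -> seq (point3 R)).
Variables (V T : seq (point3 R)).

(* Heights outside T are distinct powers of one parameter, so that each gap is a
   nonzero polynomial in it. *)
Definition depth q : {poly R} := if q \in T then 0 else - 'X^((index q V).+1).

Definition gap_poly (uv : (point3 R * point3 R) * (point3 R * point3 R)) : {poly R} :=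
  let: (s, r) := crossing_param uv.1 uv.2 in
  (1 - s) *: depth uv.1.1 + s *: depth uv.1.2 - ((1 - r) *: depth uv.2.1 + r *: depth uv.2.2).

Lemma horner_gap w t : (gap_poly w).[t] = gap w (fun q => (depth q).[t]).
Proof. by rewrite /gap_poly /gap; case: crossing_param => s r; rewrite !hornerE. Qed.

Lemma coef_gap w k : (gap_poly w)`_k = gap w (fun q => (depth q)`_k).
Proof. by rewrite /gap_poly /gap; case: crossing_param => s r; rewrite !coefE. Qed.

(** A crossing has four distinct endpoints, so one of them, [p], is outside [T]. The coefficient at
    the power assigned to [p] is, up to sign, the gap of the indicator of [p], nonzero by
    [gap_delta]. *)
Lemma gap_poly_neq0 L w : planar L -> {subset L ord0 ++ L ord_max <= V} ->
  (size T < 4)%N -> w \in walls L -> gap_poly w != 0.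
Proof.
case: w => u v pL sub sT ww; have /(wallsP L)[us vs _ ap [s [r cr]]] := ww.
have [/hasP[p p' pn]|/hasPn no] := boolP (has (fun p => p \notin T) [:: u.1; u.2; v.1; v.2]); last first.
  have := uniq_leq_size ap (s2 := T); rewrite leqNgt sT => h4.
  by suff : ~~ true by []; apply: h4 => x /no; rewrite negbK.
have [_ _ _ u1 u2] := side_facts pL us; have [_ _ _ v1 v2] := side_facts pL vs.
have dE q : q \in V -> (depth q)`_(index p V).+1 = - (q == p)%:R.
  move=> qV; rewrite /depth; case: ifP => qT.
    by rewrite coef0 (_ : q == p = false) ?oppr0 //; apply: contraNF pn => /eqP <-.
  rewrite coefN coefXn eqSS; congr (- (nat_of_bool _)%:R).
  apply/eqP/eqP => [e|-> //]; have pV : p \in V by rewrite -index_mem e index_mem.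
  by rewrite -[LHS](nth_index p qV) -e nth_index.
have := gap_delta pL ww p'; apply: contra_neq => g0.
have : (gap_poly (u, v))`_(index p V).+1 = 0 by rewrite g0 coef0.
rewrite coef_gap !(gapE pL _ us vs ap cr) /= !dE ?sub // => e.
by apply: oppr_inj; rewrite oppr0 -e; ring.
Qed.

(** One parameter serves both arrangements, so that the same heights give a link before and after
    the removal of a vertex. *)
Lemma top_heights L L' : planar L -> planar L' ->
  {subset L ord0 ++ L ord_max <= V} -> {subset L' ord0 ++ L' ord_max <= V} -> (size T < 4)%N ->
  exists h, [/\ {in T, forall q, h q = 0}, forall q, q \notin T -> h q < 0,
                lift_embedded L h & lift_embedded L' h].
Proof.
move=> pL pL' sub sub' sT.
have [|t /andP[t0 _] /allP roots] := @avoid_roots R (map gap_poly (walls L ++ walls L')) 1 ltr01.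
  apply/allP => _ /mapP[w + ->]; rewrite mem_cat => /orP[] ww.
    exact: (gap_poly_neq0 pL).
  exact: (gap_poly_neq0 pL').
exists (fun q => (depth q).[t]); split=> [q qT|q qT||].
- by rewrite /depth qT horner0.
- by rewrite /depth (negbTE qT) !hornerE oppr_lt0 exprn_gt0.
- apply/(lift_embeddedP pL) => w ww; rewrite -horner_gap.
  by apply: roots; rewrite map_f // mem_cat ww.
- apply/(lift_embeddedP pL') => w ww; rewrite -horner_gap.
  by apply: roots; rewrite map_f // mem_cat ww orbT.
Qed.
End TopHeights.

Section VertexRemoval.
Variable R : realType.
Implicit Types (p q x : point3 R) (h : point3 R -> R) (K : link R 2).
Variables (L : 'I_2 -> seq (point3 R)) (i : 'I_2) (a b c d : point3 R) (s : seq (point3 R)).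
Hypotheses (pL : planar L) (LE : L i = [:: a, c, b, d & s]).

Definition remove_vertex j := if j == i then [:: a, b, d & s] else L j.

Lemma remove_vertex_sub j : subseq (remove_vertex j) (L j).
Proof.
rewrite /remove_vertex; case: eqP => // ->; rewrite LE.
by rewrite -[X in subseq X](cat1s a) -[X in subseq _ X](cat1s a) cat_subseq // subseq_cons.
Qed.

Lemma remove_vertex_mem : {subset remove_vertex ord0 ++ remove_vertex ord_max <= L ord0 ++ L ord_max}.
Proof. by apply: mem_subseq; rewrite cat_subseq ?remove_vertex_sub. Qed.

Lemma remove_vertex_planar : planar remove_vertex.
Proof.
have [sL fL gL] := pL; split=> [j|j q qj|].
- by rewrite /remove_vertex; case: eqP.
- exact: (fL j _ (mem_subseq (remove_vertex_sub j) qj)).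
- apply: general_position_sub gL; first exact: remove_vertex_mem.
  apply: (subseq_uniq (s2 := L ord0 ++ L ord_max)); first by rewrite cat_subseq ?remove_vertex_sub.
  by have [] := planar_general pL.
Qed.

(** The triangle lies at height 0 and the link nowhere above it. A point of the link at height 0 is
    a top vertex or lies on an edge with two top ends, and the only such edges are the two that are
    replaced. *)
Lemma remove_vertex_isotopic h K K' :
  {in [:: a; b; c], forall q, h q = 0} -> (forall q, q \notin [:: a; b; c] -> h q < 0) ->
  is_lift L h K -> is_lift remove_vertex h K' -> isotopic K K'.
Proof.
move=> top below lK lK'; apply: rst_step.
have uL := planar_uniq i pL; rewrite LE in uL.
have ac : (a, c) \in cyc (L i) by rewrite LE cyc_cons2 mem_head.
have cb : (c, b) \in cyc (L i) by rewrite LE cyc_cons2 /= !inE eqxx orbT.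
have bd : (b, d) \in cyc (L i) by rewrite LE cyc_cons2 /= !inE eqxx !orbT.
have edge p q : (p, q) \in cyc (L i) -> [fset hlift h p; hlift h q]%fset \in K i.
  move=> pq; rewrite lK; apply: mem_closed_edges.
  by rewrite /cyc cyc_map; apply/mapP; exists (p, q).
(* The component has a fourth vertex, which lies below. Otherwise the edge leaving [b] could return
   to [a] at height 0. *)
have dT : d \notin [:: a; b; c].
  move: uL; rewrite /= !inE !negb_or => /and4P[/and4P[_ _ h1 _] /and3P[_ h2 _] /andP[h3 _] _].
  by rewrite ![d == _]eq_sym h1 h2 h3.
have Ti q : q \in [:: a; b; c] -> q \in L i.
  by rewrite LE !inE => /or3P[] ->; rewrite ?orbT.
have corner q x : q \in [:: a; b; c] -> x = hlift h q ->
    (segment (hlift h a) (hlift h c) `|` segment (hlift h c) (hlift h b)) x.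
  rewrite !inE => + ->; case/or3P => /eqP ->.
  - by left; exact: segment_l.
  - by right; exact: segment_r.
  - by left; exact: segment_r.
exists i, (hlift h a), (hlift h b), (hlift h c); split.
- exact: edge.
- exact: edge.
- move=> x [[j [e]]]; rewrite lK => /lift_edgeP[p [q [pq ->]]]; rewrite edge_pointsE => xs.
  move=> [r1 [r2 [r3 [_ _ _ _ xE]]]].
  have x0 : x 0 2 = 0.
    by rewrite xE !mxE /= !top ?inE ?eqxx ?orbT // !mulr0 !addr0.
  have [t /andP[t0 t1] xE'] := xs.
  have ht : (1 - t) * h p + t * h q = 0 by rewrite -x0 xE' !mxE.
  have [pT|pT] := boolP (p \in [:: a; b; c]); have [qT|qT] := boolP (q \in [:: a; b; c]).
  + have ij : i = j by apply: (planar_disjoint pL (Ti _ pT)); have [] := mem_cyc pq.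
    subst j; have uLi := planar_uniq i pL.
    move: (pT); rewrite !inE => /or3P[] /eqP pE; rewrite {}pE in pq xs.
    * by left; rewrite (cyc_next uLi ac pq).
    * by move: dT; rewrite (cyc_next uLi bd pq) qT.
    * by right; rewrite (cyc_next uLi cb pq).
  + move: ht; rewrite (top p) // mulr0 add0r => /eqP; rewrite mulf_eq0 (lt_eqF (below _ qT)) orbF => /eqP tz.
    by apply: (corner p) => //; rewrite xE' tz subr0 scale1r scale0r addr0.
  + move: ht; rewrite (top q) // mulr0 addr0 => /eqP; rewrite mulf_eq0 (lt_eqF (below _ pT)) orbF subr_eq0.
    by move=> /eqP tz; apply: (corner q) => //; rewrite xE' -tz subrr scale1r scale0r add0r.
  + have := below _ pT; have := below _ qT => hq hp; suff : (1 - t) * h p + t * h q < 0 by rewrite ht ltxx.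
    have [->|tn] := eqVneq t 0; first by rewrite subr0 mul1r mul0r addr0.
    have tp : 0 < t by rewrite lt_neqAle eq_sym tn.
    by rewrite -(addr0 0) ler_ltD ?nmulr_llt0 // nmulr_lle0 // subr_ge0.
- have uM : uniq [:: hlift h a, hlift h c, hlift h b, hlift h d & map (hlift h) s].
    have := lift_polygon h i pL; rewrite LE => -[]; by [].
  rewrite lK lK' /remove_vertex eqxx LE /=.
  move: uM; set A := hlift h a; set B := hlift h b; set C := hlift h c.
  move: (hlift h d :: _) => S uM; apply/fsetP => e.
  have -> : e \in closed_edges [:: A, B & S] = [|| e == [fset A; B]%fset, e \in path_edges B S | e == [fset last B S; A]%fset].
    exact: closed_edges_path.
  rewrite !(in_fsetU, in_fsetD, in_fset1, in_fset2) closed_edges_path.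
  have -> : (e \in path_edges C (B :: S)) = (e == [fset C; B]%fset) || (e \in path_edges B S) by rewrite inE.
  rewrite (_ : last C (B :: S) = last B S) //.
  have [_|eAB] := eqVneq e [fset A; B]%fset; first by [].
  have lB := mem_last B S.
  move: uM => /= /andP[A1 /andP[C1 _]].
  have AC : A != C by apply: contraNneq A1 => ->; exact: mem_head.
  have AB : A != B by apply: contraNneq A1 => ->; rewrite !inE eqxx orbT.
  have lC : last B S != C by apply: contraNneq C1 => <-.
  have [pe|pe] := boolP (e \in path_edges B S).
    rewrite !orbT andbT negb_or; apply/esym/andP; split; apply: contraNneq C1 => eE;
      by apply: (path_edges_mem pe); rewrite eE !inE eqxx ?orbT.
  have [-> /=|le] := eqVneq e [fset last B S; A]%fset.
    rewrite !orbT andbT negb_or; apply/esym/andP; split; apply/eqP => /fset2_inj[[e1 e2]|[e1 e2]].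
    + by rewrite e2 eqxx in AC.
    + by rewrite e1 eqxx in lC.
    + by rewrite e1 eqxx in lC.
    + by rewrite e2 eqxx in AC.
  by rewrite !orbF; case: (_ || _).
- by move=> j ji; rewrite lK lK' /remove_vertex (negbTE ji).
Qed.
End VertexRemoval.

(** * Reduction of every link to the trivial one *)

Section Unknotting.
Variable R : realType.
Variable Good : link R 2 -> Prop.
Hypothesis good_isotopic : forall K K', isotopic K K' -> Good K <-> Good K'.
Hypothesis good_crossing : forall Kp Km Dp Dm i j e f x,
  diagram_of Dp Kp -> diagram_of Dm Km -> crossing Dp i j e f x ->
  crossing_change Dp Dm e f -> Good Kp <-> Good Km.
Hypothesis good_trivial : forall K, trivial_link K -> Good K.

Lemma good_lift_any (L : 'I_2 -> seq (point3 R)) h h' : planar L -> lift_embedded L h -> lift_embedded L h' ->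
  good_lift L Good h <-> good_lift L Good h'.
Proof.
move=> pL eh eh'; have [w0|w0] := eqVneq (walls L) [::].
  exact: good_lift_flat.
exact: good_lift_equiv.
Qed.

(** The components are put at heights 0 and 1. Two sides of one triangle always share an end, so
    only sides of different components need to be compared. *)
Lemma triangles_trivial (L : 'I_2 -> seq (point3 R)) : planar L -> (forall i, size (L i) = 3) ->
  exists h, lift_embedded L h /\ forall K, is_lift L h K -> trivial_link K.
Proof.
move=> pL sL; pose h (q : point3 R) : R := (q \notin L ord0)%:R.
have hE i q : q \in L i -> h q = (i != ord0)%:R.
  move=> qi; rewrite /h; congr (nat_of_bool (~~ _))%:R; apply/idP/eqP => [q0|<- //].
  exact: (planar_disjoint pL qi q0).
exists h; split=> [i j a b c d x ab cd ap|K lK].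
  have [ai bi] := mem_cyc ab; have [cj dj] := mem_cyc cd.
  have [ij|ij] := eqVneq i j.
    subst j; have := uniq_leq_size ap (s2 := L i); rewrite sL ltnn => h4 _ _.
    by suff : false by []; apply: h4 => y; rewrite !inE => /or4P[] /eqP ->.
  move=> [s _ xE] [r _ xE']; have := congr1 (fun z : point3 R => z 0 2) xE; rewrite {1}xE' !mxE /=.
  rewrite (hE j) // (hE j d) // (hE i) // (hE i b) // -!mulrDl !subrK !mul1r.
  move/eqP; rewrite eqr_nat; move: ij.
  by case: (i =P ord0) => [->|/eqP/ord2_max ->]; case: (j =P ord0) => [->|/eqP/ord2_max ->].
exists (normal (hplane R)), (fun i => (i != ord0)%:R); split=> [||i].
- exact: normal_neq0.
- move=> i j /eqP; rewrite eqr_nat.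
  by case: (i =P ord0) => [->|/eqP/ord2_max ->]; case: (j =P ord0) => [->|/eqP/ord2_max ->].
- have := sL i; case E : (L i) => [|a [|b [|c []]]] // _; exists (hlift h a), (hlift h b), (hlift h c).
  by rewrite !dot_e3 lK E !mxE /= !(hE i) ?E ?inE ?eqxx ?orbT.
Qed.

(** Induction on the number of vertices. By [good_lift_any] the given heights may be replaced by
    those that make a vertex removable or, when both components are triangles, by those that make
    the link trivial. *)
Lemma planar_good (L : 'I_2 -> seq (point3 R)) h : planar L -> lift_embedded L h -> good_lift L Good h.
Proof.
have [n] := ubnP (size (L ord0) + size (L ord_max)); elim: n L h => // n IH L h szL pL eh.
have [[i si]|no] := pselect (exists i, (3 < size (L i))%N); last first.
  have sL i : size (L i) = 3.
    by apply/eqP; rewrite eqn_leq planar_size // andbT leqNgt; apply/negP => si; apply: no; exists i.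
  have [h0 [eh0 triv]] := triangles_trivial pL sL.
  by apply/(good_lift_any pL eh eh0) => K /triv /good_trivial.
case LE : (L i) si => [|a [|c [|b [|d s]]]] // _.
have pL' := remove_vertex_planar pL LE.
have [h0 [top below eh0 eh0']] := @top_heights R (L ord0 ++ L ord_max) [:: a; b; c] _ _ pL pL'
  (fun _ => id) (remove_vertex_mem LE) isT.
apply/(good_lift_any pL eh eh0).
have [K lK] := lift_link pL eh0; have [K' lK'] := lift_link pL' eh0'.
apply/(good_liftE Good lK)/(good_isotopic (remove_vertex_isotopic pL LE top below lK lK')).
apply/(good_liftE Good lK')/IH => //.
rewrite -ltnS; apply: leq_trans szL; rewrite ltnS /remove_vertex.
by case: (i =P ord0) LE => [->|/eqP/ord2_max->] -> /=; rewrite ?addSn ?addnS.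
Qed.

Lemma all_good K : Good K.
Proof.
have [K' [W [iso pW gW]]] := perturb_link K.
have [h [pL lK' eh]] := link_lift pW gW.
by apply/(good_isotopic iso); exact: (planar_good pL eh).
Qed.
End Unknotting.

Theorem theorem4p4 (R : realType) :
  exists! lk2 : link R 2 -> 'Z_2,
    [/\ forall K K' : link R 2, isotopic K K' -> lk2 K = lk2 K',
        forall K : link R 2, trivial_link K -> lk2 K = 0%R
      & forall (Kp Km : link R 2) (Dp Dm : diagram R 2)
               (i j : 'I_2) (e f : edge R) (A : point3 R),
          diagram_of Dp Kp -> diagram_of Dm Km ->
          crossing Dp i j e f A -> crossing_change Dp Dm e f ->
          (lk2 Kp - lk2 Km)%R = if i != j then 1%R else 0%R].
Proof.
exists (@lk2 R); split.
  split=> [K K' iso|K triv|]; last exact: lk2_crossing_change.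
    by rewrite /lk2 (isotopic_lk iso).
  by rewrite /lk2 trivial_lk.
(* The unknotting argument is applied to the property [lk2 K = g K]. *)
move=> g [isog trivg crossg]; apply/funext; apply: all_good.
- by move=> K K' iso; rewrite /lk2 (isotopic_lk iso) (isog _ _ iso).
- move=> Kp Km Dp Dm i j e f x dp dm cr ch.
  have := crossg _ _ _ _ _ _ _ _ _ dp dm cr ch.
  rewrite -(lk2_crossing_change dp dm cr ch) => E.
  (* Both functions jump by the same amount at a crossing change, so their difference is
     unchanged. *)
  have E' : lk2 Kp - g Kp = lk2 Km - g Km by rewrite -(subrK (lk2 Km) (lk2 Kp)) -E; ring.
  by split=> /eqP; rewrite -subr_eq0 => z; apply/eqP; rewrite -subr_eq0 ?E' // -E'.
- by move=> K triv; rewrite /lk2 trivial_lk // trivg.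
Qed.
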